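(* For every integer $d\ge 1$, the spectral truncations of the torus $\mathbb{T}^d$ converge in the following sense: as $\Lambda\to\infty$, the metric spaces $\big(\mathcal{S}(\mathrm{C}(\mathbb{T}^d)^{(\Lambda)}),d_\Lambda\big)$ converge in Gromov--Hausdorff distance to the metric space $\big(\mathcal{S}(\mathrm{C}(\mathbb{T}^d)),d\big)$.
   Context: $\mathbb{T}^d=\mathbb{R}^d/2\pi\mathbb{Z}^d$. Let $V=\mathbb{C}^{2^{\lfloor d/2\rfloor}}$ and let $\gamma^1,\dots,\gamma^d$ be self-adjoint matrices on $V$ with $\gamma^\mu\gamma^\nu+\gamma^\nu\gamma^\mu=2\delta^{\mu\nu}\mathbf{1}$. Let $\mathcal{H}=\mathrm{L}^2(\mathbb{T}^d)\otimes V$ and $e_n(x)=e^{in\cdot x}$ for $n\in\mathbb{Z}^d$. Functions $f\in\mathrm{C}(\mathbb{T}^d)$ act on $\mathcal{H}$ by multiplication on the first factor. The Dirac operator is the self-adjoint operator $D=-i\sum_{\mu=1}^d\partial_\mu\otimes\gamma^\mu$, so $D(e_n\otimes v)=\sum_\mu n_\mu e_n\otimes\gamma^\mu v$. For $\Lambda\ge 0$, $P_\Lambda$ is the orthogonal projection of $\mathcal{H}$ onto the span of the eigenspaces of $D$ for eigenvalues $\lambda$ with $|\lambda|\le\Lambda$; its range is $P_\Lambda\mathcal{H}=\mathrm{span}\{e_n : n\in\mathbb{Z}^d,\ \|n\|\le\Lambda\}\otimes V$ ($\|\cdot\|$ the Euclidean norm). Put $\mathrm{C}(\mathbb{T}^d)^{(\Lambda)}=P_\Lambda\mathrm{C}^\infty(\mathbb{T}^d)P_\Lambda=\{P_\Lambda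 fP_\Lambda : f\in\mathrm{C}^\infty(\mathbb{T}^d)\}$, an operator system in $\mathcal{B}(P_\Lambda\mathcal{H})$, and $D_\Lambda=P_\Lambda DP_\Lambda$. For a unital operator system (or C*-algebra) $E$, $\mathcal{S}(E)$ denotes its state space, i.e. the set of positive unital linear functionals. Connes' distance functions are $$d_\Lambda(\varphi,\psi)=\sup\{|\varphi(T)-\psi(T)| : T\in\mathrm{C}(\mathbb{T}^d)^{(\Lambda)},\ \|[D_\Lambda,T]\|=1\},\qquad \varphi,\psi\in\mathcal{S}(\mathrm{C}(\mathbb{T}^d)^{(\Lambda)}),$$ $$d(\varphi,\psi)=\sup\{|\varphi(f)-\psi(f)| : f\in\mathrm{C}^\infty(\mathbb{T}^d),\ \|[D,f]\|=1\},\qquad \varphi,\psi\in\mathcal{S}(\mathrm{C}(\mathbb{T}^d)),$$ with operator norms on the right (a supremum over the empty set being $0$). The states of $\mathrm{C}(\mathbb{T}^d)$ are the Borel probability measures on $\mathbb{T}^d$, and $d$ is the Monge--Kantorovich distance for the usual Riemannian distance on $\mathbb{T}^d$. *)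

(* Defs.v *)
From HB Require Import structures.
From mathcomp Require Import all_boot all_order all_algebra.
From mathcomp Require Import all_classical all_reals all_analysis.
From mathcomp Require Import complex.

Set Implicit Arguments.
Unset Strict Implicit.
Unset Printing Implicit Defensive.

Import Order.TTheory GRing.Theory Num.Theory.
Import numFieldNormedType.Exports.
Import Normc.

Local Open Scope classical_set_scope.
Local Open Scope complex_scope.
Local Open Scope ring_scope.

Section GromovHausdorff.
Context {R : realType}.

Definition hausdorff_dist (Z : metricType R) (A B : set Z) : \bar R :=
  ereal_inf [set r%:E | r in [set r : R | [/\ 0 <= r,
    forall a, A a -> exists2 b, B b & mdist a b <= r &
    forall b, B b -> exists2 a, A a & mdist a b <= r]]].

(* The distance functions are allowed to take the value +oo a priori; an
   isometric embedding into a metric space exists only for genuine metrics,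
   and the infimum over the empty set is +oo. *)
Definition isometric_embedding (X : Type) (dX : X -> X -> \bar R)
    (Z : metricType R) (f : X -> Z) : Prop :=
  forall x y, (mdist (f x) (f y))%:E = dX x y.

Definition gh_dist (X Y : Type) (dX : X -> X -> \bar R)
    (dY : Y -> Y -> \bar R) : \bar R :=
  ereal_inf [set e | exists (Z : metricType R) (f : X -> Z) (g : Y -> Z),
    [/\ isometric_embedding dX f, isometric_embedding dY g &
        e = hausdorff_dist (range f) (range g)]].

End GromovHausdorff.

(* An operator system is given by its elements E inside an ambient complex
   vector space, its positive elements and its unit. *)
Section States.
Context {R : realType} {V : lmodType R[i]}.

Definition is_state (E pos : set V) (one : V) (phi : set_type E -> R[i]) : Prop :=
  [/\ forall (a : R[i]) (S T U : set_type E),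
        set_val U = a *: set_val S + set_val T -> phi U = a * phi S + phi T,
      forall T : set_type E, pos (set_val T) -> 0 <= phi T &
      exists2 T : set_type E, set_val T = one & phi T = 1].

Definition state (E pos : set V) (one : V) : Type :=
  {phi : set_type E -> R[i] | is_state pos one phi}.

(* B is the set of elements whose commutator with the Dirac operator has norm
   one; adjoining 0 makes the supremum over the empty set equal to 0. *)
Definition connes_dist (E pos : set V) (one : V) (B : set V)
    (phi psi : state E pos one) : \bar R :=
  ereal_sup (0%E |` [set (normc (sval phi T - sval psi T))%:E
                    | T in [set T : set_type E | B (set_val T)]]).

End States.

Section Torus.
Context {R : realType}.

Lemma torus_period_gt0 : (0 : R) < 2 * pi.
Proof. by rewrite mulr_gt0 ?pi_gt0. Qed.

Definition torus_cons (d : nat) (p : measurableTypeR R * d.-tuple (measurableTypeR R)) :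
  d.+1.-tuple (measurableTypeR R) := [the d.+1.-tuple _ of p.1 :: p.2].

Lemma measurable_torus_cons d : measurable_fun [set: _] (@torus_cons d).
Proof. exact: measurable_cons. Qed.

HB.instance Definition _ d := @isMeasurableFun.Build _ _ _ _
  (@torus_cons d) (@measurable_torus_cons d).

(* The normalized Lebesgue measure of the fundamental domain [0, 2pi]^d *)
Fixpoint torus_measure (d : nat) : probability (d.-tuple (measurableTypeR R)) R :=
  match d with
  | 0 => dirac [tuple]
  | d'.+1 => distribution
      ((uniform_prob torus_period_gt0 \x torus_measure d')%E) (@torus_cons d')
  end.

End Torus.

Section Dirac.
Context {R : realType} {d : nat}.

Local Notation C := R[i].
Local Notation mu := (@torus_measure R d).

(* Functions on T^d are (2 pi Z)^d-periodic functions on R^d. *)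
Definition torus_periodic (f : 'rV[R]_d -> C^o) : Prop :=
  forall (n : 'rV[int]_d) x, f (x + (2 * pi) *: map_mx intr n) = f x.

Definition torus_continuous : set ('rV[R]_d -> C^o) :=
  [set f | [/\ torus_periodic f, continuous (fun x => complex.Re (f x)) &
                           continuous (fun x => complex.Im (f x))]].

Fixpoint Ck (k : nat) (g : 'rV[R]_d -> R^o) : Prop :=
  continuous g /\
  match k with
  | 0 => True
  | k'.+1 => forall i : 'I_d, (forall x, derivable g x ('e_i)) /\
                              Ck k' (fun x => 'D_('e_i) g x)
  end.

Definition torus_smooth : set ('rV[R]_d -> C^o) :=
  [set f | torus_periodic f /\ forall k, Ck k (fun x => complex.Re (f x)) /\
                                   Ck k (fun x => complex.Im (f x))].

Definition torus_nonneg : set ('rV[R]_d -> C^o) :=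
  [set f | forall x, 0 <= (f x : C)].

(* Spinor fields are functions to V on the fundamental domain [0, 2pi]^d, which
   carries torus_measure; they are not quotiented by almost everywhere
   equality, so operators that are only determined almost everywhere, such as
   the Dirac operator, are represented by their graphs. *)
Definition spinor : Type := d.-tuple (measurableTypeR R) -> 'cV[C]_(2 ^ d./2).

Definition row_of (t : d.-tuple (measurableTypeR R)) : 'rV[R]_d :=
  \row_i (tnth t i : R).

Definition cintegral (h : d.-tuple (measurableTypeR R) -> C) : C :=
  (\int[mu]_t complex.Re (h t))%R +i* (\int[mu]_t complex.Im (h t))%R.

Definition vnorm (v : 'cV[C]_(2 ^ d./2)) : R :=
  Num.sqrt (\sum_k normc (v k 0) ^+ 2).

Definition L2norm (xi : spinor) : \bar R :=
  Lnorm mu 2%:E (fun t => (vnorm (xi t))%:E).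

Definition L2spinor : set spinor :=
  [set xi : spinor | (forall k, measurable_fun setT (fun t => complex.Re (xi t k 0)) /\
                       measurable_fun setT (fun t => complex.Im (xi t k 0))) /\
            (L2norm xi < +oo)%E].

Definition inner (xi eta : spinor) : C :=
  cintegral (fun t => \sum_k conjc (xi t k 0) * eta t k 0).

Definition mult (f : 'rV[R]_d -> C^o) (xi : spinor) : spinor :=
  fun t => (f (row_of t) : C) *: xi t.

Definition expi (n : 'rV[int]_d) (t : d.-tuple (measurableTypeR R)) : C :=
  let nt : R := \sum_i (n 0 i)%:~R * tnth t i in cos nt +i* sin nt.

Definition fourier (xi : spinor) (n : 'rV[int]_d) : 'cV[C]_(2 ^ d./2) :=
  \col_k cintegral (fun t => conjc (expi n t) * xi t k 0).

Definition clifford (gam : 'I_d -> 'M[C]_(2 ^ d./2)) : Prop :=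
  (forall m, map_mx (@conjc R) (gam m)^T = gam m) /\
  (forall m n, gam m *m gam n + gam n *m gam m = (2 * (m == n)%:R)%:M).

Definition operator_graph : Type := set (spinor * spinor).

(* The graph of the self-adjoint operator D: the closure of
   e_n (x) v |-> sum_m n_m e_n (x) gam_m v, described in the orthonormal
   system (e_n), i.e. with domain the xi for which the right-hand sides are
   the Fourier coefficients of some eta in L^2. *)
Definition dirac_graph (gam : 'I_d -> 'M[C]_(2 ^ d./2)) : operator_graph :=
  [set p | [/\ L2spinor p.1, L2spinor p.2 & forall n : 'rV[int]_d,
     fourier p.2 n = \sum_m (n 0 m)%:~R *: (gam m *m fourier p.1 n)]].

(* The commutator [G, T] on the domain of those xi in dom G with T xi in dom G *)
Definition commutator (G : operator_graph) (T : spinor -> spinor) :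
    operator_graph :=
  [set p | exists eta zeta,
     [/\ G (p.1, eta), G (T p.1, zeta) & p.2 = zeta - T eta]].

Definition opnorm (G : operator_graph) : \bar R :=
  ereal_sup [set L2norm p.2 | p in [set p | G p /\ (L2norm p.1 <= 1)%E]].

(* The orthogonal projection P_L onto span {e_n : ||n|| <= L} (x) V, the sum of
   the eigenspaces of D for the eigenvalues in [-L, L]: D squares to ||n||^2 on
   e_n (x) V. Fourier coefficients do not see null sets, so unlike D it is an
   honest function of xi. *)
Definition proj (L : R) (xi : spinor) : spinor := fun t =>
  \sum_(n \in [set n : 'rV[int]_d |
                Num.sqrt (\sum_i ((n 0 i)%:~R : R) ^+ 2) <= L])
     expi n t *: fourier xi n.

Definition proj_range (L : R) : set spinor := proj L @` L2spinor.

Definition truncated_dirac (gam : 'I_d -> 'M[C]_(2 ^ d./2)) (L : R) :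
    operator_graph :=
  [set p | proj_range L p.1 /\
     exists2 zeta, dirac_graph gam (proj L p.1, zeta) & p.2 = proj L zeta].

(* Operators on proj_range L are represented as operators T with P_L T P_L = T. *)
Definition truncation (L : R) : set (spinor -> spinor) :=
  [set (proj L \o mult f \o proj L) | f in torus_smooth].

Definition nonneg_on (L : R) : set (spinor -> spinor) :=
  [set T : spinor -> spinor | forall xi, proj_range L xi -> 0 <= inner xi (T xi)].

Definition torus_state : Type :=
  state torus_continuous torus_nonneg (cst 1).

Definition truncated_state (L : R) : Type :=
  state (truncation L) (nonneg_on L) (proj L).

Definition torus_dist (gam : 'I_d -> 'M[C]_(2 ^ d./2)) :
    torus_state -> torus_state -> \bar R :=
  connes_dist
    [set f | torus_smooth f /\ opnorm (commutator (dirac_graph gam) (mult f)) = 1%E].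

Definition truncated_dist (gam : 'I_d -> 'M[C]_(2 ^ d./2)) (L : R) :
    truncated_state L -> truncated_state L -> \bar R :=
  connes_dist
    [set T | opnorm (commutator (truncated_dirac gam L) T) = 1%E].

End Dirac.

(* Main.v *)
Require Import Defs.
From HB Require Import structures.
From mathcomp Require Import all_boot all_order all_algebra.
From mathcomp Require Import all_classical all_reals all_analysis.
From mathcomp Require Import measurable_realfun complex ring lra.

Set Implicit Arguments.
Unset Strict Implicit.
Unset Printing Implicit Defensive.

Import Order.TTheory GRing.Theory Num.Theory.
Import numFieldNormedType.Exports.
Import Normc.
Import Defs.

Local Open Scope classical_set_scope.
Local Open Scope complex_scope.
Local Open Scope ring_scope.

(** Truncated operators and functions on the torus are compared by two maps.
    Compression sends a function [f] to the operator [rho f = P f P].  In the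
    other direction let [p_x] be the translate by [x] of the normalized
    indicator vector of the box [{0, ..., m}^d] of Fourier modes, tensored with
    a fixed unit spinor; as soon as the box lies in the ball of radius [L], the
    symbol [sigma T] of a truncated operator [T] is the function
    [x |-> <p_x, T p_x>].  Both maps are linear, positive and unital, so they
    pull states back, and [sigma (rho f)] is the Fejer mean of [f].

    Neither map increases the Lipschitz seminorm [|[D, .]|].  For [rho] this is
    Bessel's inequality ([tlip_le_dlip]).  For [sigma], the commutator of [D]
    with a trigonometric polynomial is pointwise Clifford multiplication by its
    differential, and the matrix coefficients of that multiplication are matrix
    coefficients of the truncated commutator at translated box vectors
    ([dlip_fejer]).

    Both compositions are close to the identity on elements of Lipschitz
    seminorm at most one.  The Fejer kernel is a probability density whose
    integral against the sum of the [1 - cos (x_i - y_i)] is exactly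
    [d / (m + 1)], and a Lipschitz function oscillates by at most a small
    constant plus a multiple of that sum; hence Lipschitz functions are
    uniformly close to their Fejer means ([fejer_lip]).  For an operator
    [T = rho f] the same estimate is applied to the functions
    [x |-> <a_x, T a_x>], where [a_x] is the translate of a vector [a]:
    the Clifford relations express each of their partial derivatives through the
    commutator [[D, T]], so they are Lipschitz, and their Fejer mean at the
    origin is [<a, rho (sigma T) a>] ([qform_fejer_le]).

    Consequently the pullback of states along [rho] is a contraction from
    truncated states to torus states, it shrinks distances by at most a constant
    times the Fejer rate, and its image is dense up to the Fejer rate, because
    the pullback along [sigma] is an approximate right inverse.  Such a map
    gives a metric on the disjoint union of the two spaces ([bridge_dist]) in
    which they are Hausdorff close.  The rate tends to zero as [m] grows.

    That the two distances are finite and separate states comes from the same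
    estimates: the torus has finite diameter, Fejer means are dense, and
    commutators are bounded on the finite-dimensional truncated space.  The
    completeness of the characters, which identifies square-integrable spinor
    fields with their Fourier coefficients, is derived from the density of
    Fejer means and a Dynkin system argument. *)

(** * A Gromov-Hausdorff bound from a map of small distortion *)

Definition is_metric (R : realType) (X : Type) (r : X -> X -> R) : Prop :=
  [/\ forall x, r x x = 0, forall x y, r x y = 0 -> x = y,
      forall x y, r x y = r y x & forall y x z, r x z <= r x y + r y z].

Section Bridge.
Context {R : realType} (X Y : Type) (rX : X -> X -> R) (rY : Y -> Y -> R).
Variables (F : X -> Y) (e : R).

(** Crossing between the two spaces costs [e] plus the distance to the image
    under [F].  The triangle inequality needs [F] to be contractive for paths
    with one crossing, and to shrink distances by at most the cost [2 * e] of
    two crossings for paths from [X] through [Y] back to [X]. *)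
Definition bridge_dist (p q : X + Y) : R :=
  match p, q with
  | inl x, inl x' => rX x x'
  | inr y, inr y' => rY y y'
  | inl x, inr y => e + rY (F x) y
  | inr y, inl x => e + rY (F x) y
  end.

Hypotheses (e_gt0 : 0 < e) (mX : is_metric rX) (mY : is_metric rY).
Hypothesis F_contr : forall x x', rY (F x) (F x') <= rX x x'.
Hypothesis F_expand : forall x x', rX x x' <= rY (F x) (F x') + 2 * e.

Lemma is_metric_ge0 (Z : Type) (r : Z -> Z -> R) : is_metric r ->
  forall x y, 0 <= r x y.
Proof.
move=> [r0 _ rs rt] x y; have := rt y x x; rewrite r0 (rs y x); lra.
Qed.

Lemma bridge_dist_metric : is_metric bridge_dist.
Proof.
have Y0 := is_metric_ge0 mY.
case: mX mY => [X1 X2 X3 X4] [Y1 Y2 Y3 Y4]; split.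
- by case=> ? /=; rewrite ?X1 ?Y1.
- case=> [x|y] [x'|y'] /= h; first by rewrite (X2 _ _ h).
  + by exfalso; have := e_gt0; have := Y0 (F x) y'; lra.
  + by exfalso; have := e_gt0; have := Y0 (F x') y; lra.
  + by rewrite (Y2 _ _ h).
- by case=> [x|y] [x'|y'] /=.
- case=> [b|b] [a|a] [c|c] /=.
  + exact: X4.
  + by have := Y4 (F b) (F a) c; have := F_contr a b; lra.
  + by have := Y4 (F b) (F c) a; have := F_contr b c; rewrite (Y3 (F c) (F b)); lra.
  + by have := e_gt0; have := Y4 (F b) a c; rewrite (Y3 a (F b)); lra.
  + by have := F_expand a c; have := Y4 b (F a) (F c); rewrite (Y3 b (F c)); lra.
  + by have := Y4 b (F a) c; lra.
  + by have := Y4 b (F c) a; rewrite (Y3 b a); lra.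
  + exact: Y4.
Qed.

Definition bridge := (X + Y)%type.
HB.instance Definition _ := gen_eqMixin bridge.
HB.instance Definition _ := gen_choiceMixin bridge.

Let bridge_xx : forall p, bridge_dist p p = 0.
Proof. by case: bridge_dist_metric. Qed.
Let bridge_sep : forall p q, bridge_dist p q = 0 -> p = q.
Proof. by case: bridge_dist_metric. Qed.
Let bridge_sym : forall p q, bridge_dist p q = bridge_dist q p.
Proof. by case: bridge_dist_metric. Qed.
Let bridge_tri : forall q p r, bridge_dist p r <= bridge_dist p q + bridge_dist q r.
Proof. by case: bridge_dist_metric. Qed.

Definition bridge_metric : metricType R :=
  HB.pack bridge (isMetric.Build R bridge bridge_xx bridge_sep bridge_sym bridge_tri).

(** In the bridge metric a point of [X] is at distance [e] from its image, and a
    point of [Y] at distance at most [2 * e] from any point whose image is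
    [e]-close to it. *)
Lemma gh_dist_le (dX : X -> X -> \bar R) (dY : Y -> Y -> \bar R) :
  (forall x x', dX x x' = (rX x x')%:E) -> (forall y y', dY y y' = (rY y y')%:E) ->
  (forall y, exists x, rY (F x) y <= e) ->
  (gh_dist dX dY <= (2 * e)%:E)%E.
Proof.
move=> dXE dYE Fdense; apply: (@le_trans _ _
  (@hausdorff_dist R bridge_metric (range inl) (range inr))).
  apply: ereal_inf_lbound; exists bridge_metric, inl, inr.
  by split => // [x y|x y]; rewrite ?dXE ?dYE.
apply: ereal_inf_lbound; exists (2 * e) => //=; split.
- by rewrite mulr_ge0// ltW.
- move=> _ [x _ <-]; exists (inr (F x)); first by exists (F x).
  rewrite /mdist/=; case: mY => -> _ _ _; have := e_gt0; lra.
- move=> _ [y _ <-]; have [x xy] := Fdense y; exists (inl x); first by exists x.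
  rewrite /mdist/=; have := e_gt0; lra.
Qed.

End Bridge.

Lemma gh_dist_ge0 (R : realType) (X Y : Type) (dX : X -> X -> \bar R)
  (dY : Y -> Y -> \bar R) : (0 <= gh_dist dX dY)%E.
Proof.
apply: le_ereal_inf_tmp => _ [Z [f [g [_ _ ->]]]].
by apply: le_ereal_inf_tmp => _ [r [r0 _ _] <-]; rewrite lee_fin.
Qed.

(** * States and Connes' distance *)

Section States.
Context {R : realType} {V : lmodType R[i]} (E pos : set V) (one : V).
Implicit Types phi psi : state E pos one.

(** Extending a state by zero outside of its operator system spares the
    membership proofs that its own domain carries. *)
Definition state_val phi (v : V) : R[i] :=
  if pselect (E v) is left h then sval phi (exist _ v (mem_set h)) else 0.

Lemma state_valE phi (T : set_type E) : state_val phi (set_val T) = sval phi T.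
Proof.
rewrite /state_val; case: pselect => [h|]; last first.
  by case; apply: set_mem; exact: (valP T).
congr (sval phi _); apply: val_inj => //=.
Qed.

Lemma state_val_linear phi (a : R[i]) u v : E u -> E v -> E (a *: u + v) ->
  state_val phi (a *: u + v) = a * state_val phi u + state_val phi v.
Proof.
move=> Eu Ev Ew; rewrite /state_val; do 3![case: pselect => //= ?].
by case: (svalP phi) => + _ _; apply.
Qed.

Lemma state_val_ge0 phi v : E v -> pos v -> 0 <= state_val phi v.
Proof.
move=> Ev pv; rewrite /state_val; case: pselect => //= h.
by case: (svalP phi) => _ + _; apply.
Qed.

Lemma state_val_one phi : E one /\ state_val phi one = 1.
Proof.
case: (svalP phi) => _ _ [T TE T1]; rewrite -TE state_valE T1; split=> //.
by apply: set_mem; exact: (valP T).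
Qed.

Lemma state_ext phi psi : (forall v, E v -> state_val phi v = state_val psi v) -> phi = psi.
Proof.
move=> h; apply: eq_sig_hprop => [f|]; [exact: Prop_irrelevance|apply: funext => T].
have := h (set_val T); rewrite !state_valE; apply.
by apply: set_mem; exact: (valP T).
Qed.

(** Linearity is required only where both sides lie in the operator system, since
    the functionals of interest are defined through functions that represent its
    elements. *)
Lemma mk_state (F : V -> R[i]) :
  (forall a u v, E u -> E v -> E (a *: u + v) -> F (a *: u + v) = a * F u + F v) ->
  (forall v, E v -> pos v -> 0 <= F v) -> E one -> F one = 1 ->
  {phi : state E pos one | forall v, E v -> state_val phi v = F v}.
Proof.
move=> Flin Fpos E1 F1.
have EV (T : set_type E) : E (set_val T) by apply: set_mem; exact: (valP T).
have Fst : is_state pos one (fun T : set_type E => F (set_val T)).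
  split=> [a S T U UE|T|]; last by exists (exist _ one (mem_set E1)).
  - by rewrite UE Flin// -UE.
  - exact: Fpos.
exists (exist _ _ Fst) => v Ev; rewrite /state_val; case: pselect => //.
Qed.

Section Dist.
Variable B : set V.
Local Notation dist := (connes_dist (E:=E) (pos:=pos) (one:=one) B).

Lemma connes_dist_le phi psi (c : R) : 0 <= c ->
  (forall v, E v -> B v -> normc (state_val phi v - state_val psi v) <= c) ->
  (dist phi psi <= c%:E)%E.
Proof.
move=> c0 h; apply: ge_ereal_sup => _ [->|[T BT <-]]; first by rewrite lee_fin.
rewrite lee_fin -!state_valE; apply: h => //.
by apply: set_mem; exact: (valP T).
Qed.

Lemma connes_dist_ge0 phi psi : (0 <= dist phi psi)%E.
Proof. by apply: ereal_sup_ubound; left. Qed.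

Lemma le_connes_dist phi psi v : E v -> B v ->
  ((normc (state_val phi v - state_val psi v))%:E <= dist phi psi)%E.
Proof.
move=> Ev Bv; apply: ereal_sup_ubound; right.
exists (exist _ v (mem_set Ev)) => //=.
by rewrite -!state_valE.
Qed.

Hypothesis dist_fin : forall phi psi, (dist phi psi < +oo)%E.

Let dist_fin_num phi psi : dist phi psi \is a fin_num.
Proof. by rewrite ge0_fin_numE ?connes_dist_ge0. Qed.

(** Symmetry and the triangle inequality hold for every supremum of this kind;
    finiteness and separation depend on the seminorm. *)
Lemma connes_dist_metric :
  (forall phi psi, dist phi psi = 0%E -> phi = psi) ->
  is_metric (fun phi psi => fine (dist phi psi)).
Proof.
move=> sep.
have le_fine phi psi v : E v -> B v ->
    normc (state_val phi v - state_val psi v) <= fine (dist phi psi).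
  by move=> Ev Bv; rewrite -lee_fin fineK//; exact: le_connes_dist.
have fine_le phi psi c : 0 <= c ->
    (forall v, E v -> B v -> normc (state_val phi v - state_val psi v) <= c) ->
    fine (dist phi psi) <= c.
  by move=> c0 h; rewrite -lee_fin fineK//; exact: connes_dist_le.
have fine_ge0 phi psi : 0 <= fine (dist phi psi).
  by rewrite fine_ge0// connes_dist_ge0.
split.
- move=> phi; apply/eqP; rewrite eq_le fine_ge0 andbT; apply: fine_le => // v _ _.
  by rewrite subrr normc0.
- by move=> phi psi h; apply: sep; rewrite -[LHS]fineK// h.
- have sym phi psi : fine (dist phi psi) <= fine (dist psi phi).
    by apply: fine_le => // v Ev Bv; rewrite -normcN opprB le_fine.
  by move=> phi psi; apply/eqP; rewrite eq_le !sym.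
- move=> psi phi chi; apply: fine_le => [|v Ev Bv]; first by rewrite addr_ge0.
  rewrite -(subrK (state_val psi v) (state_val phi v)) -addrA.
  by rewrite (le_trans (le_normcD _ _))// lerD// le_fine.
Qed.

End Dist.
End States.

(** * Integration of complex functions on the torus *)

Section ComplexNumbers.
Context {R : realType}.
Implicit Types x y : R[i].

Lemma ReD x y : complex.Re (x + y) = complex.Re x + complex.Re y.
Proof. by case: x y => [a b] [c e]. Qed.
Lemma ImD x y : complex.Im (x + y) = complex.Im x + complex.Im y.
Proof. by case: x y => [a b] [c e]. Qed.
Lemma ReN x : complex.Re (- x) = - complex.Re x.
Proof. by case: x. Qed.
Lemma ImN x : complex.Im (- x) = - complex.Im x.
Proof. by case: x. Qed.
Lemma ReM x y : complex.Re (x * y) =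
  complex.Re x * complex.Re y - complex.Im x * complex.Im y.
Proof. by case: x y => [a b] [c e]. Qed.
Lemma ImM x y : complex.Im (x * y) =
  complex.Re x * complex.Im y + complex.Im x * complex.Re y.
Proof. by case: x y => [a b] [c e]. Qed.
Lemma Re_conj x : complex.Re (conjc x) = complex.Re x.
Proof. by case: x. Qed.
Lemma Im_conj x : complex.Im (conjc x) = - complex.Im x.
Proof. by case: x. Qed.
(** A rewriting system that pushes real and imaginary parts through the ring
    operations; complex identities are reduced to real ones with it. *)
Definition reimE := (ReD, ImD, ReN, ImN, ReM, ImM, Re_conj, Im_conj).

Lemma Re_sum I (s : seq I) (P : pred I) (F : I -> R[i]) :
  complex.Re (\sum_(i <- s | P i) F i) = \sum_(i <- s | P i) complex.Re (F i).
Proof. by apply: (big_morph (@complex.Re R) ReD). Qed.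
Lemma Im_sum I (s : seq I) (P : pred I) (F : I -> R[i]) :
  complex.Im (\sum_(i <- s | P i) F i) = \sum_(i <- s | P i) complex.Im (F i).
Proof. by apply: (big_morph (@complex.Im R) ImD). Qed.

Lemma complexP x y : complex.Re x = complex.Re y -> complex.Im x = complex.Im y -> x = y.
Proof. by case: x y => [a b] [c e] /= -> ->. Qed.

Lemma normc2E x : normc x ^+ 2 = complex.Re x ^+ 2 + complex.Im x ^+ 2.
Proof. by case: x => a b; rewrite /normc sqr_sqrtr// addr_ge0 ?sqr_ge0. Qed.

Lemma normc_ge0 x : 0 <= normc x.
Proof. by case: x => a b; rewrite sqrtr_ge0. Qed.

Lemma normc_Re x : `|complex.Re x| <= normc x.
Proof.
rewrite -(@ler_pXn2r _ 2)// ?nnegrE ?normc_ge0//.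
by rewrite normc2E real_normK ?num_real// lerDl sqr_ge0.
Qed.

Lemma normc_Im x : `|complex.Im x| <= normc x.
Proof.
rewrite -(@ler_pXn2r _ 2)// ?nnegrE ?normc_ge0//.
by rewrite normc2E real_normK ?num_real// lerDr sqr_ge0.
Qed.

Lemma normc_le_ReIm x : normc x <= `|complex.Re x| + `|complex.Im x|.
Proof.
rewrite -(@ler_pXn2r _ 2)// ?nnegrE ?normc_ge0 ?addr_ge0//.
rewrite normc2E sqrrD !real_normK ?num_real//.
rewrite -addrA lerD2l lerDr mulrn_wge0// mulr_ge0//.
Qed.

Lemma conjcM x y : conjc (x * y) = conjc x * conjc y.
Proof. exact: rmorphM. Qed.

Lemma conjc_sum I (s : seq I) (P : pred I) (F : I -> R[i]) :
  conjc (\sum_(i <- s | P i) F i) = \sum_(i <- s | P i) conjc (F i).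
Proof. exact: rmorph_sum. Qed.

Lemma normc_conj x : normc (conjc x) = normc x.
Proof. by case: x => a b; rewrite /= sqrrN. Qed.

Lemma normc_real (r : R) : normc r%:C = `|r|.
Proof. by rewrite /= expr0n addr0 sqrtr_sqr. Qed.

Lemma real_complexM (a b : R) : (a * b)%:C = a%:C * b%:C :> R[i].
Proof. by rewrite rmorphM. Qed.

Lemma conjcM_normc x : conjc x * x = (normc x ^+ 2)%:C.
Proof. by apply: complexP; rewrite !reimE /= ?normc2E; ring. Qed.

Lemma le_normc_sum I (s : seq I) (P : pred I) (F : I -> R[i]) :
  normc (\sum_(i <- s | P i) F i) <= \sum_(i <- s | P i) normc (F i).
Proof.
elim/big_rec2: _ => [|i y z _ h]; first by rewrite normc0.
by rewrite (le_trans (le_normcD _ _))// lerD2l.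
Qed.

Lemma ge0_complexE x : (0 <= x) = (complex.Im x == 0) && (0 <= complex.Re x).
Proof. by rewrite lecE eq_sym. Qed.

End ComplexNumbers.

(** This keeps the sum of two square-integrable functions square-integrable. *)
Lemma sqr_le_add (R : realDomainType) (a b c : R) : 0 <= c -> c <= a + b ->
  c ^+ 2 <= 2 * a ^+ 2 + 2 * b ^+ 2.
Proof.
move=> c0 cab; have : c ^+ 2 <= (a + b) ^+ 2.
  by rewrite ler_pXn2r// nnegrE; exact: le_trans cab.
by have := sqr_ge0 (a - b); lra.
Qed.

Section ComplexIntegral.
Context {R : realType} {d : nat}.
Local Notation T := (d.-tuple (measurableTypeR R)).
Local Notation C := R[i].
Local Notation mu := (@torus_measure R d).
Implicit Types (h g : T -> C) (u v : T -> R).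

Definition cmeas h := measurable_fun setT (fun t => complex.Re (h t)) /\
                      measurable_fun setT (fun t => complex.Im (h t)).
Definition cbounded h := exists M, forall t, normc (h t) <= M.
Definition rintegrable u := mu.-integrable setT (EFin \o u).
Definition cintegrable h := rintegrable (fun t => complex.Re (h t)) /\
                            rintegrable (fun t => complex.Im (h t)).
Definition csquare h := cmeas h /\ rintegrable (fun t => normc (h t) ^+ 2).

Lemma cmeas_cst c : cmeas (fun=> c).
Proof. by split; exact: measurable_cst. Qed.

Lemma cmeasD h g : cmeas h -> cmeas g -> cmeas (fun t => h t + g t).
Proof.
move=> [h1 h2] [g1 g2]; split;
  under [X in measurable_fun _ X]eq_fun do rewrite reimE; exact: measurable_funD.
Qed.

Lemma cmeasM h g : cmeas h -> cmeas g -> cmeas (fun t => h t * g t).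
Proof.
move=> [h1 h2] [g1 g2]; split;
  under [X in measurable_fun _ X]eq_fun do rewrite reimE.
  by apply: measurable_funB; exact: measurable_funM.
by apply: measurable_funD; exact: measurable_funM.
Qed.

Lemma cmeas_conj h : cmeas h -> cmeas (fun t => conjc (h t)).
Proof.
move=> [h1 h2]; split; under [X in measurable_fun _ X]eq_fun do rewrite reimE.
  exact: h1.
exact: measurable_funN.
Qed.

Lemma measurable_normc2 h : cmeas h -> measurable_fun setT (fun t => normc (h t) ^+ 2).
Proof.
move=> [h1 h2]; under [X in measurable_fun _ X]eq_fun do rewrite normc2E.
by apply: measurable_funD; exact: measurable_funX.
Qed.

Lemma cbounded_cst c : cbounded (fun=> c).
Proof. by exists (normc c). Qed.

Lemma cboundedM h g : cbounded h -> cbounded g -> cbounded (fun t => h t * g t).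
Proof.
move=> [M hM] [N gN]; exists (M * N) => t.
by rewrite normcM ler_pM// normc_ge0.
Qed.

Lemma cbounded_conj h : cbounded h -> cbounded (fun t => conjc (h t)).
Proof. by move=> [M hM]; exists M => t; rewrite normc_conj. Qed.

Lemma rintegrable_le u v : measurable_fun setT u -> (forall t, `|u t| <= v t) ->
  rintegrable v -> rintegrable u.
Proof.
move=> mu_ uv; apply: le_integrable => //; first exact/measurable_EFinP.
move=> t _ /=; rewrite lee_fin (le_trans (uv t))// ler_norm//.
Qed.

Lemma rintegrable_bounded u M : measurable_fun setT u -> (forall t, `|u t| <= M) ->
  rintegrable u.
Proof.
move=> mu_ uM; apply: (@rintegrable_le _ (cst M)) => //.
exact: finite_measure_integrable_cst.
Qed.

Lemma rintegrableD u v : rintegrable u -> rintegrable v ->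
  rintegrable (fun t => u t + v t).
Proof.
move=> iu iv; rewrite /rintegrable.
by under [X in integrable _ _ X]eq_fun do rewrite /= EFinD; exact: integrableD.
Qed.

Lemma rintegrableZ (c : R) u : rintegrable u -> rintegrable (fun t => c * u t).
Proof.
move=> iu; rewrite /rintegrable.
by under [X in integrable _ _ X]eq_fun do rewrite /= EFinM; exact: integrableZl.
Qed.

Lemma rintegrableN u : rintegrable u -> rintegrable (fun t => - u t).
Proof.
by move=> iu; have := rintegrableZ (-1) iu; under eq_fun do rewrite mulN1r.
Qed.

Lemma rintegrableB u v : rintegrable u -> rintegrable v ->
  rintegrable (fun t => u t - v t).
Proof. by move=> iu iv; apply: rintegrableD => //; exact: rintegrableN. Qed.

Lemma rintegrable_sum I (s : seq I) (F : I -> T -> R) :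
  (forall i, rintegrable (F i)) -> rintegrable (fun t => \sum_(i <- s) F i t).
Proof.
move=> iF; elim: s => [|i s ih].
  under eq_fun do rewrite big_nil; exact: finite_measure_integrable_cst.
by under eq_fun do rewrite big_cons; exact: rintegrableD.
Qed.

Lemma rintegrable_meas u : rintegrable u -> measurable_fun setT u.
Proof. by move=> /measurable_int /measurable_EFinP. Qed.

Lemma rintegrable_cmul u v M : measurable_fun setT u -> (forall t, `|u t| <= M) ->
  rintegrable v -> rintegrable (fun t => u t * v t).
Proof.
move=> mu_ uM iv.
apply: (@rintegrable_le _ (fun t => M * `|v t|)).
- by apply: measurable_funM => //; exact: rintegrable_meas.
- by move=> t; rewrite normrM ler_wpM2r.
- by apply: rintegrableZ; exact: integrable_norm.
Qed.

Lemma integral_sumR I (s : seq I) (F : I -> T -> R) :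
  (forall i, rintegrable (F i)) ->
  (\int[mu]_t \sum_(i <- s) F i t)%R = \sum_(i <- s) (\int[mu]_t F i t)%R.
Proof.
move=> iF; elim: s => [|i s ih].
  under eq_Rintegral do rewrite big_nil.
  by rewrite Rintegral_cst// mul0r big_nil.
under eq_Rintegral do rewrite big_cons.
by rewrite RintegralD ?ih ?big_cons//; [exact: iF|exact: rintegrable_sum].
Qed.

Lemma cintegrable_bounded h : cmeas h -> cbounded h -> cintegrable h.
Proof.
move=> [m1 m2] [M hM]; split.
  by apply: (@rintegrable_bounded _ M) => // t; rewrite (le_trans (normc_Re _)).
by apply: (@rintegrable_bounded _ M) => // t; rewrite (le_trans (normc_Im _)).
Qed.

Lemma cintegrableM h g : cmeas h -> cbounded h -> cintegrable g ->
  cintegrable (fun t => h t * g t).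
Proof.
move=> [m1 m2] [M hM] [g1 g2].
have h1 t : `|complex.Re (h t)| <= M by rewrite (le_trans (normc_Re _)).
have h2 t : `|complex.Im (h t)| <= M by rewrite (le_trans (normc_Im _)).
split; under eq_fun do rewrite reimE.
  by apply: rintegrableB; exact: rintegrable_cmul.
by apply: rintegrableD; exact: rintegrable_cmul.
Qed.

Lemma cintegrableD h g : cintegrable h -> cintegrable g ->
  cintegrable (fun t => h t + g t).
Proof.
move=> [m1 m2] [g1 g2].
by split; under eq_fun do rewrite reimE; exact: rintegrableD.
Qed.

Lemma cintegrableZ (c : C) h : cintegrable h -> cintegrable (fun t => c * h t).
Proof. by apply: cintegrableM; [exact: cmeas_cst|exact: cbounded_cst]. Qed.

Lemma cintegrable_sum I (s : seq I) (F : I -> T -> C) :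
  (forall i, cintegrable (F i)) -> cintegrable (fun t => \sum_(i <- s) F i t).
Proof.
move=> iF; elim: s => [|i s ih].
  under eq_fun do rewrite big_nil.
  by apply: cintegrable_bounded; [exact: cmeas_cst|exact: cbounded_cst].
by under eq_fun do rewrite big_cons; exact: cintegrableD.
Qed.

Lemma Re_cintegral h : complex.Re (cintegral h) = (\int[mu]_t complex.Re (h t))%R.
Proof. by []. Qed.
Lemma Im_cintegral h : complex.Im (cintegral h) = (\int[mu]_t complex.Im (h t))%R.
Proof. by []. Qed.

Lemma eq_cintegral h g : h =1 g -> cintegral h = cintegral g.
Proof. by move=> /funext ->. Qed.

Lemma cintegralD h g : cintegrable h -> cintegrable g ->
  cintegral (fun t => h t + g t) = cintegral h + cintegral g.
Proof.
move=> [h1 h2] [g1 g2]; apply: complexP;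
  rewrite ?(ReD, ImD, Re_cintegral, Im_cintegral) -RintegralD//;
  by apply: eq_Rintegral => t _; rewrite reimE.
Qed.

Lemma cintegralZ (c : C) h : cintegrable h ->
  cintegral (fun t => c * h t) = c * cintegral h.
Proof.
move=> [h1 h2]; apply: complexP; rewrite ?(ReM, ImM, Re_cintegral, Im_cintegral);
  rewrite -!RintegralZl//.
  rewrite -RintegralB//; [|exact: rintegrableZ|exact: rintegrableZ].
  by apply: eq_Rintegral => t _; rewrite reimE.
rewrite -RintegralD//; [|exact: rintegrableZ|exact: rintegrableZ].
by apply: eq_Rintegral => t _; rewrite reimE.
Qed.

Lemma cintegral_sum I (s : seq I) (F : I -> T -> C) :
  (forall i, cintegrable (F i)) ->
  cintegral (fun t => \sum_(i <- s) F i t) = \sum_(i <- s) cintegral (F i).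
Proof.
move=> iF; apply: complexP; rewrite ?(Re_sum, Im_sum, Re_cintegral, Im_cintegral).
  under eq_Rintegral do rewrite Re_sum.
  by rewrite integral_sumR// => i; case: (iF i).
under eq_Rintegral do rewrite Im_sum.
by rewrite integral_sumR// => i; case: (iF i).
Qed.

Lemma cintegral_real u : cintegral (fun t => (u t)%:C) = ((\int[mu]_t u t)%R)%:C.
Proof.
by apply: complexP => //=; rewrite Rintegral_cst// mul0r.
Qed.

Lemma fine_torus_measure_setT : fine (mu setT) = 1.
Proof. by rewrite probability_setT. Qed.

Lemma cintegral_cst (c : C) : cintegral (fun _ : T => c) = c.
Proof.
by apply: complexP => /=; rewrite Rintegral_cst// fine_torus_measure_setT mulr1.
Qed.

Lemma csquare_bounded h : cmeas h -> cbounded h -> csquare h.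
Proof.
move=> mh [M hM]; split=> //; apply: (@rintegrable_bounded _ (M ^+ 2)).
  exact: measurable_normc2.
move=> t; rewrite ger0_norm ?sqr_ge0// ler_pXn2r// ?nnegrE ?normc_ge0//.
by rewrite (le_trans _ (hM t))// normc_ge0.
Qed.

Lemma csquareM h g : csquare h -> csquare g -> cintegrable (fun t => h t * g t).
Proof.
move=> [mh ih] [mg ig].
have [m1 m2] := cmeasM mh mg.
have hg t : normc (h t * g t) <= normc (h t) ^+ 2 + normc (g t) ^+ 2.
  by rewrite normcM; have := normc_ge0 (h t); have := normc_ge0 (g t); nra.
split; apply: (@rintegrable_le _ (fun t => normc (h t) ^+ 2 + normc (g t) ^+ 2)) => //.
- by move=> t; rewrite (le_trans (normc_Re _)).
- exact: rintegrableD.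
- by move=> t; rewrite (le_trans (normc_Im _)).
- exact: rintegrableD.
Qed.

Lemma csquare_bmul h g : cmeas h -> cbounded h -> csquare g ->
  csquare (fun t => h t * g t).
Proof.
move=> mh [M hM] [mg ig]; split; first exact: cmeasM.
apply: (@rintegrable_le _ (fun t => M ^+ 2 * normc (g t) ^+ 2)).
- by apply: measurable_normc2; exact: cmeasM.
- move=> t; rewrite normcM exprMn ger0_norm; last by apply: mulr_ge0; exact: sqr_ge0.
  rewrite ler_wpM2r ?sqr_ge0// ler_pXn2r// ?nnegrE; first exact: normc_ge0.
  by rewrite (le_trans _ (hM t))// normc_ge0.
- exact: rintegrableZ.
Qed.

Lemma csquareZ (c : C) h : csquare h -> csquare (fun t => c * h t).
Proof. by apply: csquare_bmul; [exact: cmeas_cst|exact: cbounded_cst]. Qed.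

Lemma csquareD h g : csquare h -> csquare g -> csquare (fun t => h t + g t).
Proof.
move=> [mh ih] [mg ig]; split; first exact: cmeasD.
apply: (@rintegrable_le _ (fun t => 2 * normc (h t) ^+ 2 + 2 * normc (g t) ^+ 2)).
- by apply: measurable_normc2; exact: cmeasD.
- move=> t; rewrite ger0_norm ?sqr_ge0//.
  exact: sqr_le_add (normc_ge0 _) (le_normcD _ _).
- by apply: rintegrableD; exact: rintegrableZ.
Qed.

Lemma csquare_sum I (s : seq I) (F : I -> T -> C) :
  (forall i, csquare (F i)) -> csquare (fun t => \sum_(i <- s) F i t).
Proof.
move=> iF; elim: s => [|i s ih].
  under eq_fun do rewrite big_nil.
  by apply: csquare_bounded; [exact: cmeas_cst|exact: cbounded_cst].
by under eq_fun do rewrite big_cons; exact: csquareD.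
Qed.

Lemma csquare_integrable h : csquare h -> cintegrable h.
Proof.
move=> ih; have := csquareM ih (csquare_bounded (cmeas_cst 1) (cbounded_cst 1)).
by under eq_fun do rewrite mulr1.
Qed.

End ComplexIntegral.

(** * Characters and continuous periodic functions *)

Section Characters.
Context {R : realType} {d : nat}.
Local Notation X := 'rV[R]_d.
Local Notation Zd := 'rV[int]_d.
Local Notation T := (d.-tuple (measurableTypeR R)).

Definition phase (n : Zd) (x : X) : R := \sum_i (n 0 i)%:~R * x 0 i.
Definition tchar (n : Zd) (x : X) : R[i] := cos (phase n x) +i* sin (phase n x).

Lemma expi_tchar n (t : T) : expi n t = tchar n (row_of t).
Proof.
by rewrite /expi /tchar /phase; under [in RHS]eq_bigr do rewrite mxE.
Qed.

Lemma phaseDl n m x : phase (n + m) x = phase n x + phase m x.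
Proof.
by rewrite /phase -big_split; apply: eq_bigr => i _; rewrite mxE intrD mulrDl.
Qed.
Lemma phaseNl n x : phase (- n) x = - phase n x.
Proof. by rewrite /phase -sumrN; apply: eq_bigr => i _; rewrite mxE mulrNz mulNr. Qed.
Lemma phaseDr n x y : phase n (x + y) = phase n x + phase n y.
Proof. by rewrite /phase -big_split; apply: eq_bigr => i _; rewrite mxE mulrDr. Qed.
Lemma phaseZr n (a : R) x : phase n (a *: x) = a * phase n x.
Proof. by rewrite /phase mulr_sumr; apply: eq_bigr => i _; rewrite mxE mulrCA. Qed.
Lemma phase_delta n i : phase n 'e_i = (n 0 i)%:~R.
Proof.
rewrite /phase (bigD1 i)//= mxE !eqxx mulr1 big1 ?addr0// => j /negbTE ji.
by rewrite mxE ji andbF mulr0.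
Qed.
Lemma phase_deltal i x : phase 'e_i x = x 0 i.
Proof.
rewrite /phase (bigD1 i)//= mxE !eqxx mul1r big1 ?addr0// => j /negbTE ji.
by rewrite mxE ji andbF mul0r.
Qed.

Lemma cis_add (a b : R) :
  cos (a + b) +i* sin (a + b) = (cos a +i* sin a) * (cos b +i* sin b) :> R[i].
Proof. by apply: complexP; rewrite reimE /= ?cosD ?sinD//; ring. Qed.

Lemma tchar_addl n m x : tchar (n + m) x = tchar n x * tchar m x.
Proof. by rewrite /tchar phaseDl cis_add. Qed.
Lemma tchar_addr n x y : tchar n (x + y) = tchar n x * tchar n y.
Proof. by rewrite /tchar phaseDr cis_add. Qed.
Lemma tchar_oppl n x : tchar (- n) x = conjc (tchar n x).
Proof. by rewrite /tchar phaseNl cosN sinN. Qed.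
Lemma tchar_subl n m x : tchar (n - m) x = tchar n x * conjc (tchar m x).
Proof. by rewrite tchar_addl tchar_oppl. Qed.
Lemma tchar_0l x : tchar 0 x = 1.
Proof.
rewrite /tchar (_ : phase 0 x = 0) ?cos0 ?sin0//.
by rewrite /phase big1// => i _; rewrite mxE mul0r.
Qed.
Lemma tchar_0r n : tchar n 0 = 1.
Proof.
rewrite /tchar (_ : phase n 0 = 0) ?cos0 ?sin0//.
by rewrite /phase big1// => i _; rewrite mxE mulr0.
Qed.
Lemma normc_tchar n x : normc (tchar n x) = 1.
Proof. by rewrite /tchar /= cos2Dsin2 sqrtr1. Qed.
Lemma tcharMconj n x : tchar n x * conjc (tchar n x) = 1.
Proof. by rewrite mulrC conjcM_normc normc_tchar expr1n. Qed.

Lemma cos_2piz (k : int) : cos (2 * pi * k%:~R) = 1 :> R.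
Proof.
have H (n : nat) : cos (2 * pi * n%:R) = 1 :> R.
  have E := periodicn (@cosD2pi R) n 0; rewrite add0r cos0 in E.
  rewrite -[RHS]E; congr cos.
  by rewrite -[in RHS]mulr_natr -[pi *+ 2]mulr_natl.
by case: k => n; [exact: H|rewrite NegzE mulrNz mulrN cosN; exact: H].
Qed.
Lemma sin_2piz (k : int) : sin (2 * pi * k%:~R) = 0 :> R.
Proof.
have H (n : nat) : sin (2 * pi * n%:R) = 0 :> R.
  have E := periodicn (@sinD2pi R) n 0; rewrite add0r sin0 in E.
  rewrite -[RHS]E; congr sin.
  by rewrite -[in RHS]mulr_natr -[pi *+ 2]mulr_natl.
by case: k => n; [exact: H|rewrite NegzE mulrNz mulrN sinN H oppr0].
Qed.

Lemma tchar_period n (m : Zd) : tchar n ((2 * pi) *: map_mx intr m) = 1.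
Proof.
rewrite /tchar phaseZr (_ : phase _ _ = (\sum_i n 0 i * m 0 i)%:~R).
  by rewrite cos_2piz sin_2piz.
rewrite /phase (big_morph (fun z : int => z%:~R) (@intrD R) (erefl _)).
by apply: eq_bigr => i _; rewrite mxE intrM.
Qed.

Lemma tchar_periodic n : torus_periodic (tchar n : X -> R[i]^o).
Proof. by move=> m x; rewrite tchar_addr tchar_period mulr1. Qed.

Lemma phase_continuous n : continuous (phase n : X -> R^o).
Proof.
rewrite /phase; elim: (index_enum _) => [|i s ih].
  rewrite (_ : (fun _ => _) = cst 0); first exact: cst_continuous.
  by apply/funext => x; rewrite big_nil.
have E (x : X) : \sum_(j <- i :: s) (n 0 j)%:~R * x 0 j =
    (n 0 i)%:~R * x 0 i + \sum_(j <- s) (n 0 j)%:~R * x 0 j by rewrite big_cons.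
rewrite (funext E) => {E}.
move=> x; apply: cvgD; [exact: nbhs_filter| |exact: ih].
apply: (@continuousM _ _ (cst (n 0 i)%:~R) (fun x : X => x 0 i : R^o)).
  exact: cst_continuous.
exact: coord_continuous.
Qed.

Lemma continuous_Re_tchar n : continuous (fun x : X => complex.Re (tchar n x) : R^o).
Proof. by move=> x; apply: continuous_comp; [exact: phase_continuous|exact: continuous_cos]. Qed.
Lemma continuous_Im_tchar n : continuous (fun x : X => complex.Im (tchar n x) : R^o).
Proof. by move=> x; apply: continuous_comp; [exact: phase_continuous|exact: continuous_sin]. Qed.

(** A directional derivative is a derivative along a line, so the calculus of one
    real variable applies to it. *)
Lemma is_derive_line (u : X -> R^o) (x v : X) (w : R) :
  is_derive (0 : R^o) (1 : R^o) (fun s : R^o => u (x + s *: v) : R^o) w <-> is_derive x v u w.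
Proof.
have E : (fun h : R => h^-1 *: (((fun s : R^o => u (x + s *: v) : R^o) \o shift 0) (h *: (1 : R^o)) - u (x + 0 *: v)))
   = (fun h : R => h^-1 *: ((u \o shift x) (h *: v) - u x)).
  apply/funext => h; have -> : h *: (1 : R^o) = h by exact: mulr1.
  by rewrite /= addr0 scale0r addr0 [h *: v + x]addrC.
split; case; rewrite /derivable /derive ?E => h1 h2; split; rewrite /derivable /derive ?E//.
Qed.

Lemma is_derive_line_at (u : X -> R^o) (x v : X) (s : R) (w : R) :
  is_derive (x + s *: v) v u w ->
  is_derive (s : R^o) (1 : R^o) (fun s : R^o => u (x + s *: v) : R^o) w.
Proof.
have E : (fun h : R => h^-1 *: (((fun s : R^o => u (x + s *: v) : R^o) \o shift s) (h *: (1 : R^o)) - u (x + s *: v)))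
   = (fun h : R => h^-1 *: ((u \o shift (x + s *: v)) (h *: v) - u (x + s *: v))).
  apply/funext => h; have -> : h *: (1 : R^o) = h by exact: mulr1.
  by rewrite /= scalerDl addrCA.
case; rewrite /derivable /derive -?E => h1 h2; split; rewrite /derivable /derive//.
Qed.

Lemma is_derive_Re_tchar n x v : is_derive x v (fun x => complex.Re (tchar n x) : R^o)
  (- phase n v * complex.Im (tchar n x)).
Proof.
apply/is_derive_line => /=.
under [X in is_derive _ _ X _]eq_fun do rewrite phaseDr phaseZr.
apply: is_derive_eq; rewrite mul0r addr0 !add0r -![_ *: _]/(_ * _) mulr1; ring.
Qed.

Lemma is_derive_Im_tchar n x v : is_derive x v (fun x => complex.Im (tchar n x) : R^o)
  (phase n v * complex.Re (tchar n x)).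
Proof.
apply/is_derive_line => /=.
under [X in is_derive _ _ X _]eq_fun do rewrite phaseDr phaseZr.
apply: is_derive_eq; rewrite mul0r addr0 !add0r -![_ *: _]/(_ * _) mulr1; ring.
Qed.

End Characters.
Arguments tchar : simpl never.

Section PeriodicFunctions.
Context {R : realType} {d : nat}.
Local Notation X := 'rV[R]_d.
Local Notation Zd := 'rV[int]_d.

Definition rperiodic (u : X -> R) := forall (n : Zd) x,
  u (x + (2 * pi) *: map_mx intr n) = u x.

Lemma angle_rep (r : R) : exists n : int, `|r - 2 * pi * n%:~R| <= pi.
Proof.
exists (Num.floor ((r + pi) / (2 * pi))).
have p0 : (0 : R) < 2 * pi by rewrite mulr_gt0 ?pi_gt0.
have := ge_floor ((r + pi) / (2 * pi)); have := floorD1_gt ((r + pi) / (2 * pi)).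
rewrite ltr_pdivrMr// ler_pdivlMr// intrD => h1 h2.
by rewrite ler_norml; apply/andP; split; lra.
Qed.

Lemma torus_rep (x y : X) : exists (z : X) (n : Zd),
  (forall i, `|z 0 i| <= pi) /\ y = x + z + (2 * pi) *: map_mx intr n.
Proof.
have /choice[n nP] (i : 'I_d) := angle_rep (y 0 i - x 0 i).
exists (y - x - (2 * pi) *: map_mx intr (\row_i n i)), (\row_i n i); split.
  by move=> i; rewrite !mxE.
by rewrite -addrA subrK addrC subrK.
Qed.

Lemma cube_compact (r : R) : compact [set x : X | forall i, `|x 0 i| <= r].
Proof.
have := @rV_compact R d (fun=> `[- r, r]%classic) (fun=> @segment_compact R _ _).
by congr compact; apply/seteqP; split => x /= h i; have := h i; rewrite /= in_itv/= ler_norml.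
Qed.

Lemma periodic_bounded (u : X -> R^o) : rperiodic u -> continuous u ->
  exists M, forall x, `|u x| <= M.
Proof.
move=> pu cu.
have := @EVT_max_rV R d (fun x => `|u x|) [set x : X | forall i, `|x 0 i| <= pi].
case.
- by exists 0 => i /=; rewrite mxE normr0 pi_ge0.
- exact: cube_compact.
- by apply: continuous_subspaceT => x; apply: continuous_comp; [exact: cu|exact: norm_continuous].
move=> c _ cmax; exists `|u c| => x.
have [z [n [zpi ->]]] := torus_rep 0 x.
by rewrite pu add0r cmax// inE.
Qed.

(** Compactness of a cube that meets every orbit of the lattice. *)
Lemma periodic_uniform (u : X -> R^o) (e : R) : rperiodic u -> continuous u -> 0 < e ->
  exists2 delta, 0 < delta & forall x z : X, (forall i, `|z 0 i| < delta) ->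
    `|u (x + z) - u x| < e.
Proof.
move=> pu cu e0; have e20 : 0 < e / 2 by rewrite divr_gt0.
have /compact_near_coveringP := @cube_compact pi.
move=> /(_ R (0^'+) (fun delta x => forall z : X, (forall i, `|z 0 i| < delta) ->
  `|u (x + z) - u x| < e)).
case.
- move=> x _; have /cvgrPdist_lt/(_ _ e20)/nbhs_ballP[r /= r0 hr] := cu x.
  have r20 : 0 < r / 2 by rewrite divr_gt0.
  near=> x' delta => z /= zd.
  have dr : delta < r / 2 by near: delta; exact: nbhs_right_lt.
  have h1 : `|u x - u x'| < e / 2.
    apply: hr; near: x'.
    exact: nbhsx_ballx.
  have h2 : `|u x - u (x' + z)| < e / 2.
    apply: hr; split => // i j; rewrite mxE.
    have xb : ball x (r / 2) x' by near: x'; exact: nbhsx_ballx.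
    have {xb} := xb.2 i j; rewrite /ball /= ord1 => xb.
    rewrite opprD addrA [ltRHS](splitr r) (le_lt_trans (ler_normB _ _))// ltrD//.
    by rewrite (lt_trans (zd j)).
  rewrite (_ : u _ - _ = (u x - u x') - (u x - u (x' + z))); last by ring.
  by rewrite (le_lt_trans (ler_normB _ _))// [ltRHS](splitr e) ltrD.
- move=> s /= s0 hs; exists (s / 2); first by rewrite divr_gt0.
  move=> x z zd; have [w [n [wpi ->]]] := torus_rep 0 x.
  rewrite addrAC !pu add0r; apply: (hs (s / 2)) => //=.
  + by rewrite sub0r normrN gtr0_norm ?divr_gt0// ltr_pdivrMr// ltr_pMr// ltr1n.
  + by rewrite divr_gt0.
Unshelve. all: by end_near.
Qed.

Lemma cos_lt1 (a : R) : 0 < a <= pi -> cos a < 1.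
Proof.
by move=> /andP[a0 ap]; rewrite -cos0 ltr_cos// in_itv/= ?lexx ?pi_ge0// ltW.
Qed.

Lemma cos_ge_far (z a : R) : 0 < a <= pi -> a <= `|z| <= pi -> 1 - cos a <= 1 - cos z.
Proof.
move=> /andP[a0 ap] /andP[az zp]; rewrite lerD2l lerN2 -(cos_norm z).
move: az; rewrite le_eqVlt => /predU1P[->//|az].
by rewrite ltW// ltr_cos// in_itv/= ?zp ?normr_ge0 ?ap ?ltW.
Qed.

(** A substitute for the distance on the torus that is a trigonometric polynomial
    in each variable, so that its Fejer mean can be computed exactly. *)
Definition chordal (x y : X) : R := \sum_i (1 - cos (x 0 i - y 0 i)).

Lemma chordal_term_ge0 (r : R) : 0 <= 1 - cos r.
Proof. by rewrite subr_ge0 cos_le1. Qed.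

Lemma chordal_ge0 x y : 0 <= chordal x y.
Proof. by apply: sumr_ge0 => i _; exact: chordal_term_ge0. Qed.

Lemma chordal_rep x z n :
  chordal x (x + z + (2 * pi) *: map_mx intr n) = \sum_i (1 - cos (z 0 i)).
Proof.
apply: eq_bigr => i _; rewrite !mxE; congr (1 - _).
rewrite -cosN (_ : - _ = z 0 i + 2 * pi * (n 0 i)%:~R); last by ring.
by rewrite cosD cos_2piz sin_2piz mulr1 mulr0 subr0.
Qed.

(** Nearby points are covered by uniform continuity.  For the others some
    coordinate differs by an angle of at least [a] modulo the period, so
    [chordal] is at least [1 - cos a] and absorbs the oscillation [2 * M]. *)
Lemma periodic_modulus (u : X -> R^o) (e : R) : rperiodic u -> continuous u -> 0 < e ->
  exists2 K, 0 <= K & forall x y, `|u x - u y| <= e + K * chordal x y.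
Proof.
move=> pu cu e0; have [M hM] := periodic_bounded pu cu.
have M0 : 0 <= M := le_trans (normr_ge0 _) (hM 0).
have [s s0 hs] := periodic_uniform pu cu e0.
pose a := Num.min s pi; have a0 : 0 < a by rewrite lt_min s0 pi_gt0.
have api : 0 < a <= pi by rewrite a0 ge_min lexx orbT.
have c0 : 0 < 1 - cos a by rewrite subr_gt0 cos_lt1.
have K0 : 0 <= 2 * M / (1 - cos a) by rewrite divr_ge0 ?mulr_ge0// ltW.
exists (2 * M / (1 - cos a)) => // x y.
have [z [n [zpi ->]]] := torus_rep x y.
rewrite chordal_rep pu.
have [zs|/existsNP[i /negP]] := pselect (forall i, `|z 0 i| < a).
  rewrite distrC ler_wpDr ?mulr_ge0//; last first.
    by apply: ltW; apply: hs => i; rewrite (lt_le_trans (zs i))// ge_min lexx.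
  by apply: sumr_ge0 => i _; exact: chordal_term_ge0.
rewrite -leNgt => ai.
rewrite ler_wpDl ?(ltW e0)//.
apply: (@le_trans _ _ (2 * M)).
  by rewrite (le_trans (ler_normB _ _))// mulr_natl mulr2n lerD.
rewrite mulrAC ler_pdivlMr//; apply: ler_wpM2l; first by rewrite mulr_ge0.
rewrite (bigD1 i)//= ler_wpDr//; last by apply: cos_ge_far; rewrite ?ai ?zpi.
by apply: sumr_ge0 => j _; exact: chordal_term_ge0.
Qed.

(** Small angles are covered by [e]; for the others [1 - cos z] is at least
    [1 - cos e], and the constant [pi] bounds the angle. *)
Lemma angle_modulus (e z : R) : 0 < e <= pi -> `|z| <= pi ->
  `|z| <= e + pi / (1 - cos e) * (1 - cos z).
Proof.
move=> epi zpi; have c0 : 0 < 1 - cos e by rewrite subr_gt0 cos_lt1.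
have [ze|ez] := leP `|z| e.
  rewrite ler_wpDr// mulr_ge0 ?chordal_term_ge0// divr_ge0 ?pi_ge0// ltW//.
rewrite ler_wpDl//; first by case/andP : epi => /ltW.
rewrite mulrAC ler_pdivlMr//.
apply: ler_pM; rewrite ?(ltW c0)//; apply: cos_ge_far => //.
by rewrite zpi andbT ltW.
Qed.

(** The distance in the Lipschitz condition is the sum of the coordinate
    distances, to which [angle_modulus] applies one coordinate at a time. *)
Lemma lipschitz_modulus (u : X -> R) (l e : R) : 0 <= l -> rperiodic u -> 0 < e <= pi ->
  (forall x z, `|u (x + z) - u x| <= l * \sum_i `|z 0 i|) ->
  forall x y, `|u x - u y| <= l * (d%:R * e + pi / (1 - cos e) * chordal x y).
Proof.
move=> l0 pu epi hl x y; have [z [n [zpi ->]]] := torus_rep x y.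
rewrite chordal_rep pu distrC (le_trans (hl _ _))// ler_wpM2l//.
rewrite mulr_sumr.
rewrite (_ : d%:R * e = \sum_(i < d) e); last first.
  by rewrite sumr_const card_ord mulr_natl.
by rewrite -big_split ler_sum// => i _; exact: angle_modulus.
Qed.

End PeriodicFunctions.

(** * Integration by parts and Fourier coefficients *)

Section TorusMeasure.
Context {R : realType}.
Local Notation U := (uniform_prob (@torus_period_gt0 R)).

Section Grid.
Context {d : nat}.
Local Notation X := 'rV[R]_d.
Local Notation Zd := 'rV[int]_d.
Local Notation T := (d.-tuple (measurableTypeR R)).

(** Rounding down to a lattice of mesh [1 / (k + 1)].  A continuous function is the
    pointwise limit of its values at the rounded points, and these take countably
    many values on measurable sets; this gives measurability with respect to the
    product sigma-algebra on tuples. *)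
Definition grid (k : nat) (t : T) : Zd := \row_i Num.floor (k.+1%:R * (tnth t i : R)).

Lemma grid_fiber k (z : Zd) : measurable [set t : T | grid k t = z].
Proof.
rewrite (_ : [set _ | _] = \bigcap_(i in [set: 'I_d])
  ((tnth (T := measurableTypeR R))^~ i @^-1`
     `[(z 0 i)%:~R / k.+1%:R, (z 0 i + 1)%:~R / k.+1%:R[%classic)); last first.
  apply/seteqP; split => t /=.
    move=> <- i _ /=; rewrite !mxE in_itv/= ler_pdivrMr ?ltr0n// ltr_pdivlMr ?ltr0n//.
    by rewrite mulrC ge_floor floorD1_gt.
  move=> h; apply/rowP => i; rewrite mxE; apply/floor_def.
  have := h i I; rewrite /= in_itv/= ler_pdivrMr ?ltr0n// ltr_pdivlMr ?ltr0n//.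
  by rewrite mulrC.
apply: fin_bigcap_measurable => // i _; rewrite -[X in measurable X]setTI.
exact: measurable_tnth.
Qed.

Lemma measurable_grid k (phi : Zd -> R) :
  measurable_fun setT (fun t : T => phi (grid k t)).
Proof.
move=> _ Y mY; rewrite setTI.
rewrite (_ : _ @^-1` _ = \bigcup_(z : Zd)
   (if phi z \in Y then [set t : T | grid k t = z] else set0)); last first.
  apply/seteqP; split => t /=.
    by move=> Yt; exists (grid k t) => //; rewrite mem_set.
  by move=> [z _]; case: ifPn => // /set_mem Yz /= ->.
apply: countable_bigcupT_measurable => [|z]; first exact: countableP.
by case: ifPn => // _; exact: grid_fiber.
Qed.

Lemma measurable_continuous_row (u : X -> R^o) : continuous u ->
  measurable_fun setT (fun t : T => u (row_of t) : R).
Proof.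
move=> cu.
apply: (@measurable_fun_cvg _ _ _ _
  (fun k (t : T) => u (k.+1%:R^-1 *: map_mx intr (grid k t)))).
  by move=> k; exact: (measurable_grid k (fun z => u (k.+1%:R^-1 *: map_mx intr z))).
move=> t _; apply/cvgrPdist_lt => e e0.
have /cvgrPdist_lt/(_ _ e0)/nbhs_ballP[r /= r0 hr] := cu (row_of t).
near=> k; apply: hr; split => // a i.
have k0 : (0 : R) < k.+1%:R by rewrite ltr0n.
have kr : k.+1%:R^-1 < r by near: k; exact: near_infty_natSinv_lt (PosNum r0).
rewrite /ball/= !mxE; apply: lt_trans kr.
rewrite -[X in `|X - _|](mulKf (lt0r_neq0 k0)) -mulrBr normrM ger0_norm ?invr_ge0 ?ltW//.
rewrite -[ltRHS]mulr1 ltr_pM2l ?invr_gt0//.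
have := ge_floor (k.+1%:R * (tnth t i : R)).
have := floorD1_gt (k.+1%:R * (tnth t i : R)); rewrite intrD => h1 h2.
by rewrite ltr_norml; apply/andP; split; lra.
Unshelve. all: by end_near.
Qed.

Definition set_coord (t : T) (i : 'I_d) (s : R) : T :=
  [tuple if j == i then (s : measurableTypeR R) else tnth t j | j < d].

Lemma row_of_set_coord t i s : row_of (set_coord t i s) = row_of (set_coord t i 0) + s *: 'e_i.
Proof.
apply/rowP => j; rewrite !mxE !tnth_mktuple eqxx /=; case: eqVneq => // _.
  by rewrite add0r mulr1.
by rewrite mulr0 addr0.
Qed.

End Grid.

Lemma set_coord_cons0 d (t : d.-tuple (measurableTypeR R)) (x s : R) :
  set_coord (torus_cons ((x : measurableTypeR R), t)) ord0 s = torus_cons ((s : measurableTypeR R), t).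
Proof.
apply: eq_from_tnth => j; rewrite tnth_mktuple.
case: (unliftP ord0 j) => [k|] ->; last by rewrite eqxx.
by rewrite eq_sym (negbTE (neq_lift _ _)) !tnthS.
Qed.

Lemma set_coord_consS d (t : d.-tuple (measurableTypeR R)) (i : 'I_d) (x s : R) :
  set_coord (torus_cons ((x : measurableTypeR R), t)) (lift ord0 i) s =
  torus_cons ((x : measurableTypeR R), set_coord t i s).
Proof.
apply: eq_from_tnth => j; rewrite tnth_mktuple.
case: (unliftP ord0 j) => [k|] ->.
  by rewrite (inj_eq lift_inj) !tnthS tnth_mktuple.
by rewrite (negbTE (neq_lift _ _)).
Qed.

Local Open Scope ereal_scope.

(** Fubini; the induction follows the recursive definition of the measure, which
    splits off the first coordinate: it is either the axis in question or a
    parameter. *)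
Lemma torus_integral_line0 d (i : 'I_d) (H : d.-tuple (measurableTypeR R) -> R) (M : R) :
  measurable_fun setT H -> (forall t, (`|H t| <= M)%R) ->
  (forall t, \int[U]_s (H (set_coord t i s))%:E = 0) ->
  \int[@torus_measure R d]_t (H t)%:E = 0.
Proof.
elim: d i H M => [[]//|d ih i H M mH HM Hi].
have mHc : measurable_fun setT (fun p => H (torus_cons p)).
  exact: measurableT_comp mH (@measurable_torus_cons R d).
have iH : (U \x @torus_measure R d).-integrable setT (EFin \o (fun p => H (torus_cons p))).
  apply: measurable_bounded_integrable => //.
    by rewrite [ltLHS]probability_setT ltry.
  by exists M; split; [exact: num_real|move=> y My p _ /=; exact: le_trans (HM _) (ltW My)].
rewrite /= integral_distribution//; last exact/measurable_EFinP.
case: (unliftP ord0 i) => [j|] ij; rewrite {}ij in Hi.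
- rewrite -integral12_prod_meas1//= integral0_eq// => x _.
  apply: (ih j (fun t => H (torus_cons (x, t))) M) => //.
    exact: measurable_fun_pair2 mHc.
  by move=> t; rewrite -[RHS](Hi (torus_cons (x, t))); under [in RHS]eq_integral do rewrite set_coord_consS.
- rewrite -integral21_prod_meas1//= integral0_eq// => t _.
  by rewrite -[RHS](Hi (torus_cons (0%R, t))); under [in RHS]eq_integral do rewrite set_coord_cons0.
Qed.

End TorusMeasure.

Section IntegrationByParts.
Context {R : realType} {d : nat}.
Local Notation U := (uniform_prob (@torus_period_gt0 R)).
Local Notation X := 'rV[R]_d.
Local Notation Zd := 'rV[int]_d.
Local Notation T := (d.-tuple (measurableTypeR R)).
Local Notation mu := (@torus_measure R d).

(** The fundamental theorem of calculus on one period. *)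
Lemma uniform_integral_derive (F F' : R -> R) (M : R) :
  (forall s, is_derive (s : R^o) (1 : R^o) (F : R^o -> R^o) (F' s)) ->
  continuous (F' : R^o -> R^o) -> (forall s, `|F' s| <= M) -> F (2 * pi) = F 0 ->
  (\int[U]_s (F' s)%:E = 0)%E.
Proof.
move=> dF cF' F'M FE.
have mF' : measurable_fun setT F' by exact: continuous_measurable_fun.
have bF' : [bounded F' x | x in setT].
  by exists M; split; [exact: num_real|move=> y My p _ /=; exact: le_trans (F'M _) (ltW My)].
have iF' : U.-integrable setT (EFin \o F').
  apply: measurable_bounded_integrable => //.
  by rewrite [ltLHS]probability_setT ltry.
(* the integral against the uniform law is known for nonnegative functions,
   whence the shift of [F'] by its bound [M] *)
have : (\int[U]_s (F' s + M)%:E = M%:E)%E.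
  rewrite integral_uniform; last 2 first.
  - by apply/measurable_EFinP; exact: measurable_funD.
  - move=> s; rewrite lee_fin; have := F'M s; rewrite ler_norml => /andP[]; lra.
  rewrite (@continuous_FTC2 _ _ (fun s => F s + M * s)).
  - rewrite -EFinB -EFinM FE subr0 mulr0 addr0 [(F 0 + _)%R]addrC addrK.
    by rewrite mulrC mulfK// gt_eqF// mulr_gt0 ?pi_gt0.
  - by rewrite mulr_gt0 ?pi_gt0.
  - apply: continuous_subspaceT => x; apply: cvgD; [exact: cF'|exact: cvg_cst].
  - have dFM s : is_derive (s : R^o) (1 : R^o) (fun s => F s + M * s) (F' s + M).
      by apply: is_derive_eq; rewrite [_ *: _]mulr1.
    have cFM : continuous (fun s : R^o => F s + M * s : R^o).
      by move=> s; apply: differentiable_continuous; apply/derivable1_diffP; case: (dFM s).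
    by split=> [s _| |]; [case: (dFM s)|apply: cvg_at_right_filter; exact: cFM|
      apply: cvg_at_left_filter; exact: cFM].
  - move=> s _; rewrite derive1E.
    have dFM : is_derive (s : R^o) (1 : R^o) (fun s => F s + M * s) (F' s + M).
      by apply: is_derive_eq; rewrite [_ *: _]mulr1.
    by case: dFM.
under eq_integral do rewrite EFinD.
rewrite integralD//; last exact: finite_measure_integrable_cst.
rewrite integral_cst// [X in (_ * X)%E]probability_setT mule1.
have fa := integrable_fin_num measurableT iF'.
rewrite -[in X in X -> _](fineK fa) => -[h]; rewrite -(fineK fa); congr EFin.
by apply: (@addIr _ M); rewrite add0r.
Qed.

(** The derivative of a periodic function integrates to zero along each line in
    its direction, hence over the torus. *)
Lemma torus_integral_derive (i : 'I_d) (u u' : X -> R^o) :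
  rperiodic u -> rperiodic u' -> continuous u' ->
  (forall x, is_derive x 'e_i u (u' x)) ->
  (\int[mu]_t u' (row_of t))%R = 0.
Proof.
move=> pu pu' cu' du; have [M hM] := periodic_bounded pu' cu'.
rewrite /Rintegral (torus_integral_line0 (i:=i) (M:=M)) ?fine0//.
  exact: measurable_continuous_row.
move=> t; set x0 := row_of (set_coord t i 0).
under eq_integral do rewrite row_of_set_coord -/x0.
apply: (@uniform_integral_derive (fun s => u (x0 + s *: 'e_i)) _ M) => //.
- by move=> s; apply: is_derive_line_at.
- move=> s; apply: continuous_comp; last exact: cu'.
  apply: cvgD; first exact: cvg_cst.
  by apply: cvgZr_tmp; exact: cvg_id.
- rewrite scale0r addr0 -[RHS](pu ('e_i)); congr (u (_ + _ *: _)).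
  by apply/rowP => j; rewrite !mxE; case: (_ && _).
Qed.

(** The predicate of the state space, on functions with values in [R[i]] seen
    as a ring and not as a module over itself. *)
Definition tcont (f : X -> R[i]) : Prop := torus_continuous (f : X -> R[i]^o).

Lemma tcont_Re f : tcont f -> rperiodic (fun x => complex.Re (f x)).
Proof. by case=> pf _ _ n x; rewrite pf. Qed.
Lemma tcont_Im f : tcont f -> rperiodic (fun x => complex.Im (f x)).
Proof. by case=> pf _ _ n x; rewrite pf. Qed.

Lemma tcont_tchar n : tcont (tchar n).
Proof.
split; [exact: tchar_periodic|exact: continuous_Re_tchar|exact: continuous_Im_tchar].
Qed.

Lemma tcont_cst c : tcont (fun=> c).
Proof. by split => //; exact: cst_continuous. Qed.

Lemma tcontD f g : tcont f -> tcont g -> tcont (fun x => f x + g x).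
Proof.
move=> [pf f1 f2] [pg g1 g2]; split.
- by move=> n x; rewrite pf pg.
- under eq_fun do rewrite reimE; move=> x; apply: cvgD; [exact: nbhs_filter|exact: f1|exact: g1].
- under eq_fun do rewrite reimE; move=> x; apply: cvgD; [exact: nbhs_filter|exact: f2|exact: g2].
Qed.

Lemma tcontM f g : tcont f -> tcont g -> tcont (fun x => f x * g x).
Proof.
move=> [pf f1 f2] [pg g1 g2]; split.
- by move=> n x; rewrite pf pg.
- under eq_fun do rewrite reimE; move=> x.
  apply: cvgB; [exact: nbhs_filter| |].
    by apply: cvgM; [exact: nbhs_filter|exact: f1|exact: g1].
  by apply: cvgM; [exact: nbhs_filter|exact: f2|exact: g2].
- under eq_fun do rewrite reimE; move=> x.
  apply: cvgD; [exact: nbhs_filter| |].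
    by apply: cvgM; [exact: nbhs_filter|exact: f1|exact: g2].
  by apply: cvgM; [exact: nbhs_filter|exact: f2|exact: g1].
Qed.

Lemma tcont_conj f : tcont f -> tcont (fun x => conjc (f x)).
Proof.
move=> [pf f1 f2]; split.
- by move=> n x; rewrite pf.
- by under eq_fun do rewrite reimE.
- under eq_fun do rewrite reimE; move=> x; apply: cvgN; [exact: nbhs_filter|exact: f2].
Qed.

Lemma tcontZ (c : R[i]) f : tcont f -> tcont (fun x => c * f x).
Proof. by apply: tcontM; exact: tcont_cst. Qed.

Lemma tcontB f g : tcont f -> tcont g -> tcont (fun x => f x - g x).
Proof.
by move=> tf tg; have := tcontD tf (tcontZ (-1) tg); under eq_fun do rewrite mulN1r.
Qed.

Lemma tcont_sum I (s : seq I) (F : I -> X -> R[i]) : (forall i, tcont (F i)) ->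
  tcont (fun x => \sum_(i <- s) F i x).
Proof.
move=> mF; elim: s => [|i s ih].
  by under eq_fun do rewrite big_nil; exact: tcont_cst.
by under eq_fun do rewrite big_cons; exact: tcontD.
Qed.

Lemma tcont_meas f : tcont f -> cmeas (fun t : T => f (row_of t)).
Proof.
by move=> [_ f1 f2]; split; [exact: (measurable_continuous_row f1)|exact: (measurable_continuous_row f2)].
Qed.

Lemma tcont_bound f : tcont f -> exists M, forall x, normc (f x) <= M.
Proof.
move=> tf; have [_ f1 f2] := tf.
have [M hM] := periodic_bounded (tcont_Re tf) f1.
have [N hN] := periodic_bounded (tcont_Im tf) f2.
by exists (M + N) => x; rewrite (le_trans (normc_le_ReIm _))// lerD.
Qed.

Lemma tcont_cbounded f : tcont f -> cbounded (fun t : T => f (row_of t)).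
Proof. by move=> /tcont_bound[M hM]; exists M. Qed.

Lemma tcont_integrable f : tcont f -> cintegrable (fun t : T => f (row_of t)).
Proof.
by move=> tf; apply: cintegrable_bounded; [exact: tcont_meas|exact: tcont_cbounded].
Qed.

Definition cderive (x v : X) (f : X -> R[i]) (w : R[i]) :=
  is_derive x v (fun x => complex.Re (f x) : R^o) (complex.Re w) /\
  is_derive x v (fun x => complex.Im (f x) : R^o) (complex.Im w).

Lemma cderive_tchar n x v : cderive x v (tchar n) ((phase n v)*i * tchar n x).
Proof.
split; first by apply: is_derive_eq (is_derive_Re_tchar n x v) _; rewrite reimE /=; ring.
by apply: is_derive_eq (is_derive_Im_tchar n x v) _; rewrite reimE /=; ring.
Qed.

Lemma cderive_conj x v f w : cderive x v f w -> cderive x v (fun x => conjc (f x)) (conjc w).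
Proof.
move=> [h1 h2]; split; rewrite reimE; under eq_fun do rewrite reimE; first exact: h1.
exact: is_deriveN.
Qed.

Lemma cderiveM x v f g w z : cderive x v f w -> cderive x v g z ->
  cderive x v (fun x => f x * g x) (w * g x + f x * z).
Proof.
move=> [f1 f2] [g1 g2]; split; rewrite !reimE; under eq_fun do rewrite reimE.
  apply: is_derive_eq (is_deriveB (is_deriveM f1 g1) (is_deriveM f2 g2)) _.
  rewrite -![_ *: _]/(_ * _); ring.
apply: is_derive_eq (is_deriveD (is_deriveM f1 g2) (is_deriveM f2 g1)) _.
rewrite -![_ *: _]/(_ * _); ring.
Qed.

Lemma cderiveD x v f g w z : cderive x v f w -> cderive x v g z ->
  cderive x v (fun x => f x + g x) (w + z).
Proof.
by move=> [f1 f2] [g1 g2]; split; rewrite !reimE; under eq_fun do rewrite reimE;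
  apply: is_derive_eq.
Qed.

Lemma cderive_cst x v c : cderive x v (fun=> c) 0.
Proof. by split; exact: is_derive_cst. Qed.

Lemma cderiveZ F (c w : R[i]) x v :
  cderive x v F w -> cderive x v (fun x => c * F x) (c * w).
Proof.
by move=> h; have := cderiveM (cderive_cst x v c) h; rewrite mul0r add0r.
Qed.

Lemma cderive_sum I (s : seq I) (F : I -> X -> R[i]) (w : I -> R[i]) x v :
  (forall i, cderive x v (F i) (w i)) ->
  cderive x v (fun x => \sum_(i <- s) F i x) (\sum_(i <- s) w i).
Proof.
move=> h; elim: s => [|i s ih].
  by rewrite big_nil; under eq_fun do rewrite big_nil; exact: cderive_cst.
by rewrite big_cons; under eq_fun do rewrite big_cons; exact: cderiveD.
Qed.

Lemma cintegral_derive (i : 'I_d) f g : tcont f -> tcont g ->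
  (forall x, cderive x 'e_i f (g x)) -> cintegral (fun t : T => g (row_of t)) = 0.
Proof.
move=> tf tg fg; have [_ g1 g2] := tg.
apply: complexP; [rewrite Re_cintegral|rewrite Im_cintegral].
  apply: (torus_integral_derive (tcont_Re tf) (tcont_Re tg)) => // x.
  by case: (fg x) => h _; exact: h.
apply: (torus_integral_derive (tcont_Im tf) (tcont_Im tg)) => // x.
by case: (fg x) => _ h; exact: h.
Qed.

(** For [n != 0] the character is a multiple of one of its own partial
    derivatives, so its integral vanishes. *)
Lemma cintegral_tchar n : cintegral (fun t : T => tchar n (row_of t)) = (n == 0)%:R.
Proof.
have [->|n0] := eqVneq n 0.
  by under eq_cintegral do rewrite tchar_0l; rewrite cintegral_cst.
have [i ni] : exists i, n 0 i != 0.
  apply/existsP; rewrite -negb_forall; apply: contra n0 => /forallP h.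
  by apply/eqP/rowP => i; rewrite mxE; apply/eqP.
have := @cintegral_derive i (tchar n) (fun x => (phase n 'e_i)*i * tchar n x) (tcont_tchar n)
  (tcontZ _ (tcont_tchar n)) (fun x => cderive_tchar n x 'e_i).
rewrite cintegralZ; last exact: tcont_integrable (tcont_tchar n).
rewrite phase_delta => /eqP; rewrite mulf_eq0 => /orP[|/eqP//].
by rewrite eq_complex /= eqxx /= intr_eq0 (negbTE ni).
Qed.

Definition fhat (f : X -> R[i]) (k : Zd) : R[i] :=
  cintegral (fun t : T => conjc (tchar k (row_of t)) * f (row_of t)).

Lemma tcont_conjM f k : tcont f -> tcont (fun x => conjc (tchar k x) * f x).
Proof. by move=> tf; apply: tcontM => //; apply: tcont_conj; exact: tcont_tchar. Qed.

(** Integration by parts: the derivative of the product of the conjugate character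
    with [f] integrates to zero. *)
Lemma fhat_deriv (i : 'I_d) f g k : tcont f -> tcont g ->
  (forall x, cderive x 'e_i f (g x)) -> fhat g k = ((k 0 i)%:~R)*i * fhat f k.
Proof.
move=> tf tg fg.
have tfk := tcont_conjM k tf; have tgk := tcont_conjM k tg.
have := @cintegral_derive i (fun x => conjc (tchar k x) * f x)
  (fun x => conjc (tchar k x) * g x + (- (phase k 'e_i)*i) * (conjc (tchar k x) * f x)) tfk
  (tcontD tgk (tcontZ _ tfk)).
have ifk := tcont_integrable tfk; have igk := tcont_integrable tgk.
have izk := cintegrableZ (- (phase k 'e_i)*i) ifk.
rewrite (cintegralD igk izk) (cintegralZ _ ifk).
rewrite phase_delta mulNr -/(fhat g k) -/(fhat f k) => h; apply/eqP; rewrite -subr_eq0.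
apply/eqP; apply: h => x.
have := cderiveM (cderive_conj (cderive_tchar k x 'e_i)) (fg x).
rewrite addrC phase_delta rmorphM mulrA; congr (cderive _ _ _ (_ + _)).
by rewrite -!mulrA; congr (_ * _); apply: complexP; rewrite /= ?oppr0.
Qed.

Lemma fhat_tchar n k : fhat (tchar n) k = (n == k)%:R.
Proof.
rewrite /fhat; under eq_cintegral do rewrite mulrC -tchar_subl.
by rewrite cintegral_tchar subr_eq0.
Qed.

Lemma fhatZ (c : R[i]) f k : tcont f -> fhat (fun x => c * f x) k = c * fhat f k.
Proof.
move=> tf; rewrite /fhat -cintegralZ; last exact: tcont_integrable (tcont_conjM k tf).
by apply: eq_cintegral => t; rewrite mulrCA.
Qed.

Lemma fhatD f g k : tcont f -> tcont g -> fhat (fun x => f x + g x) k = fhat f k + fhat g k.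
Proof.
move=> tf tg; rewrite /fhat -cintegralD; [|exact: tcont_integrable (tcont_conjM k tf)|
  exact: tcont_integrable (tcont_conjM k tg)].
by apply: eq_cintegral => t; rewrite mulrDr.
Qed.

Lemma fhat_sum I (s : seq I) (F : I -> X -> R[i]) k : (forall i, tcont (F i)) ->
  fhat (fun x => \sum_(i <- s) F i x) k = \sum_(i <- s) fhat (F i) k.
Proof.
move=> tF; rewrite /fhat -cintegral_sum => [|i]; last exact: tcont_integrable (tcont_conjM k (tF i)).
by apply: eq_cintegral => t; rewrite mulr_sumr.
Qed.

End IntegrationByParts.

(** * Fejer means *)

Section Fejer.
Context {R : realType} {d : nat}.
Local Notation X := 'rV[R]_d.
Local Notation Zd := 'rV[int]_d.
Local Notation T := (d.-tuple (measurableTypeR R)).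
Local Notation mu := (@torus_measure R d).

Section Kernel.
Variable m : nat.
Local Notation I := {ffun 'I_d -> 'I_m.+1}.

Definition box (q : I) : Zd := \row_i (q i : nat)%:Z.

Lemma box_inj : injective box.
Proof.
move=> p q /rowP pq; apply/ffunP => i; apply/val_inj.
by have := pq i; rewrite !mxE => -[].
Qed.

Definition boxN : R := #|I|%:R.

Lemma card_box_gt0 : (0 < #|I|)%N.
Proof. by rewrite card_ffun !card_ord expn_gt0. Qed.

Lemma boxN_gt0 : 0 < boxN.
Proof. by rewrite ltr0n card_box_gt0. Qed.

Lemma boxN_neq0 : boxN != 0.
Proof. by rewrite gt_eqF ?boxN_gt0. Qed.

(** The squared modulus of a Dirichlet kernel: it is manifestly nonnegative, and
    the differences of the modes of the box are its frequencies. *)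
Definition fejer_kernel (x y : X) : R :=
  boxN^-1 * normc (\sum_(q : I) tchar (box q) x * conjc (tchar (box q) y)) ^+ 2.

Lemma fejer_kernel_ge0 x y : 0 <= fejer_kernel x y.
Proof. by rewrite mulr_ge0 ?sqr_ge0// invr_ge0 ltW ?boxN_gt0. Qed.

Lemma fejer_kernelE x y : (fejer_kernel x y)%:C =
  (boxN^-1)%:C * \sum_(p : I) \sum_(q : I)
    tchar (box p - box q) x * conjc (tchar (box p - box q) y).
Proof.
rewrite /fejer_kernel real_complexM; congr (_ * _).
rewrite -conjcM_normc mulrC mulr_suml; apply: eq_bigr => p _.
rewrite conjc_sum mulr_sumr; apply: eq_bigr => q _.
by rewrite !tchar_subl !conjcM !conjcK mulrACA.
Qed.

Definition fejer_weight (k : Zd) : R :=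
  boxN^-1 * \sum_(p : I) \sum_(q : I) (box p - box q == k)%:R.

(** Written through Fourier coefficients, which is the form in which it arises as
    the symbol of a compression; [fejerE] gives the convolution. *)
Definition fejer (f : X -> R[i]) (x : X) : R[i] :=
  (boxN^-1)%:C * \sum_(p : I) \sum_(q : I) fhat f (box p - box q) * tchar (box p - box q) x.

Lemma tcont_fejer f : tcont (fejer f).
Proof.
apply: tcontZ; apply: tcont_sum => p; apply: tcont_sum => q.
by apply: tcontZ; exact: tcont_tchar.
Qed.

Lemma fejerE f x : tcont f ->
  cintegral (fun t : T => (fejer_kernel x (row_of t))%:C * f (row_of t)) = fejer f x.
Proof.
move=> tf.
have tpq p q : tcont (fun y => tchar (box p - box q) x *
    (conjc (tchar (box p - box q) y) * f y)).
  by apply: tcontZ; exact: tcont_conjM.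
transitivity (cintegral (fun t : T => (boxN^-1)%:C *
   \sum_p \sum_q tchar (box p - box q) x *
    (conjc (tchar (box p - box q) (row_of t)) * f (row_of t)))).
  apply: eq_cintegral => t; rewrite fejer_kernelE -mulrA; congr (_ * _).
  rewrite mulr_suml; apply: eq_bigr => p _; rewrite mulr_suml.
  by apply: eq_bigr => q _; rewrite mulrA.
rewrite cintegralZ; last first.
  by apply: cintegrable_sum => p; apply: cintegrable_sum => q; exact: tcont_integrable (tpq p q).
congr (_ * _); rewrite cintegral_sum => [|p]; last first.
  by apply: cintegrable_sum => q; exact: tcont_integrable (tpq p q).
apply: eq_bigr => p _; rewrite cintegral_sum => [|q]; last exact: tcont_integrable (tpq p q).
apply: eq_bigr => q _; rewrite cintegralZ; first by rewrite /fhat; exact: mulrC.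
exact: tcont_integrable (tcont_conjM _ tf).
Qed.

Lemma fejer_tchar k x : fejer (tchar k) x = (fejer_weight k)%:C * tchar k x.
Proof.
rewrite /fejer /fejer_weight rmorphM -mulrA; congr (_ * _).
rewrite rmorph_sum mulr_suml; apply: eq_bigr => p _.
rewrite rmorph_sum mulr_suml; apply: eq_bigr => q _.
by rewrite fhat_tchar eq_sym rmorph_nat; case: eqVneq => [->|]; rewrite ?mul0r.
Qed.

Lemma fhat_fejer f k : fhat (fejer f) k = (fejer_weight k)%:C * fhat f k.
Proof.
have tpq p q : tcont (fun y => fhat f (box p - box q) * tchar (box p - box q) y).
  by apply: tcontZ; exact: tcont_tchar.
rewrite /fejer fhatZ; last by apply: tcont_sum => p; apply: tcont_sum => q.
rewrite /fejer_weight rmorphM -mulrA; congr (_ * _).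
rewrite fhat_sum => [|p]; last by apply: tcont_sum.
rewrite rmorph_sum mulr_suml; apply: eq_bigr => p _.
rewrite fhat_sum// rmorph_sum mulr_suml; apply: eq_bigr => q _.
rewrite fhatZ; last exact: tcont_tchar.
by rewrite fhat_tchar rmorph_nat; case: eqVneq => [->|]; rewrite ?mulr0 ?mul0r ?mulr1 ?mul1r.
Qed.

Lemma fejer_weight0 : fejer_weight 0 = 1.
Proof.
rewrite /fejer_weight (eq_bigr (fun=> 1)); last first.
  move=> p _; rewrite (bigD1 p)//= subrr eqxx big1 ?addr0// => q qp.
  by rewrite subr_eq0 (inj_eq box_inj) eq_sym (negbTE qp).
by rewrite sumr_const -/boxN mulVf ?boxN_neq0.
Qed.

(** The coordinate [i] takes each of its [m + 1] values equally often. *)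
Lemma card_box_max (i : 'I_d) :
  (#|[pred q : I | q i == ord_max]| * m.+1)%N = #|I|.
Proof.
rewrite (@eq_card _ _ (family (fun j => if j == i then pred1 ord_max else predT))); last first.
  move=> q; rewrite !inE; apply/idP/familyP => [/eqP qi j|/(_ i)]; last first.
    by rewrite eqxx.
  by case: eqVneq => [->|_]; rewrite !inE ?qi.
rewrite card_family foldrE big_map big_enum /= (bigD1 i)//= eqxx card1 mul1n.
rewrite card_ffun -prod_nat_const [in RHS](bigD1 i)//= mulnC; congr (_ * _)%N.
  by rewrite card_ord.
apply: eq_bigr => j /negbTE ->; exact: eq_card.
Qed.

(** The differences equal to ['e_i] come from the [q] whose coordinate [i] is not
    maximal, one [p] for each such [q]. *)
Lemma fejer_weight_delta (i : 'I_d) : fejer_weight 'e_i = 1 - m.+1%:R^-1.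
Proof.
rewrite /fejer_weight exchange_big /=.
rewrite (eq_bigr (fun q : I => 1 - (q i == ord_max)%:R)); last first.
  move=> q _; have [qi|qi] := eqVneq (q i) ord_max.
    rewrite subrr big1// => p _; apply/eqP; rewrite pnatr_eq0 eqb0.
    apply/eqP => /rowP/(_ i); rewrite !mxE !eqxx qi /= => h.
    move/eqP: h; rewrite subr_eq -PoszD eqz_nat add1n => /eqP h.
    by have := ltn_ord (p i); rewrite h ltnn.
  have qm : (q i < m)%N.
    by rewrite ltn_neqAle -ltnS ltn_ord andbT; apply: contra qi => /eqP h; apply/eqP/val_inj.
  pose p0 : I := [ffun j => if j == i then Ordinal (qm : (q i).+1 < m.+1)%N else q j].
  have p0q : box p0 - box q = 'e_i.
    apply/rowP => j; rewrite !mxE ffunE eqxx /=; case: eqVneq => [->|] /=; last by rewrite subrr.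
    by rewrite -addn1 PoszD addrC addKr.
  rewrite subr0 (bigD1 p0)//= p0q eqxx big1 ?addr0// => p pp0.
  apply/eqP; rewrite pnatr_eq0 eqb0; apply: contra pp0; rewrite -p0q => /eqP/addIr/box_inj ->.
  exact: eqxx.
rewrite sumrB sumr_const -/boxN.
have -> : \sum_(q : I) (q i == ord_max)%:R = #|[pred q : I | q i == ord_max]|%:R :> R.
  rewrite -sum1_card natr_sum [RHS]big_mkcond.
  by apply: eq_bigr => q _; rewrite inE; case: eqP.
rewrite mulrBr mulVf ?boxN_neq0//; congr (1 - _).
rewrite /boxN -(card_box_max i) natrM invfM mulrAC mulVf ?mul1r//.
rewrite pnatr_eq0; apply: contraTneq card_box_gt0 => h.
by rewrite -(card_box_max i) h.
Qed.

Lemma fejer_kernel_tcont x : tcont (fun y => (fejer_kernel x y)%:C).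
Proof.
under eq_fun do rewrite fejer_kernelE; apply: tcontZ; apply: tcont_sum => p.
by apply: tcont_sum => q; apply: tcontZ; apply: tcont_conj; exact: tcont_tchar.
Qed.

Local Notation K x t := (fejer_kernel x (row_of t)).

Lemma fejer_kernel_integrable x : rintegrable (fun t : T => K x t).
Proof. by case: (tcont_integrable (fejer_kernel_tcont x)). Qed.

Lemma fejer_kernel_bound x : exists M, forall t : T, `|K x t| <= M.
Proof.
have [M hM] := tcont_bound (fejer_kernel_tcont x).
by exists M => t; rewrite (le_trans _ (hM (row_of t)))// normc_real.
Qed.

Lemma fejer_kernel_mass x : (\int[mu]_t K x t)%R = 1.
Proof.
have := fejerE x (tcont_tchar 0); rewrite fejer_tchar fejer_weight0.
under eq_cintegral do rewrite tchar_0l mulr1.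
by rewrite cintegral_real tchar_0l mulr1 => -[].
Qed.

Lemma fejer_kernel_cos x (i : 'I_d) :
  (\int[mu]_t (K x t * cos (x 0 i - tnth t i)))%R = 1 - m.+1%:R^-1.
Proof.
have := fejerE x (tcont_tchar 'e_i); rewrite fejer_tchar fejer_weight_delta => h.
have {h} : cintegral (fun t : T => conjc (tchar 'e_i x) * ((K x t)%:C * tchar 'e_i (row_of t)))
   = (1 - m.+1%:R^-1)%:C.
  rewrite cintegralZ ?h; first by rewrite mulrCA [conjc _ * _]mulrC tcharMconj mulr1.
  by apply: (tcont_integrable (tcontM (fejer_kernel_tcont x) (tcont_tchar 'e_i))).
move=> /(congr1 (@complex.Re R)); rewrite Re_cintegral [RHS]/= => <-.
apply: eq_Rintegral => t _; rewrite !reimE /tchar /= !phase_deltal mxE cosB; ring.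
Qed.

(** The kernel has mass one and multiplies each of the cosines by
    [1 - 1 / (m + 1)]. *)
Lemma fejer_kernel_chordal x :
  (\int[mu]_t (K x t * chordal x (row_of t)))%R = d%:R / m.+1%:R.
Proof.
have mcos i : measurable_fun setT (fun t : T => cos (x 0 i - tnth t i)).
  apply: measurableT_comp; first by apply: continuous_measurable_fun; exact: continuous_cos.
  by apply: measurable_funB => //; exact: measurable_tnth.
have ic i : rintegrable (fun t : T => K x t * cos (x 0 i - tnth t i)).
  under eq_fun do rewrite mulrC.
  by apply: (rintegrable_cmul (M:=1)) => // [t|]; [exact: cos_max|exact: fejer_kernel_integrable].
transitivity (\int[mu]_t \sum_(i < d) (K x t - K x t * cos (x 0 i - tnth t i)))%R.
  apply: eq_Rintegral => t _; rewrite /chordal mulr_sumr; apply: eq_bigr => i _.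
  by rewrite mxE mulrBr mulr1.
rewrite integral_sumR => [|i]; last by apply: rintegrableB => //; exact: fejer_kernel_integrable.
rewrite (eq_bigr (fun=> m.+1%:R^-1)) ?sumr_const ?card_ord ?mulr_natl// => i _.
rewrite (RintegralB _ (fejer_kernel_integrable x) (ic i))//.
by rewrite fejer_kernel_mass fejer_kernel_cos subKr.
Qed.

Lemma chordal_le (x y : X) : chordal x y <= 2 * d%:R.
Proof.
rewrite /chordal (le_trans (ler_sum _ (G := fun=> 2) _))//.
  by move=> i _; have := cos_geN1 (x 0 i - y 0 i); lra.
by rewrite sumr_const card_ord mulr_natr.
Qed.

(** Korovkin's argument: integrate the bound on the oscillation against the
    kernel, which is a probability density. *)
Lemma fejer_approx (u : T -> R) (x : X) (u0 A B : R) : measurable_fun setT u ->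
  0 <= B -> (forall t, `|u0 - u t| <= A + B * chordal x (row_of t)) ->
  `|u0 - (\int[mu]_t (K x t * u t))%R| <= A + B * (d%:R / m.+1%:R).
Proof.
move=> mu_ B0 hu.
have iK := fejer_kernel_integrable x.
have [M KM] := fejer_kernel_bound x.
have mch : measurable_fun setT (fun t : T => chordal x (row_of t)).
  apply: measurable_sum => i; apply: measurable_funB => //.
  apply: measurableT_comp; first by apply: continuous_measurable_fun; exact: continuous_cos.
  apply: measurable_funB => //.
  by under [X in measurable_fun _ X]eq_fun do rewrite mxE; exact: measurable_tnth.
have iKch : rintegrable (fun t : T => K x t * chordal x (row_of t)).
  under eq_fun do rewrite mulrC.
  apply: (rintegrable_cmul (M := 2 * d%:R)) => // t.
  by rewrite ger0_norm ?chordal_ge0 ?chordal_le.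
have ub t : `|u t| <= `|u0| + (A + B * (2 * d%:R)).
  rewrite -[u t](subKr u0) (le_trans (ler_normB _ _))// lerD2l (le_trans (hu t))//.
  by rewrite lerD2l ler_wpM2l// chordal_le.
have iKu : rintegrable (fun t : T => K x t * u t).
  by under eq_fun do rewrite mulrC; exact: rintegrable_cmul ub iK.
have iKu0 := rintegrableZ u0 iK.
have -> : u0 - (\int[mu]_t (K x t * u t))%R = (\int[mu]_t (u0 * K x t - K x t * u t))%R.
  by rewrite RintegralB// RintegralZl// fejer_kernel_mass mulr1.
have iB := rintegrableB iKu0 iKu.
rewrite (le_trans (le_normr_Rintegral _ iB))//.
have iA := rintegrableD (rintegrableZ A iK) (rintegrableZ B iKch).
rewrite (le_trans (le_Rintegral _ (integrable_norm iB) iA _))//.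
  move=> t _ /=; rewrite [u0 * _]mulrC -mulrBr normrM ger0_norm ?fejer_kernel_ge0//.
  have -> : A * K x t + B * (K x t * chordal x (row_of t)) =
    K x t * (A + B * chordal x (row_of t)) by ring.
  by rewrite ler_wpM2l ?fejer_kernel_ge0.
rewrite (RintegralD measurableT (rintegrableZ A iK) (rintegrableZ B iKch)).
rewrite (RintegralZl A measurableT iK) (RintegralZl B measurableT iKch).
by rewrite fejer_kernel_mass fejer_kernel_chordal mulr1.
Qed.

Lemma fejer_close f x A B : tcont f -> 0 <= B ->
  (forall y, `|complex.Re (f x) - complex.Re (f y)| <= A + B * chordal x y) ->
  (forall y, `|complex.Im (f x) - complex.Im (f y)| <= A + B * chordal x y) ->
  normc (f x - fejer f x) <= 2 * (A + B * (d%:R / m.+1%:R)).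
Proof.
move=> tf B0 h1 h2; have [m1 m2] := tcont_meas tf.
rewrite (le_trans (normc_le_ReIm _))// mulrDl mul1r -fejerE// !reimE.
rewrite Re_cintegral Im_cintegral; apply: lerD.
  under eq_Rintegral do rewrite reimE /= mul0r subr0.
  exact: fejer_approx.
under eq_Rintegral do rewrite reimE /= mul0r addr0.
exact: fejer_approx.
Qed.

End Kernel.

(** Uniform density of trigonometric polynomials in the continuous periodic
    functions. *)
Lemma fejer_uniform f (e : R) : tcont f -> 0 < e ->
  exists m0, forall m, (m0 <= m)%N -> forall x, normc (f x - fejer m f x) <= e.
Proof.
move=> tf e0; have [_ f1 f2] := tf.
have e4 : 0 < e / 4 by rewrite divr_gt0.
have [K1 K10 h1] := periodic_modulus (tcont_Re tf) f1 e4.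
have [K2 K20 h2] := periodic_modulus (tcont_Im tf) f2 e4.
pose B := K1 + K2; have B0 : 0 <= B by rewrite addr_ge0.
exists (Num.bound (B * d%:R / (e / 4))) => m mm x.
have -> : e = 2 * (e / 4 + e / 4) by lra.
apply: le_trans (@fejer_close m f x (e / 4) B tf B0 _ _) _.
- move=> y; rewrite (le_trans (h1 x y))// lerD2l ler_wpM2r ?chordal_ge0//.
  by rewrite lerDl.
- move=> y; rewrite (le_trans (h2 x y))// lerD2l ler_wpM2r ?chordal_ge0//.
  by rewrite lerDr.
rewrite ler_wpM2l// lerD2l mulrA ler_pdivrMr ?ltr0n//.
rewrite -ler_pdivrMl// mulrC.
apply: ltW; apply: (lt_le_trans (archi_boundP _)).
  by rewrite divr_ge0 ?mulr_ge0// ltW.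
by rewrite ler_nat ltnW.
Qed.

(** * Completeness of the characters *)

Section Completeness.

Local Notation cube := [set t : T | forall i, 0 < (tnth t i : R) < 2 * pi].
Local Notation U := (uniform_prob (@torus_period_gt0 R)).

(** Periodic functions take the same value on opposite faces of the cube, so
    indicators of boxes can only be approximated away from the faces. *)
Lemma torus_measure_cube : {ae mu, forall t : T, cube t}.
Proof.
have coord (i : 'I_d) : {ae mu, forall t : T, 0 < (tnth t i : R) < 2 * pi}.
  pose B := ~` `]0, 2 * pi[%classic : set R.
  have mB : measurable B by apply: measurableC; exact: measurable_itv.
  pose A := [set t : T | B (tnth t i)].
  have mA : measurable A.
    by rewrite -[A]setTI; apply: (measurable_tnth (T := measurableTypeR R)).
  exists A; split; [exact: mA| |by move=> t /= h; rewrite /A/B/= in_itv/=].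
  have UB : U B = 0.
    rewrite /uniform_prob integral_uniform_pdf.
    rewrite (_ : B `&` _ = [set 0] `|` [set 2 * pi]); last first.
      have p2 := @torus_period_gt0 R.
      apply/seteqP; split => x; rewrite /B /= !in_itv /=.
        move=> [/negP + /andP[x0 x2]]; rewrite negb_and -!leNgt => /orP[h|h].
          by left; apply/eqP; rewrite eq_le h x0.
        by right; apply/eqP; rewrite eq_le x2 h.
      by move=> [->|->]; rewrite !ltxx ?lexx ?(ltW p2) ?andbF.
    apply: null_set_integral => //; first exact: measurableU.
      by apply/measurable_EFinP/measurable_funTS; exact: measurable_uniform_pdf.
    apply: countable_lebesgue_measure0; apply: finite_set_countable.
    by rewrite finite_setU; split; exact: finite_set1.
  have := @torus_integral_line0 R d i (\1_A) 1.
  rewrite integral_indic// setIT; apply.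
  - exact: measurable_indic.
  - by move=> t; rewrite indicE ger0_norm// lern1; case: (_ \in _).
  - move=> t; transitivity (\int[U]_s (\1_B s)%:E)%E; last by rewrite integral_indic// setIT.
    apply: eq_integral => s _; rewrite !indicE.
    suff -> : (set_coord t i s \in A) = (s \in B) by [].
    by apply/idP/idP => /set_mem h; apply/mem_set; move: h; rewrite /A /= tnth_mktuple eqxx.
have : {ae mu, forall t : T, forall i, i \in enum 'I_d -> 0 < (tnth t i : R) < 2 * pi}.
  elim: (enum 'I_d) => [|i s ih]; first exact: aeW.
  move: ih (coord i); apply: filterS2 => t h1 h2 j.
  by rewrite inE => /predU1P[->//|]; exact: h1.
by apply: filterS => t h i; apply: h; rewrite mem_enum.
Qed.

(** A system of sets, stable under intersection and generating the
    sigma-algebra, over which integrals are limits of integrals of continuous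
    periodic functions. *)
Definition cube_approx (A : set T) : Prop := measurable A /\
  exists u : nat -> X -> R^o, [/\ forall j, rperiodic (u j), forall j, continuous (u j),
    forall j x, 0 <= u j x <= 1 &
    forall t, cube t -> (fun j => u j (row_of t) : R^o) @ \oo --> (\1_A t : R^o)].

Lemma cube_approxI : setI_closed cube_approx.
Proof.
move=> A B [mA [u [pu cu u01 uA]]] [mB [v [pv cv v01 vB]]].
split; first exact: measurableI.
exists (fun j x => u j x * v j x); split.
- by move=> j n x; rewrite pu pv.
- by move=> j x; apply: cvgM; [exact: nbhs_filter|exact: cu|exact: cv].
- move=> j x; have /andP[u0 u1] := u01 j x; have /andP[v0 v1] := v01 j x.
  by rewrite mulr_ge0//= mulr_ile1.
- by move=> t ct; rewrite indicI; apply: cvgM; [exact: uA|exact: vB].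
Qed.

(** On the cube the sign of [cos (t_i - b / 2) - cos (b / 2)] tells whether
    [t_i < b], so truncated multiples of this periodic function converge to the
    indicator. *)
Lemma cube_approx_ray (i : 'I_d) (b : R) : cube_approx [set t : T | (tnth t i : R) < b].
Proof.
set A := [set t | _].
have mA : measurable A.
  rewrite -[A]setTI -[A](_ : (tnth (T := measurableTypeR R))^~ i @^-1` `]-oo, b[%classic = A).
    exact: (measurable_tnth (T := measurableTypeR R)).
  by apply/seteqP; split => t /=; rewrite in_itv.
split=> //.
have [b0|b0] := leP b 0.
  exists (fun _ _ => 0); split => // [j|j x|t ct]; first exact: cst_continuous.
    by rewrite lexx ler01.
  rewrite indicE memNset; first exact: cvg_cst.
  by move=> /= h; have /andP[] := ct i; rewrite ltNge (le_trans (ltW h) b0).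
have [b2|b2] := leP (2 * pi) b.
  exists (fun _ _ => 1); split => // [j|j x|t ct]; first exact: cst_continuous.
    by rewrite lexx ler01.
  rewrite indicE mem_set; first exact: cvg_cst.
  by have /andP[_ h] := ct i; rewrite /A /= (lt_le_trans h b2).
pose g (x : X) : R := cos (x 0 i - b / 2) - cos (b / 2).
have cg : continuous (g : X -> R^o).
  have c1 : continuous (fun x : X => x 0 i - b / 2 : R^o).
    move=> x.
    apply: (@cvgB R R^o X (nbhs x) _ (fun y : X => y 0 i : R^o) (cst (b / 2))).
      exact: (@coord_continuous R 1 d 0 i).
    exact: cvg_cst.
  have c2 : continuous (fun x : X => cos (x 0 i - b / 2) : R^o).
    by move=> x; apply: continuous_comp (c1 x) _; exact: continuous_cos.
  move=> x.
  apply: (@cvgB R R^o X (nbhs x) _ (fun y : X => cos (y 0 i - b / 2) : R^o) (cst (cos (b / 2)))).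
    exact: c2.
  exact: cvg_cst.
exists (fun j x => Num.min 1 (Num.max 0 (j%:R * g x))); split.
- move=> j n x; congr (Num.min _ (Num.max _ (_ * _))); rewrite /g; congr (_ - _).
  rewrite !mxE addrAC; move: (x 0 i - b / 2) => a.
  by rewrite cosD cos_2piz sin_2piz mulr1 mulr0 subr0.
- move=> j.
  have c1 : continuous (fun x : X => j%:R * g x : R^o).
    move=> x; apply: (@cvgM R X (nbhs x) _ (cst j%:R) g); last exact: cg.
    exact: cvg_cst.
  have c2 := @max_fun_continuous _ X R (cst 0) _ (@cst_continuous _ _ _) c1.
  exact: (@min_fun_continuous _ X R (cst 1) _ (@cst_continuous _ _ _) c2).
- by move=> j x; rewrite le_min ler01 le_max lexx /= ge_min lexx.
move=> t ct; have /andP[t0 t2] := ct i; rewrite indicE.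
(* the factorization shows the sign: the first sine is positive on the cube and
   the second has the sign of [b - t_i] *)
have sum2 : cos (tnth t i - b / 2) - cos (b / 2) =
    2 * (sin (tnth t i / 2) * sin ((b - tnth t i) / 2)).
  have -> : tnth t i - b / 2 = tnth t i / 2 - (b - tnth t i) / 2 by lra.
  have -> : cos (b / 2) = cos (tnth t i / 2 + (b - tnth t i) / 2) by congr cos; lra.
  by rewrite cosB cosD; ring.
have gt : g (row_of t) = 2 * (sin (tnth t i / 2) * sin ((b - tnth t i) / 2)).
  by rewrite /g mxE.
have s1 : 0 < sin (tnth t i / 2) by apply: sin_gt0_pi; apply/andP; split; lra.
have [tb|bt] := ltP (tnth t i : R) b.
  rewrite mem_set//; apply: cvg_near_cst.
  have s2 : 0 < sin ((b - tnth t i) / 2) by apply: sin_gt0_pi; apply/andP; split; lra.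
  have g0 : 0 < g (row_of t) by rewrite gt mulr_gt0 ?mulr_gt0.
  near=> j.
  have jg : 1 <= j%:R * g (row_of t).
    rewrite -ler_pdivrMr// mul1r; near: j; exact: nbhs_infty_ger.
  by rewrite max_r ?min_l// (le_trans ler01 jg).
rewrite memNset; last by rewrite /A /=; apply/negP; rewrite -leNgt.
apply: cvg_near_cst; apply: nearW => j.
have s2 : sin ((b - tnth t i) / 2) <= 0.
  rewrite -oppr_ge0 -sinN; apply: sin_ge0_pi; apply/andP; split; lra.
rewrite max_l ?min_r ?ler01// mulr_ge0_le0// gt mulr_ge0_le0// mulr_ge0_le0// ltW//.
Unshelve. all: by end_near.
Qed.

Lemma cube_approx_generates : @measurable _ T = <<s cube_approx >>.
Proof.
apply/seteqP; split; last first.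
  apply: smallest_sub; first exact: sigma_algebra_measurable.
  by move=> A [].
apply: smallest_sub; first exact: smallest_sigma_algebra.
apply: (big_ind (fun S : set (set T) => S `<=` <<s cube_approx >>)) => [|S S' h h'|j _].
- by [].
- by rewrite subUset; split.
move=> A [B mB <-]; rewrite setTI.
move: mB; rewrite RGenInftyO.measurableE.
pose H := [set B : set R | <<s cube_approx >> ((fun t : T => tnth t j) @^-1` B)].
suff : <<s @RGenInftyO.G R >> `<=` H by move=> h /h.
apply: smallest_sub.
  split.
  - by rewrite /H/= preimage_set0; exact: sigma_algebra0.
  - by move=> C HC; rewrite /H /= setTD preimage_setC; exact: sigma_algebraC.
  - by move=> F HF; rewrite /H /= preimage_bigcup; exact: sigma_algebra_bigcup.
move=> _ [b ->]; apply: sub_sigma_algebra.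
rewrite (_ : _ @^-1` _ = [set t : T | (tnth t j : R) < b]); first exact: cube_approx_ray.
by apply/seteqP; split => t /=; rewrite in_itv.
Qed.

(** By dominated convergence [h] integrates to zero over the sets of
    [cube_approx], and the sets over which it does form a Dynkin system. *)
Lemma continuous_orthogonal_ae0 (h : T -> R) : rintegrable h ->
  (forall u : X -> R^o, rperiodic u -> continuous u ->
     (\int[mu]_t (u (row_of t) * h t))%R = 0) ->
  {ae mu, forall t, h t = 0}.
Proof.
move=> ih hu; have mh := rintegrable_meas ih.
have ihE A : measurable A -> mu.-integrable A (EFin \o h).
  by move=> mA; apply: integrableS ih.
have z A : measurable A -> (\int[mu]_(t in A) (h t)%:E = 0)%E.
  rewrite cube_approx_generates; move: A.
  have hT : (\int[mu]_t (h t)%:E = 0)%E.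
    have := hu (cst 1) (fun _ _ => erefl) (@cst_continuous _ _ _).
    rewrite /Rintegral; under eq_integral do rewrite mul1r.
    by move=> h0; rewrite -(fineK (integrable_fin_num measurableT ih)) h0.
  apply: (dynkin_induction (P := fun A => (\int[mu]_(t in A) (h t)%:E = 0)%E) cube_approx_generates).
  - exact: cube_approxI.
  - exact: hT.
  - move=> A [mA [u [pu cu u01 uA]]].
    have muj j := measurable_continuous_row (cu j).
    have iuh j : mu.-integrable setT (EFin \o (fun t => u j (row_of t) * h t)).
      apply: (rintegrable_cmul (M := 1)) => // t.
      by have /andP[a b] := u01 j (row_of t); rewrite ger0_norm.
    have m1 j : measurable_fun setT (fun t : T => (u j (row_of t) * h t)%:E).
      by apply/measurable_EFinP; exact: measurable_funM.
    have m2 : measurable_fun setT (fun t : T => (\1_A t * h t)%:E).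
      by apply/measurable_EFinP; apply: measurable_funM => //; exact: measurable_indic.
    have lim : {ae mu, forall t, setT t ->
        (fun j => (u j (row_of t) * h t)%:E) @ \oo --> (\1_A t * h t)%:E}.
      move: torus_measure_cube; apply: filterS => t ct _.
      apply: cvg_EFin; first exact: nearW.
      by apply: cvgM; [exact: uA|exact: cvg_cst].
    have bd : {ae mu, forall t j, setT t -> (`|(u j (row_of t) * h t)%:E| <= `|h t|%:E)%E}.
      apply: aeW => t j _; rewrite lee_fin normrM ler_piMl//.
      by have /andP[a b] := u01 j (row_of t); rewrite ger0_norm.
    have [_ _] := dominated_convergence measurableT m1 m2 lim (integrable_norm ih) bd.
    rewrite (_ : (fun j => _) = cst 0%E) => [dc|]; last first.
      by apply/funext => j /=; rewrite -(fineK (integrable_fin_num measurableT (iuh j))) [fine _]hu.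
    rewrite integral_mkcond.
    transitivity (\int[mu]_t (\1_A t * h t)%:E)%E.
      apply: eq_integral => t _; rewrite patchE indicE.
      by case: ifP; rewrite ?mul1r ?mul0r.
    by apply: (cvg_unique (@ereal_hausdorff R) dc); exact: cvg_cst.
  - move=> A mA A0; move: hT; rewrite -(setUCr A) integral_setU//.
    + by rewrite A0 add0e.
    + exact: measurableC.
    + by rewrite setUCr; apply/measurable_EFinP.
    + by apply/disj_setPS; rewrite setICr.
  - move=> F mF tF F0; rewrite integral_bigcup//; last first.
      by apply: ihE; exact: bigcupT_measurable.
    by apply: eseries0 => k _ _; exact: F0.
have := @integral_ae_eq _ T R mu setT measurableT (cst 0%E) (EFin \o h) ih.
move=> /(_ (measurable_cst _)); case.
  by move=> A _ mA; rewrite z// integral0.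
move=> N [mN N0 sN]; exists N; split => // t ht; apply: sN => /= h0.
by apply: ht; have [] := h0 I.
Qed.

(** Fejer means are linear combinations of characters, hence orthogonal to [h]; by
    uniform density so are all continuous periodic functions. *)
Lemma fourier_unique (h : T -> R[i]) : cintegrable h ->
  (forall n, cintegral (fun t : T => conjc (tchar n (row_of t)) * h t) = 0) ->
  {ae mu, forall t, h t = 0}.
Proof.
move=> ih h0; have [i1 i2] := ih.
have trig0 m f : cintegral (fun t : T => fejer m f (row_of t) * h t) = 0.
  have imul c n : cintegrable (fun t : T => c * tchar n (row_of t) * h t).
    apply: cintegrableM => //.
      by apply: cmeasM; [exact: cmeas_cst|exact: tcont_meas (tcont_tchar n)].
    by apply: cboundedM; [exact: cbounded_cst|exact: tcont_cbounded (tcont_tchar n)].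
  transitivity (cintegral (fun t : T => (boxN m)^-1%:C *
      \sum_p \sum_q fhat f (@box m p - @box m q) * tchar (@box m p - @box m q) (row_of t) * h t)).
    apply: eq_cintegral => t; rewrite /fejer -mulrA; congr (_ * _).
    by rewrite mulr_suml; apply: eq_bigr => p _; rewrite mulr_suml.
  rewrite cintegralZ; last by apply: cintegrable_sum => p; exact: cintegrable_sum.
  rewrite cintegral_sum; last by move=> p; exact: cintegrable_sum.
  rewrite big1 ?mulr0// => p _; rewrite cintegral_sum// big1// => q _.
  rewrite -[box p - box q]opprK; under eq_cintegral do rewrite tchar_oppl -mulrA.
  rewrite cintegralZ ?h0 ?mulr0//; apply: cintegrableM => //.
    by apply: cmeas_conj; exact: tcont_meas (tcont_tchar _).
  by apply: cbounded_conj; exact: tcont_cbounded (tcont_tchar _).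
have real0 (u : X -> R^o) : rperiodic u -> continuous u ->
    cintegral (fun t : T => (u (row_of t))%:C * h t) = 0.
  move=> pu cu; have tu : tcont (fun x => (u x)%:C).
    by split; [move=> n x; rewrite pu|exact: cu|exact: cst_continuous].
  pose S : R := (\int[mu]_t (`|complex.Re (h t)| + `|complex.Im (h t)|))%R.
  have iS : rintegrable (fun t : T => `|complex.Re (h t)| + `|complex.Im (h t)|).
    by apply: rintegrableD; exact: integrable_norm.
  have S0 : 0 <= S by apply: Rintegral_ge0 => t _; rewrite addr_ge0.
  have iuh : cintegrable (fun t : T => (u (row_of t))%:C * h t).
    by apply: cintegrableM => //; [exact: tcont_meas tu|exact: tcont_cbounded tu].
  suff bnd e : 0 < e -> normc (cintegral (fun t : T => (u (row_of t))%:C * h t)) <= 2 * e * S.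
    apply: eq0_normc; apply/eqP; rewrite eq_le normc_ge0 andbT.
    apply/ler_addgt0Pr => e e0; rewrite add0r.
    have S1 : 0 < 2 * (S + 1) by rewrite mulr_gt0// ltr_wpDl.
    rewrite (le_trans (bnd (e / (2 * (S + 1))) _)) ?divr_gt0//.
    rewrite mulrA mulrAC ler_pdivrMr// mulrAC.
    have -> : e * (2 * (S + 1)) = 2 * S * e + 2 * e by ring.
    by rewrite lerDl mulr_ge0// ltW.
  move=> e0; have [m0 hm] := fejer_uniform tu e0.
  have {}hm := hm _ (leqnn m0).
  have ifh : cintegrable (fun t : T => fejer m0 (fun x => (u x)%:C) (row_of t) * h t).
    apply: cintegrableM => //; first exact: tcont_meas (tcont_fejer _ _).
    exact: tcont_cbounded (tcont_fejer _ _).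
  pose g t := ((u (row_of t))%:C - fejer m0 (fun x => (u x)%:C) (row_of t)) * h t.
  have -> : cintegral (fun t : T => (u (row_of t))%:C * h t) = cintegral g.
    rewrite -[LHS]subr0 -(trig0 m0 (fun x => (u x)%:C)) -mulN1r -cintegralZ// -cintegralD//.
      by apply: eq_cintegral => t; rewrite /g mulrBl mulN1r.
    exact: cintegrableZ.
  have ig : cintegrable g.
    rewrite (_ : g = fun t => (u (row_of t))%:C * h t +
       -1 * (fejer m0 (fun x => (u x)%:C) (row_of t) * h t)).
      by apply: cintegrableD => //; exact: cintegrableZ.
    by apply/funext => t; rewrite /g mulrBl mulN1r.
  have gb t : normc (g t) <= e * (`|complex.Re (h t)| + `|complex.Im (h t)|).
    by rewrite normcM ler_pM ?normc_ge0 ?normc_le_ReIm.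
  have [g1 g2] := ig; have iSe := rintegrableZ e iS.
  have part (k : T -> R) : rintegrable k -> (forall t, `|k t| <= normc (g t)) ->
      `|(\int[mu]_t k t)%R| <= e * S.
    move=> ik kg; rewrite (le_trans (le_normr_Rintegral measurableT ik))//.
    rewrite -(RintegralZl e measurableT iS).
    apply: (le_Rintegral measurableT (integrable_norm ik) iSe) => t _.
    exact: le_trans (kg t) (gb t).
  rewrite (le_trans (normc_le_ReIm _))// Re_cintegral Im_cintegral -mulrA mulr_natl mulr2n.
  by rewrite lerD ?part// => t; [exact: normc_Re|exact: normc_Im].
have r1 : {ae mu, forall t, complex.Re (h t) = 0}.
  apply: continuous_orthogonal_ae0 => // u pu cu.
  have /(congr1 (@complex.Re R)) := real0 u pu cu; rewrite Re_cintegral [RHS]/= => <-.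
  by apply: eq_Rintegral => t _; rewrite reimE /= mul0r subr0.
have r2 : {ae mu, forall t, complex.Im (h t) = 0}.
  apply: continuous_orthogonal_ae0 => // u pu cu.
  have /(congr1 (@complex.Im R)) := real0 u pu cu; rewrite Im_cintegral [RHS]/= => <-.
  by apply: eq_Rintegral => t _; rewrite reimE /= mul0r addr0.
by move: r1 r2; apply: filterS2 => t e1 e2; exact: complexP.
Qed.

End Completeness.

End Fejer.

(** * Square-integrable spinor fields *)

Section VectorNorm.
Context {R : realType} {p : nat}.
Local Notation C := R[i].
Local Notation V := 'cV[C]_p.
Implicit Types (u v w : V).

Definition vn2 v : R := \sum_k normc (v k 0) ^+ 2.
Definition vdot u v : C := \sum_k conjc (u k 0) * v k 0.

Lemma vn2_ge0 v : 0 <= vn2 v.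
Proof. by apply: sumr_ge0 => k _; exact: sqr_ge0. Qed.

Lemma vdotE v : vdot v v = (vn2 v)%:C.
Proof. by rewrite /vdot /vn2 rmorph_sum; apply: eq_bigr => k _; rewrite conjcM_normc. Qed.

Lemma vdotDr u v w : vdot u (v + w) = vdot u v + vdot u w.
Proof. by rewrite /vdot -big_split; apply: eq_bigr => k _; rewrite mxE mulrDr. Qed.
Lemma vdotZr u (a : C) v : vdot u (a *: v) = a * vdot u v.
Proof. by rewrite /vdot mulr_sumr; apply: eq_bigr => k _; rewrite mxE mulrCA. Qed.
Lemma vdotNr u v : vdot u (- v) = - vdot u v.
Proof. by rewrite -scaleN1r vdotZr mulN1r. Qed.
Lemma vdotC u v : vdot u v = conjc (vdot v u).
Proof. by rewrite /vdot conjc_sum; apply: eq_bigr => k _; rewrite conjcM conjcK mulrC. Qed.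
Lemma vdotZl u (a : C) v : vdot (a *: u) v = conjc a * vdot u v.
Proof. by rewrite vdotC vdotZr conjcM -vdotC. Qed.
Lemma vdotDl u v w : vdot (u + v) w = vdot u w + vdot v w.
Proof. by rewrite (vdotC u) (vdotC v) (vdotC (_ + _)) vdotDr rmorphD. Qed.
Lemma vdotNl u v : vdot (- u) v = - vdot u v.
Proof. by rewrite (vdotC u) (vdotC (- u)) vdotNr rmorphN. Qed.
Lemma vdot_sumr I (s : seq I) (F : I -> V) u :
  vdot u (\sum_(i <- s) F i) = \sum_(i <- s) vdot u (F i).
Proof.
elim: s => [|i s ih]; last by rewrite !big_cons vdotDr ih.
by rewrite !big_nil /vdot big1// => k _; rewrite mxE mulr0.
Qed.

Lemma vn2Z (a : C) v : vn2 (a *: v) = normc a ^+ 2 * vn2 v.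
Proof. by rewrite /vn2 mulr_sumr; apply: eq_bigr => k _; rewrite mxE normcM exprMn. Qed.

Lemma vn2_sub u v : vn2 (u - v) = vn2 u - 2 * complex.Re (vdot v u) + vn2 v.
Proof.
apply: complexI; rewrite -vdotE !(vdotDr, vdotDl, vdotNl, vdotNr) !vdotE.
rewrite (vdotC u v); apply: complexP; rewrite !reimE /=; ring.
Qed.

(** The nonnegativity of the squared norm of [B a - z b], with [z] the inner
    product and [B] the squared norm of [b].  For [B = 0] this says nothing, but
    then every [b i] vanishes. *)
Lemma cauchy_schwarz I (s : seq I) (a b : I -> V) :
  normc (\sum_(i <- s) vdot (b i) (a i)) ^+ 2 <=
  (\sum_(i <- s) vn2 (b i)) * (\sum_(i <- s) vn2 (a i)).
Proof.
set z := \sum_(i <- s) vdot _ _; set B := \sum_(i <- s) vn2 (b i).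
set A := \sum_(i <- s) vn2 (a i).
have B0 : 0 <= B by apply: sumr_ge0 => i _; exact: vn2_ge0.
have : 0 <= \sum_(i <- s) vn2 (B%:C *: a i - z *: b i).
  by apply: sumr_ge0 => i _; exact: vn2_ge0.
rewrite (eq_bigr (fun i => B ^+ 2 * vn2 (a i) -
    2 * B * complex.Re (conjc z * vdot (b i) (a i)) + normc z ^+ 2 * vn2 (b i))); last first.
  move=> i _; rewrite vn2_sub !vn2Z normc_real real_normK ?num_real// vdotZl vdotZr.
  by rewrite mulrCA !reimE /=; ring.
rewrite !big_split /= -!mulr_sumr sumrN -mulr_sumr -Re_sum -mulr_sumr -/z -/A -/B.
rewrite conjcM_normc /= => h.
have [B00|Bn] := eqVneq B 0.
  have bz i : vn2 (b i) = 0 -> forall v, vdot (b i) v = 0.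
    move=> /eqP; rewrite psumr_eq0 => [/allP h0 v|k _]; last exact: sqr_ge0.
    rewrite /vdot big1// => k _; have := h0 k; rewrite mem_index_enum => /(_ isT).
    by rewrite sqrf_eq0 => /eqP/eq0_normc ->; rewrite conjc0 mul0r.
  have -> : z = 0.
    rewrite /z; move: B00 => /eqP; rewrite /B.
    elim: (s) => [|i r ih]; first by rewrite !big_nil.
    rewrite !big_cons paddr_eq0 ?vn2_ge0//; last by apply: sumr_ge0 => j _; exact: vn2_ge0.
    by move=> /andP[/eqP /bz -> /ih ->]; rewrite addr0.
  by rewrite normc0 expr0n mulr_ge0//; apply: sumr_ge0 => i _; exact: vn2_ge0.
have Bp : 0 < B by rewrite lt_def Bn B0.
by rewrite -subr_ge0 -(pmulr_rge0 _ Bp); apply: le_trans h _; rewrite le_eqVlt; apply/orP; left; apply/eqP; ring.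
Qed.

Lemma vn2_mulmx (M : 'M[C]_p) : exists2 c, 0 <= c &
  forall v : 'cV[C]_p, vn2 (M *m v) <= c * vn2 v.
Proof.
pose u k : 'cV[C]_p := \col_j conjc (M k j).
exists (\sum_k vn2 (u k)); first by apply: sumr_ge0 => k _; exact: vn2_ge0.
move=> v; rewrite /vn2 mulr_suml; apply: ler_sum => k _.
have := cauchy_schwarz [:: tt] (fun=> v) (fun=> u k); rewrite !big_seq1.
congr (_ <= _); congr (normc _ ^+ 2); rewrite mxE; apply: eq_bigr => j _.
by rewrite mxE conjcK.
Qed.

(** Cauchy-Schwarz between the family and the constant family equal to its sum. *)
Lemma vn2_sum I (s : seq I) (F : I -> 'cV[C]_p) :
  vn2 (\sum_(i <- s) F i) <= (size s)%:R * \sum_(i <- s) vn2 (F i).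
Proof.
set w := \sum_(i <- s) F i.
have h := cauchy_schwarz s F (fun=> w).
rewrite -vdot_sumr -/w vdotE normc_real in h.
rewrite big_const_seq count_predT iter_addr_0 in h.
rewrite real_normK ?num_real// expr2 in h.
have [w0|w0] := eqVneq (vn2 w) 0.
  by rewrite w0 mulr_ge0//; apply: sumr_ge0 => i _; exact: vn2_ge0.
have wp : 0 < vn2 w by rewrite lt_def w0 vn2_ge0.
by rewrite -(ler_pM2l wp) mulrA mulr_natr.
Qed.

Definition selfadjoint (M : 'M[C]_p) := map_mx (@conjc R) M^T = M.

Lemma vdot_selfadjoint (M : 'M[C]_p) u v : selfadjoint M ->
  vdot (M *m u) v = vdot u (M *m v).
Proof.
move=> sM; rewrite /vdot.
under eq_bigr do rewrite mxE conjc_sum mulr_suml.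
rewrite exchange_big; apply: eq_bigr => j _; rewrite mxE mulr_sumr.
apply: eq_bigr => k _; rewrite -[in RHS]sM !mxE conjcM; ring.
Qed.

End VectorNorm.

Section Spinors.
Context {R : realType} {d : nat}.
Local Notation C := R[i].
Local Notation X := 'rV[R]_d.
Local Notation Zd := 'rV[int]_d.
Local Notation T := (d.-tuple (measurableTypeR R)).
Local Notation mu := (@torus_measure R d).
Local Notation V := 'cV[C]_(2 ^ d./2).
Local Notation spinor := (@spinor R d).
Implicit Types (xi eta chi : spinor) (a b c : Zd -> V) (S : seq Zd).

Lemma vnormE (v : V) : vnorm v = Num.sqrt (vn2 v).
Proof. by []. Qed.

Definition nrm2 xi : R := (\int[mu]_t vn2 (xi t))%R.
Definition csquare_spinor xi := forall k, csquare (fun t : T => xi t k 0).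

Lemma vn2_integrable xi : csquare_spinor xi -> rintegrable (fun t : T => vn2 (xi t)).
Proof. by move=> h; apply: rintegrable_sum => k; case: (h k). Qed.

Lemma nrm2_ge0 xi : 0 <= nrm2 xi.
Proof. by apply: Rintegral_ge0 => t _; exact: vn2_ge0. Qed.

Lemma L2norm_integral xi :
  L2norm xi = poweR (\int[mu]_t (vn2 (xi t))%:E)%E 2^-1.
Proof.
rewrite /L2norm unlock; congr (poweR _ _); apply: eq_integral => t _.
rewrite gee0_abs ?lee_fin ?sqrtr_ge0// poweR_EFin vnormE powR_mulrn ?sqrtr_ge0//.
by rewrite sqr_sqrtr// vn2_ge0.
Qed.

Lemma L2spinorP xi : L2spinor xi <-> csquare_spinor xi.
Proof.
split=> [[mxi L2xi] k|h].
- split; first exact: mxi.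
  have mv : measurable_fun setT (fun t : T => vn2 (xi t)).
    by apply: measurable_sum => j; apply: measurable_normc2; exact: mxi.
  have iv : rintegrable (fun t : T => vn2 (xi t)).
    apply/integrableP; split; first exact/measurable_EFinP.
    under eq_integral do rewrite /= ger0_norm ?vn2_ge0//.
    move: L2xi; rewrite L2norm_integral.
    have [->|] := eqVneq (\int[mu]_t (vn2 (xi t))%:E)%E +oo%E; last by rewrite -ltey.
    by rewrite poweRyr ?invr_eq0// ltxx.
  apply: rintegrable_le iv; first by apply: measurable_normc2; exact: mxi.
  move=> t; rewrite ger0_norm ?sqr_ge0// /vn2 (bigD1 k)//= lerDl.
  by apply: sumr_ge0 => j _; exact: sqr_ge0.
- split; first by move=> k; case: (h k) => [[]].
  rewrite L2norm_integral -(fineK (integrable_fin_num measurableT (vn2_integrable h))).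
  by rewrite poweR_EFin ltry.
Qed.

Lemma L2normE xi : csquare_spinor xi -> L2norm xi = (Num.sqrt (nrm2 xi))%:E.
Proof.
move=> h; rewrite L2norm_integral.
rewrite -(fineK (integrable_fin_num measurableT (vn2_integrable h))) -/(nrm2 xi).
by rewrite poweR_EFin powR12_sqrt// nrm2_ge0.
Qed.

Lemma L2norm_le xi (r : R) : csquare_spinor xi -> 0 <= r ->
  (L2norm xi <= r%:E)%E = (nrm2 xi <= r ^+ 2).
Proof.
move=> h r0; rewrite L2normE// lee_fin -(@ler_pXn2r _ 2) ?nnegrE ?sqrtr_ge0//.
by rewrite sqr_sqrtr ?nrm2_ge0.
Qed.

(** Trigonometric polynomials with spinor coefficients: the range of a spectral
    projection consists of those supported in a ball. *)
Definition trigsp S a : spinor := fun t => \sum_(n <- S) tchar n (row_of t) *: a n.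

Lemma trigspE S a t k : trigsp S a t k 0 = \sum_(n <- S) tchar n (row_of t) * a n k 0.
Proof. by rewrite /trigsp summxE; apply: eq_bigr => n _; rewrite mxE. Qed.

Lemma trigsp_tcont S a k : tcont (fun x => \sum_(n <- S) tchar n x * a n k 0).
Proof.
by apply: tcont_sum => n; apply: tcontM; [exact: tcont_tchar|exact: tcont_cst].
Qed.

Lemma trigsp_meas S a k : cmeas (fun t : T => trigsp S a t k 0).
Proof. by under eq_fun do rewrite trigspE; exact: tcont_meas (trigsp_tcont S a k). Qed.

Lemma trigsp_bounded S a k : cbounded (fun t : T => trigsp S a t k 0).
Proof. by under eq_fun do rewrite trigspE; exact: tcont_cbounded (trigsp_tcont S a k). Qed.

Lemma trigsp_csquare S a : csquare_spinor (trigsp S a).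
Proof. by move=> k; apply: csquare_bounded; [exact: trigsp_meas|exact: trigsp_bounded]. Qed.

Lemma mult_csquare f xi : tcont f -> csquare_spinor xi -> csquare_spinor (mult f xi).
Proof.
move=> tf h k; have -> : (fun t : T => mult f xi t k 0) = (fun t => f (row_of t) * xi t k 0).
  by apply/funext => t; rewrite /mult mxE.
by apply: csquare_bmul; [exact: tcont_meas|exact: tcont_cbounded|exact: h].
Qed.

Lemma fourierE xi n k : fourier xi n k 0 =
  cintegral (fun t : T => conjc (tchar n (row_of t)) * xi t k 0).
Proof. by rewrite mxE; apply: eq_cintegral => t; rewrite expi_tchar. Qed.

Lemma conj_tchar_bounded n : cbounded (fun t : T => conjc (tchar n (row_of t))).
Proof. by apply: cbounded_conj; exact: tcont_cbounded (tcont_tchar n). Qed.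
Lemma conj_tchar_meas n : cmeas (fun t : T => conjc (tchar n (row_of t))).
Proof. by apply: cmeas_conj; exact: tcont_meas (tcont_tchar n). Qed.

Lemma fourier_integrable (h : T -> C) n : cintegrable h ->
  cintegrable (fun t : T => conjc (tchar n (row_of t)) * h t).
Proof. by apply: cintegrableM; [exact: conj_tchar_meas|exact: conj_tchar_bounded]. Qed.

Lemma spinor_integrable xi k : csquare_spinor xi -> cintegrable (fun t : T => xi t k 0).
Proof. by move=> h; exact: csquare_integrable. Qed.

Lemma fourierD xi eta n : csquare_spinor xi -> csquare_spinor eta ->
  fourier (fun t => xi t + eta t) n = fourier xi n + fourier eta n.
Proof.
move=> hx he; apply/colP => k; rewrite [RHS]mxE !fourierE.
rewrite -cintegralD; try by apply: fourier_integrable; exact: spinor_integrable.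
by apply: eq_cintegral => t; rewrite mxE mulrDr.
Qed.

Lemma fourierZ (z : C) xi n : csquare_spinor xi ->
  fourier (fun t => z *: xi t) n = z *: fourier xi n.
Proof.
move=> hx; apply/colP => k; rewrite [RHS]mxE !fourierE.
rewrite -cintegralZ; last by apply: fourier_integrable; exact: spinor_integrable.
by apply: eq_cintegral => t; rewrite mxE mulrCA.
Qed.

Lemma csquare_spinorD xi eta : csquare_spinor xi -> csquare_spinor eta ->
  csquare_spinor (fun t => xi t + eta t).
Proof. by move=> hx he k; under eq_fun do rewrite mxE; exact: csquareD. Qed.

Lemma csquare_spinorZ (z : C) xi : csquare_spinor xi -> csquare_spinor (fun t => z *: xi t).
Proof. by move=> hx k; under eq_fun do rewrite mxE; exact: csquareZ. Qed.

Lemma csquare_spinor_sum I (s : seq I) (F : I -> spinor) : (forall i, csquare_spinor (F i)) ->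
  csquare_spinor (fun t => \sum_(i <- s) F i t).
Proof.
by move=> hF k; under eq_fun do rewrite summxE; apply: csquare_sum => i; exact: hF.
Qed.

Lemma fourier_sum I (s : seq I) (F : I -> spinor) n : (forall i, csquare_spinor (F i)) ->
  fourier (fun t => \sum_(i <- s) F i t) n = \sum_(i <- s) fourier (F i) n.
Proof.
move=> hF; apply/colP => k; rewrite fourierE summxE.
under [RHS]eq_bigr do rewrite fourierE.
rewrite -cintegral_sum => [|i]; last by apply: fourier_integrable; exact: spinor_integrable.
by apply: eq_cintegral => t; rewrite summxE mulr_sumr.
Qed.

Lemma csquare_spinor_mulmx (M : 'M[C]_(2 ^ d./2)) xi : csquare_spinor xi ->
  csquare_spinor (fun t => M *m xi t).
Proof.
move=> hx k; under eq_fun do rewrite mxE.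
by apply: csquare_sum => q; apply: csquareZ; exact: hx.
Qed.

Lemma fourier_mulmx (M : 'M[C]_(2 ^ d./2)) xi n : csquare_spinor xi ->
  fourier (fun t => M *m xi t) n = M *m fourier xi n.
Proof.
move=> hx; apply/colP => k; rewrite fourierE !mxE.
have iq q : cintegrable (fun t : T => conjc (tchar n (row_of t)) * xi t q 0).
  by apply: fourier_integrable; exact: spinor_integrable.
transitivity (cintegral (fun t : T => \sum_q M k q *
    (conjc (tchar n (row_of t)) * xi t q 0))).
  by apply: eq_cintegral => t; rewrite mxE mulr_sumr; apply: eq_bigr => q _; rewrite mulrCA.
rewrite cintegral_sum => [|q]; last exact: cintegrableZ.
by apply: eq_bigr => q _; rewrite cintegralZ// fourierE.
Qed.

Lemma fourier_mult_tchar (b : C) k xi n : csquare_spinor xi ->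
  fourier (mult (fun x => b * tchar k x) xi) n = b *: fourier xi (n - k).
Proof.
move=> hx; apply/colP => j; rewrite [RHS]mxE !fourierE -cintegralZ; last first.
  by apply: fourier_integrable; exact: spinor_integrable.
by apply: eq_cintegral => t; rewrite /mult mxE tchar_subl conjcM conjcK; ring.
Qed.

Lemma fourier_mult_trigsp f S a n : tcont f ->
  fourier (mult f (trigsp S a)) n = \sum_(m <- S) fhat f (n - m) *: a m.
Proof.
move=> tf; apply/colP => k; rewrite fourierE summxE.
have tm m : tcont (fun x => conjc (tchar (n - m) x) * f x) by exact: tcont_conjM.
transitivity (cintegral (fun t : T =>
   \sum_(m <- S) a m k 0 * (conjc (tchar (n - m) (row_of t)) * f (row_of t)))).
  apply: eq_cintegral => t; rewrite /mult mxE trigspE mulr_sumr mulr_sumr.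
  by apply: eq_bigr => m _; rewrite tchar_subl conjcM conjcK; ring.
rewrite cintegral_sum => [|m]; last by apply: cintegrableZ; exact: tcont_integrable (tm m).
apply: eq_bigr => m _; rewrite cintegralZ ?mxE; last exact: tcont_integrable (tm m).
exact: mulrC.
Qed.

Lemma fourier_trigsp S a n : uniq S -> fourier (trigsp S a) n = if n \in S then a n else 0.
Proof.
move=> uS; have -> : trigsp S a = mult (fun=> 1) (trigsp S a).
  by apply/funext => t; rewrite /mult scale1r.
rewrite (fourier_mult_trigsp _ _ _ (tcont_cst 1)).
have -> : (fun=> 1) = tchar (0 : Zd) :> (X -> C) by apply/funext => x; rewrite tchar_0l.
under eq_bigr do rewrite fhat_tchar eq_sym subr_eq0.
case: ifPn => nS.
  rewrite (bigD1_seq n)//= eqxx scale1r big1 ?addr0// => m mn.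
  by rewrite eq_sym (negbTE mn) scale0r.
rewrite big1_seq// => m /andP[_ mS]; case: eqVneq => [e|]; last by rewrite scale0r.
by rewrite e mS in nS.
Qed.

Definition ndot S a b : C := \sum_(n <- S) vdot (a n) (b n).
Definition nn2 S a : R := \sum_(n <- S) vn2 (a n).

Lemma nn2_ge0 S a : 0 <= nn2 S a.
Proof. by apply: sumr_ge0 => n _; exact: vn2_ge0. Qed.

Lemma ndotE S a : ndot S a a = (nn2 S a)%:C.
Proof. by rewrite /nn2 rmorph_sum; apply: eq_bigr => n _; rewrite vdotE. Qed.

Lemma inner_trigsp S a chi : csquare_spinor chi ->
  inner (trigsp S a) chi = \sum_(n <- S) vdot (a n) (fourier chi n).
Proof.
move=> hc.
have ik n k : cintegrable (fun t : T => conjc (a n k 0) *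
    (conjc (tchar n (row_of t)) * chi t k 0)).
  by apply: cintegrableZ; apply: fourier_integrable; exact: spinor_integrable.
transitivity (cintegral (fun t : T => \sum_(n <- S) \sum_k conjc (a n k 0) *
    (conjc (tchar n (row_of t)) * chi t k 0))).
  apply: eq_cintegral => t; rewrite exchange_big; apply: eq_bigr => k _.
  rewrite trigspE conjc_sum mulr_suml; apply: eq_bigr => n _.
  by rewrite conjcM; ring.
rewrite cintegral_sum => [|n]; last exact: cintegrable_sum.
apply: eq_bigr => n _; rewrite cintegral_sum//; apply: eq_bigr => k _.
rewrite cintegralZ ?fourierE//; apply: fourier_integrable; exact: spinor_integrable.
Qed.

Lemma inner_self xi : inner xi xi = (nrm2 xi)%:C.
Proof.
rewrite /inner; under eq_cintegral do rewrite -/(vdot _ _) vdotE.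
by rewrite cintegral_real.
Qed.

Lemma nrm2_trigsp S a : uniq S -> nrm2 (trigsp S a) = nn2 S a.
Proof.
move=> uS; apply: complexI; rewrite -inner_self inner_trigsp; last exact: trigsp_csquare.
rewrite -ndotE; rewrite /ndot !big_seq; apply: eq_bigr => n nS.
by rewrite fourier_trigsp// nS.
Qed.

(** The trigonometric polynomial with the same Fourier coefficients on [S] is the
    orthogonal projection, so the difference has squared norm
    [nrm2 chi - nn2 S (fourier chi)]. *)
Lemma bessel S chi : uniq S -> csquare_spinor chi ->
  nn2 S (fourier chi) <= nrm2 chi.
Proof.
move=> uS hc; pose a := fourier chi.
have ht := trigsp_csquare S a.
have hdiff : csquare_spinor (fun t => chi t + -1 *: trigsp S a t).
  by apply: csquare_spinorD => //; exact: csquare_spinorZ.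
have := nrm2_ge0 (fun t => chi t + -1 *: trigsp S a t).
have iin : rintegrable (fun t : T => complex.Re (vdot (trigsp S a t) (chi t))).
  have : cintegrable (fun t : T => vdot (trigsp S a t) (chi t)).
    apply: cintegrable_sum => k; apply: csquareM => //.
    by apply: csquare_bounded; [apply: cmeas_conj; exact: trigsp_meas|apply: cbounded_conj; exact: trigsp_bounded].
  by case.
have -> : nrm2 (fun t => chi t + -1 *: trigsp S a t) = nrm2 chi - nn2 S a; last by rewrite subr_ge0.
have ic := vn2_integrable hc; have it := vn2_integrable ht.
transitivity ((\int[mu]_t (vn2 (chi t) - 2 * complex.Re (vdot (trigsp S a t) (chi t)) + vn2 (trigsp S a t)))%R).
  by apply: eq_Rintegral => t _; rewrite scaleN1r vn2_sub.
have i2 := rintegrableZ 2 iin.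
rewrite (RintegralD measurableT (rintegrableB ic i2) it) (RintegralB measurableT ic i2).
rewrite (RintegralZl 2 measurableT iin) -Re_cintegral -/(inner (trigsp S a) chi).
rewrite inner_trigsp// -/(ndot S a a) ndotE /= -!/(nrm2 _) nrm2_trigsp//.
ring.
Qed.

(** All Fourier coefficients of the difference vanish, so it is zero almost
    everywhere. *)
Lemma nrm2_eq_fourier xi eta : csquare_spinor xi -> csquare_spinor eta ->
  (forall n, fourier xi n = fourier eta n) -> nrm2 xi = nrm2 eta.
Proof.
move=> hx he hf.
have hd : csquare_spinor (fun t => xi t + -1 *: eta t).
  by apply: csquare_spinorD => //; exact: csquare_spinorZ.
have z k : {ae mu, forall t : T, xi t k 0 - eta t k 0 = 0}.
  suff : {ae mu, forall t : T, (xi t + -1 *: eta t) k 0 = 0}.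
    by apply: filterS => t; rewrite !mxE mulN1r.
  apply: fourier_unique => [|n]; first exact: spinor_integrable k hd.
   have : fourier (fun t => xi t + -1 *: eta t) n k 0 = 0.
    rewrite fourierD//; last exact: csquare_spinorZ.
    by rewrite fourierZ// hf scaleN1r subrr mxE.
  by rewrite fourierE.
have zall : {ae mu, forall t : T, forall k, k \in enum 'I_(2 ^ d./2) -> xi t k 0 - eta t k 0 = 0}.
  elim: (enum _) => [|k s ih]; first exact: aeW.
  move: ih (z k); apply: filterS2 => t h1 h2 j.
  by rewrite inE => /predU1P[->//|]; exact: h1.
rewrite /nrm2 /Rintegral; congr fine; apply: ae_eq_integral => //.
- by have /measurable_int := vn2_integrable hx.
- by have /measurable_int := vn2_integrable he.
- move: zall; apply: filterS => t h _ /=; congr EFin; apply: eq_bigr => k _.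
  by have /eqP := h k (mem_enum _ _); rewrite subr_eq0 => /eqP ->.
Qed.

End Spinors.

(** * Spectral projections and Clifford multiplication *)

Section Ball.
Context {R : realType} {d : nat}.
Local Notation C := R[i].
Local Notation Zd := 'rV[int]_d.
Local Notation spinor := (@spinor R d).

Definition zball (L : R) : set Zd :=
  [set n | Num.sqrt (\sum_i ((n 0 i)%:~R : R) ^+ 2) <= L].

Lemma zball_coord L n i : zball L n -> `|(n 0 i)%:~R| <= L.
Proof.
move=> /=; apply: le_trans.
rewrite -(@ler_pXn2r _ 2)// ?nnegrE ?sqrtr_ge0// sqr_sqrtr; last first.
  by apply: sumr_ge0 => j _; exact: sqr_ge0.
rewrite real_normK ?num_real// (bigD1 i)//= lerDl.
by apply: sumr_ge0 => j _; exact: sqr_ge0.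
Qed.

Lemma zball_finite L : finite_set (zball L).
Proof.
pose K := Num.bound L.
have : finite_set [set (\row_i ((q i : nat)%:Z - K%:Z) : Zd) |
    q in [set: {ffun 'I_d -> 'I_(K + K).+1}]].
  by apply: finite_image; exact: finite_finset.
apply: sub_finite_set => n nL.
have nK i : (absz (n 0%R i) <= K)%N.
    have h := zball_coord i nL.
    have := le_lt_trans h (archi_boundP (le_trans (normr_ge0 _) h)).
    by rewrite -intr_norm -[(Num.bound L)%:R]/((K%:Z)%:~R) ltr_int -abszE ltz_nat => /ltnW.
have nn i : (absz (n 0%R i + K%:Z)%R < (K + K).+1)%N.
    have := nK i; rewrite ltnS -!lez_nat !abszE PoszD => h.
    by rewrite (le_trans (ler_normD _ _))// lerD.
exists [ffun i => Ordinal (nn i)] => //; apply/rowP => i; rewrite !mxE ffunE /=.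
rewrite gez0_abs ?addrK//; have := nK i; rewrite -lez_nat abszE ler_norml => /andP[h _].
by rewrite -lerBlDr sub0r.
Qed.

(** An enumeration, so that the projection becomes an ordinary finite sum. *)
Definition ball_seq (L : R) : seq Zd := finmap.enum_fset (fset_set (zball L)).

Lemma ball_seq_uniq L : uniq (ball_seq L).
Proof. exact: finmap.fset_uniq. Qed.

Lemma mem_ball_seq L n : (n \in ball_seq L) = (n \in zball L).
Proof. exact: (in_fset_set (zball_finite L)). Qed.

Lemma projE L (xi : spinor) : proj L xi = trigsp (ball_seq L) (fourier xi).
Proof.
apply/funext => t; rewrite /proj /trigsp -/(zball L) fsbig_finite; last exact: zball_finite.
by apply: eq_bigr => n _; rewrite expi_tchar.
Qed.

Lemma eq_trigsp (S : seq Zd) a b : {in S, a =1 b} -> trigsp S a = trigsp S b :> spinor.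
Proof.
by move=> ab; apply/funext => t; rewrite /trigsp !big_seq; apply: eq_bigr => n nS; rewrite ab.
Qed.

Lemma proj_trigsp L a : proj L (trigsp (ball_seq L) a) = trigsp (ball_seq L) a.
Proof.
by rewrite projE; apply: eq_trigsp => n nB; rewrite fourier_trigsp ?ball_seq_uniq// nB.
Qed.

Lemma proj_rangeP L xi : proj_range L xi <-> exists a, xi = trigsp (ball_seq L) a.
Proof.
split=> [[eta _ <-]|[a ->]]; first by exists (fourier eta); rewrite projE.
by exists (trigsp (ball_seq L) a); [apply/L2spinorP; exact: trigsp_csquare|exact: proj_trigsp].
Qed.

Section Box.
Variable m : nat.
Local Notation I := {ffun 'I_d -> 'I_m.+1}.

(** The Euclidean norm is at most the sum of the coordinates. *)
Lemma box_ball_seq L (p : I) : (d * m)%:R <= L -> box p \in ball_seq L.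
Proof.
move=> dmL; rewrite mem_ball_seq; apply/mem_set => /=; apply: le_trans dmL.
have S0 : 0 <= \sum_i (p i)%:R :> R by apply: sumr_ge0.
rewrite -(@ler_pXn2r _ 2)// ?nnegrE ?sqrtr_ge0// sqr_sqrtr; last first.
  by apply: sumr_ge0 => j _; exact: sqr_ge0.
apply: (@le_trans _ _ ((\sum_i (p i)%:R) ^+ 2)).
  rewrite expr2 mulr_suml; apply: ler_sum => i _; rewrite mxE expr2.
  by rewrite ler_wpM2l// (bigD1 i)//= lerDl; apply: sumr_ge0.
rewrite ler_pXn2r// ?nnegrE//.
apply: (@le_trans _ _ (\sum_(i < d) m%:R)).
  by apply: ler_sum => i _; rewrite ler_nat -ltnS.
by rewrite sumr_const card_ord natrM mulr_natl.
Qed.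

Lemma sum_box (A : nmodType) (S : seq Zd) (G : Zd -> A) : uniq S ->
  (forall p : I, box p \in S) ->
  \sum_(n <- S) (if n \in codom (@box d m) then G n else 0) = \sum_(p : I) G (box p).
Proof.
move=> uS bS; rewrite -big_mkcond -big_filter -[RHS](big_map (@box d m) xpredT G).
apply: perm_big; apply: uniq_perm.
- by rewrite filter_uniq.
- by rewrite map_inj_uniq ?index_enum_uniq//; exact: box_inj.
move=> n; rewrite mem_filter; apply/andP/mapP.
  by move=> [/codomP[p ->] _]; exists p; rewrite ?mem_index_enum.
by move=> [p _ ->]; split; [exact: codom_f|exact: bS].
Qed.

End Box.
End Ball.

Section CliffordMultiplication.
Context {R : realType} {d : nat}.
Local Notation C := R[i].
Local Notation Zd := 'rV[int]_d.
Local Notation V := 'cV[C]_(2 ^ d./2).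
Variable gam : 'I_d -> 'M[C]_(2 ^ d./2).

(** The symbol of the Dirac operator. *)
Definition cliff (k : Zd) : 'M[C]_(2 ^ d./2) := \sum_m (k 0 m)%:~R *: gam m.

Lemma cliffB n m : cliff (n - m) = cliff n - cliff m.
Proof.
rewrite /cliff -sumrB; apply: eq_bigr => i _; rewrite !mxE intrD mulrNz.
by rewrite scalerDl scaleNr.
Qed.

Lemma cliffE (k : Zd) (v : V) : \sum_m (k 0 m)%:~R *: (gam m *m v) = cliff k *m v.
Proof. by rewrite /cliff mulmx_suml; apply: eq_bigr => i _; rewrite scalemxAl. Qed.

Hypothesis gam_clifford : clifford gam.

Lemma gam_selfadjoint i : selfadjoint (gam i).
Proof. by case: gam_clifford => h _; exact: h. Qed.

Lemma gam_sqr i : gam i *m gam i = 1%:M.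
Proof.
case: gam_clifford => _ /(_ i i); rewrite eqxx mulr1 -mulr2n -scaler_nat => h.
have := congr1 (fun M => 2^-1 *: M) h.
by rewrite scalerA mulVf ?pnatr_eq0// scale1r scale_scalar_mx mulVf ?pnatr_eq0.
Qed.

Lemma vn2_gam i (v : V) : vn2 (gam i *m v) = vn2 v.
Proof.
apply: complexI; rewrite -!vdotE vdot_selfadjoint; last exact: gam_selfadjoint.
by rewrite mulmxA gam_sqr mul1mx.
Qed.

Lemma gam_cliff i (k : Zd) : gam i *m cliff k + cliff k *m gam i = (2 * (k 0 i)%:~R)%:M.
Proof.
rewrite /cliff mulmx_sumr mulmx_suml -big_split /=.
rewrite (eq_bigr (fun m => ((k 0 m)%:~R * (2 * (i == m)%:R))%:M)); last first.
  move=> m _; rewrite -scalemxAl -scalemxAr -scalerDr.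
  by case: gam_clifford => _ ->; rewrite scale_scalar_mx.
rewrite (bigD1 i)//= big1 ?addr0; first by rewrite eqxx mulr1 mulrC.
by move=> m /negbTE mi; rewrite eq_sym mi !mulr0 raddf0.
Qed.

(** The Clifford relations recover the single coordinate [k_i] from Clifford
    multiplication by [k]; on matrix coefficients of commutators with the Dirac
    operator this isolates one partial derivative. *)
Lemma vdot_coord i (k : Zd) (u v : V) : 2 * (k 0 i)%:~R * vdot u v =
  vdot (gam i *m u) (cliff k *m v) + vdot u (cliff k *m (gam i *m v)).
Proof.
rewrite vdot_selfadjoint; last exact: gam_selfadjoint.
by rewrite -vdotDr !mulmxA -mulmxDl gam_cliff mul_scalar_mx vdotZr.
Qed.

End CliffordMultiplication.

(** * Commutators with the Dirac operator *)

Section DiracCommutators.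
Context {R : realType} {d : nat}.
Local Notation C := R[i].
Local Notation X := 'rV[R]_d.
Local Notation Zd := 'rV[int]_d.
Local Notation T := (d.-tuple (measurableTypeR R)).
Local Notation V := 'cV[C]_(2 ^ d./2).
Local Notation spinor := (@spinor R d).
Variable gam : 'I_d -> 'M[C]_(2 ^ d./2).
Local Notation cliff := (cliff gam).

Lemma dirac_graphP (xi eta : spinor) : dirac_graph gam (xi, eta) <->
  [/\ csquare_spinor xi, csquare_spinor eta & forall n, fourier eta n = cliff n *m fourier xi n].
Proof.
split=> [[/= /L2spinorP h1 /L2spinorP h2 h3]|[h1 h2 h3]]; split => //=.
- by move=> n; rewrite h3 cliffE.
- exact/L2spinorP.
- exact/L2spinorP.
- by move=> n; rewrite cliffE.
Qed.

Lemma dirac_trigsp S (a : Zd -> V) : uniq S ->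
  dirac_graph gam (trigsp S a, trigsp S (fun n => cliff n *m a n)).
Proof.
move=> uS; apply/dirac_graphP; split; try exact: trigsp_csquare.
by move=> n; rewrite !fourier_trigsp//; case: ifP; rewrite ?mulmx0.
Qed.

Lemma trigspB S (a b : Zd -> V) : trigsp S a - trigsp S b = trigsp S (fun n => a n - b n) :> spinor.
Proof.
apply/funext => t; rewrite /trigsp fctE -sumrB; apply: eq_bigr => n _.
by rewrite scalerBr.
Qed.

Section Truncated.
Variable L : R.
Local Notation B := (@ball_seq R d L).

Definition trunc (f : X -> C) : spinor -> spinor := proj L \o mult f \o proj L.

Lemma truncE f xi : tcont f ->
  trunc f xi = trigsp B (fun n => \sum_(m <- B) fhat f (n - m) *: fourier xi m).
Proof.
move=> tf; rewrite /trunc /= !projE; apply: eq_trigsp => n _.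
exact: fourier_mult_trigsp.
Qed.

Lemma trunc_trigsp f a : tcont f ->
  trunc f (trigsp B a) = trigsp B (fun n => \sum_(m <- B) fhat f (n - m) *: a m).
Proof.
move=> tf; rewrite truncE//; apply: eq_trigsp => n _.
by rewrite !big_seq; apply: eq_bigr => m mB; rewrite fourier_trigsp ?ball_seq_uniq// mB.
Qed.

Lemma truncated_dirac_trigsp a eta : truncated_dirac gam L (trigsp B a, eta) <->
  eta = trigsp B (fun n => cliff n *m a n).
Proof.
split=> [[/= _ [zeta]]|->].
  rewrite proj_trigsp => /dirac_graphP[_ _ h] ->; rewrite projE; apply: eq_trigsp => n nB.
  by rewrite h fourier_trigsp ?ball_seq_uniq// nB.
split=> /=; first by apply/proj_rangeP; exists a.
exists (trigsp B (fun n => cliff n *m a n)); last by rewrite proj_trigsp.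
by rewrite proj_trigsp; exact: dirac_trigsp (ball_seq_uniq L).
Qed.

(** The Fourier coefficients of the truncated commutator with [f], applied to the
    trigonometric polynomial with coefficients [a]. *)
Definition comm_coef (f : X -> C) (a : Zd -> V) (n : Zd) : V :=
  \sum_(m <- B) fhat f (n - m) *: (cliff (n - m) *m a m).

Lemma comm_coefE f a n : comm_coef f a n =
  cliff n *m (\sum_(m <- B) fhat f (n - m) *: a m) -
  \sum_(m <- B) fhat f (n - m) *: (cliff m *m a m).
Proof.
rewrite mulmx_sumr -sumrB; apply: eq_bigr => m _.
by rewrite cliffB mulmxBl scalerBr scalemxAr.
Qed.

Lemma trunc_commutatorP f p : tcont f ->
  commutator (truncated_dirac gam L) (trunc f) p <->
  exists a, p = (trigsp B a, trigsp B (comm_coef f a)).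
Proof.
move=> tf; have E a : trigsp B (fun n => cliff n *m \sum_(m <- B) fhat f (n - m) *: a m) -
    trunc f (trigsp B (fun n => cliff n *m a n)) = trigsp B (comm_coef f a).
  by rewrite trunc_trigsp// trigspB; apply: eq_trigsp => n _; rewrite comm_coefE.
case: p => xi chi; split=> [[eta [zeta /= [h1 h2 ->]]]|[a [-> ->]]].
  have /proj_rangeP[a xiE] : proj_range L xi by case: h1.
  exists a; rewrite xiE in h1 h2 *.
  move: h2; rewrite trunc_trigsp// => /truncated_dirac_trigsp ->.
  by move: h1 => /truncated_dirac_trigsp ->; rewrite E.
exists (trigsp B (fun n => cliff n *m a n)),
  (trigsp B (fun n => cliff n *m \sum_(m <- B) fhat f (n - m) *: a m)); split => /=.
- exact/truncated_dirac_trigsp.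
- by rewrite trunc_trigsp//; exact/truncated_dirac_trigsp.
- by rewrite E.
Qed.

(** The Lipschitz seminorm of a truncated operator. *)
Definition tlip (T : spinor -> spinor) : \bar R := opnorm (commutator (truncated_dirac gam L) T).

Lemma comm_coefZ f (r : C) a n : comm_coef f (fun m => r *: a m) n = r *: comm_coef f a n.
Proof.
rewrite /comm_coef scaler_sumr; apply: eq_bigr => m _.
by rewrite -scalemxAr !scalerA mulrC.
Qed.

Lemma nn2Z S (r : C) (a : Zd -> V) : nn2 S (fun n => r *: a n) = normc r ^+ 2 * nn2 S a.
Proof. by rewrite /nn2 mulr_sumr; apply: eq_bigr => n _; rewrite vn2Z. Qed.

Lemma nn2_eq0 S (a : Zd -> V) : nn2 S a = 0 -> {in S, forall n, a n = 0}.
Proof.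
move=> /eqP; rewrite psumr_eq0 => [/allP h n nS|n _]; last exact: vn2_ge0.
have := h n nS => /=; rewrite psumr_eq0 => [/allP h' |k _]; last exact: sqr_ge0.
apply/colP => k; rewrite mxE; have := h' k; rewrite mem_index_enum => /(_ isT).
by rewrite sqrf_eq0 => /eqP/eq0_normc.
Qed.

Lemma tlip_leP f (l : R) : tcont f -> 0 <= l ->
  (tlip (trunc f) <= l%:E)%E <-> (forall a, nn2 B (comm_coef f a) <= l ^+ 2 * nn2 B a).
Proof.
move=> tf l0; split=> h.
- have h1 a : nn2 B a <= 1 -> nn2 B (comm_coef f a) <= l ^+ 2.
    move=> a1; rewrite -nrm2_trigsp ?ball_seq_uniq// -L2norm_le//; last exact: trigsp_csquare.
    apply: le_trans h; apply: ereal_sup_ubound.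
    exists (trigsp B a, trigsp B (comm_coef f a)) => //; split; first by apply/trunc_commutatorP => //; exists a.
    by rewrite L2norm_le ?expr1n ?nrm2_trigsp ?ball_seq_uniq//; exact: trigsp_csquare.
  move=> a; have [a0|a0] := eqVneq (nn2 B a) 0.
    rewrite a0 mulr0 /nn2 big1// => n _; rewrite /comm_coef big1_seq.
      by rewrite /vn2 big1// => k _; rewrite mxE normc0 expr0n.
    by move=> m /andP[_ mB]; rewrite (nn2_eq0 a0)// mulmx0 scaler0.
  have ap : 0 < nn2 B a by rewrite lt_def a0 nn2_ge0.
  have sp : 0 < Num.sqrt (nn2 B a) by rewrite sqrtr_gt0.
  set r : R := (Num.sqrt (nn2 B a))^-1.
  have r2 : r ^+ 2 = (nn2 B a)^-1 by rewrite exprVn sqr_sqrtr ?(ltW ap).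
  have nr : normc r%:C ^+ 2 = (nn2 B a)^-1 by rewrite normc_real real_normK ?num_real.
  have := h1 (fun n => r%:C *: a n); rewrite nn2Z nr mulVf// lexx => /(_ isT).
  have -> : nn2 B (comm_coef f (fun n => r%:C *: a n)) = nn2 B (fun n => r%:C *: comm_coef f a n).
    by apply: eq_bigr => n _; rewrite comm_coefZ.
  by rewrite nn2Z nr mulrC ler_pdivrMr.
- apply: ge_ereal_sup => _ [p [/trunc_commutatorP-/(_ tf)[a ->] /=] + <-].
  have B1 := @ball_seq_uniq R d L.
  rewrite L2norm_le ?expr1n ?nrm2_trigsp//; last exact: trigsp_csquare.
  move=> a1; rewrite L2norm_le//; last exact: trigsp_csquare.
  by rewrite nrm2_trigsp// (le_trans (h a))// ler_piMr// sqr_ge0.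
Qed.

(** A finite sum of finite matrices. *)
Lemma comm_coef_bounded f : exists2 c, 0 <= c &
  forall a, nn2 B (comm_coef f a) <= c * nn2 B a.
Proof.
have /choice[c cP] k : exists c, 0 <= c /\ forall v : V, vn2 (cliff k *m v) <= c * vn2 v.
  by have [c c0 h] := vn2_mulmx (cliff k); exists c.
pose D n m := (size B)%:R * (normc (fhat f (n - m)) ^+ 2 * c (n - m)).
have D0 n m : 0 <= D n m.
  by rewrite mulr_ge0// mulr_ge0 ?sqr_ge0//; case: (cP (n - m)).
exists (\sum_(n <- B) \sum_(m <- B) D n m).
  by apply: sumr_ge0 => n _; apply: sumr_ge0 => m _.
move=> a; rewrite mulr_suml; apply: ler_sum => n _.
rewrite (le_trans (vn2_sum _ _))// mulr_sumr mulr_suml !big_seq; apply: ler_sum => m mB.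
rewrite vn2Z /D -[_ * nn2 B a]mulrA -[_ * c _ * _]mulrA; apply: ler_wpM2l => //; apply: ler_wpM2l; first exact: sqr_ge0.
case: (cP (n - m)) => c0 h; rewrite (le_trans (h _))// ler_wpM2l//.
rewrite /nn2 (big_rem m)//= lerDl; apply: sumr_ge0 => k _; exact: vn2_ge0.
Qed.

Lemma tlip_fin f : tcont f -> (tlip (trunc f) < +oo)%E.
Proof.
move=> tf; have [c c0 h] := comm_coef_bounded f.
apply: (@le_lt_trans _ _ (Num.sqrt c)%:E); last exact: ltry.
by apply/tlip_leP; rewrite ?sqrtr_ge0// => a; rewrite sqr_sqrtr.
Qed.

End Truncated.

Section Full.

(** The Lipschitz seminorm of a function. *)
Definition dlip (f : X -> C) : \bar R := opnorm (commutator (dirac_graph gam) (mult f)).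

Lemma dlip_leP f (l : R) : tcont f -> 0 <= l ->
  (dlip f <= l%:E)%E <-> (forall xi eta zeta, dirac_graph gam (xi, eta) ->
     dirac_graph gam (mult f xi, zeta) -> nrm2 xi <= 1 ->
     nrm2 (fun t => zeta t - mult f eta t) <= l ^+ 2).
Proof.
move=> tf l0.
have hd eta zeta : csquare_spinor eta -> csquare_spinor zeta ->
    csquare_spinor (fun t => zeta t - mult f eta t).
  move=> he hz; rewrite (_ : (fun t => _) = (fun t => zeta t + -1 *: mult f eta t)).
    apply: csquare_spinorD => //; apply: csquare_spinorZ; exact: mult_csquare.
  by apply/funext => t; rewrite scaleN1r.
split=> [h xi eta zeta g1 g2 x1|h].
  have [hx he _] := (dirac_graphP _ _).1 g1; have [_ hz _] := (dirac_graphP _ _).1 g2.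
  rewrite -L2norm_le//; last exact: hd.
  apply: le_trans h; apply: ereal_sup_ubound.
  exists (xi, zeta - mult f eta) => //; split; first by exists eta, zeta.
  by rewrite L2norm_le ?expr1n.
apply: ge_ereal_sup => _ [[xi chi] [[eta [zeta /= [g1 g2 ->]]]] + <-].
have [hx he _] := (dirac_graphP _ _).1 g1; have [_ hz _] := (dirac_graphP _ _).1 g2.
rewrite L2norm_le ?expr1n// => x1; rewrite L2norm_le//; last exact: hd.
exact: (h xi eta zeta g1 g2 x1).
Qed.

(** The commutator with a trigonometric polynomial is Clifford multiplication by
    its differential.  For a spinor field in the domain this is seen by comparing
    Fourier coefficients, where only finitely many shifts occur, and completeness
    turns it into an equality of norms. *)
Lemma dlip_trig I (s : seq I) (b : I -> C) (k : I -> Zd) (l : R) : 0 <= l ->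
  (forall x (v : V), vn2 (\sum_(i <- s) (b i * tchar (k i) x) *: (cliff (k i) *m v)) <=
     l ^+ 2 * vn2 v) ->
  (dlip (fun x => (\sum_(i <- s) b i * tchar (k i) x)%R) <= l%:E)%E.
Proof.
set g := fun x => _ => l0 h.
have tg : tcont g by apply: tcont_sum => i; apply: tcontZ; exact: tcont_tchar.
apply/dlip_leP => // xi eta zeta /dirac_graphP[hx he fe] /dirac_graphP[hg hz fz] x1.
pose term i : X -> C := fun x => b i * tchar (k i) x.
have tt i : tcont (term i) by apply: tcontZ; exact: tcont_tchar.
pose omega : spinor := fun t => \sum_(i <- s) mult (term i) (fun t => cliff (k i) *m xi t) t.
have hterm i : csquare_spinor (mult (term i) (fun t => cliff (k i) *m xi t)).
  by apply: mult_csquare => //; exact: csquare_spinor_mulmx.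
have fmult (chi : spinor) n : csquare_spinor chi ->
    fourier (mult g chi) n = \sum_(i <- s) b i *: fourier chi (n - k i).
  move=> hc; rewrite (_ : mult g chi = (fun t => \sum_(i <- s) mult (term i) chi t)).
    rewrite fourier_sum => [|i]; last exact: mult_csquare.
    by apply: eq_bigr => i _; exact: fourier_mult_tchar.
  by apply/funext => t; rewrite /mult /g scaler_suml.
have hmg : csquare_spinor (mult g eta) by exact: mult_csquare.
have hom : csquare_spinor omega by exact: csquare_spinor_sum.
have hdiff : csquare_spinor (fun t => zeta t + -1 *: mult g eta t).
  by apply: csquare_spinorD => //; exact: csquare_spinorZ.
rewrite (_ : (fun t => zeta t - mult g eta t) = (fun t => zeta t + -1 *: mult g eta t)); last first.
  by apply/funext => t; rewrite scaleN1r.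
rewrite (nrm2_eq_fourier hdiff hom).
  apply: (@le_trans _ _ (l ^+ 2 * nrm2 xi)); last by rewrite ler_piMr ?sqr_ge0.
  rewrite -(RintegralZl (l ^+ 2) measurableT (vn2_integrable hx)).
  apply: (le_Rintegral measurableT (vn2_integrable hom)); last by move=> t _; exact: h.
  by apply: rintegrableZ; exact: vn2_integrable.
move=> n; rewrite fourierD//; last exact: csquare_spinorZ.
rewrite fourierZ// scaleN1r fz !fmult// /omega fourier_sum//.
rewrite mulmx_sumr -sumrB; apply: eq_bigr => i _.
rewrite fourier_mult_tchar ?fourier_mulmx// ?fe; last exact: csquare_spinor_mulmx.
rewrite -scalemxAr -scalerBr -mulmxBl -cliffB; congr (_ *: (cliff _ *m _)).
by rewrite opprB addrC subrK.
Qed.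

(** On a trigonometric polynomial the full commutator is Clifford multiplication
    by the differential of [f], and the truncated commutator is its projection,
    so Bessel's inequality suffices. *)
Lemma tlip_le_dlip L f (g : 'I_d -> X -> C) (l : R) : 0 <= l -> tcont f ->
  (forall i, tcont (g i)) -> (forall i x, cderive x 'e_i f (g i x)) ->
  (dlip f <= l%:E)%E -> (tlip L (trunc L f) <= l%:E)%E.
Proof.
move=> l0 tf tg fg /(dlip_leP tf l0) h; have B1 := @ball_seq_uniq R d L.
apply: ge_ereal_sup => _ [p [/trunc_commutatorP-/(_ tf)[a ->] /=] + <-].
rewrite L2norm_le ?expr1n//; last exact: trigsp_csquare.
move=> a1; rewrite L2norm_le//; last exact: trigsp_csquare.
set B := @ball_seq R d L in B1 *.
pose xi : spinor := trigsp B a; pose eta : spinor := trigsp B (fun n => cliff n *m a n).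
(* [omega] is [[D, f] xi]: each partial derivative enters with the factor [-i] of
   the Dirac operator *)
pose part i : spinor := fun t => - 'i *: (gam i *m mult (g i) xi t).
pose omega : spinor := fun t => \sum_i part i t.
have hx : csquare_spinor xi by exact: trigsp_csquare.
have hmx i : csquare_spinor (mult (g i) xi) by exact: mult_csquare.
have hpart i : csquare_spinor (part i).
  by apply: csquare_spinorZ; exact: csquare_spinor_mulmx.
have hom : csquare_spinor omega by exact: csquare_spinor_sum.
have fom n : fourier omega n = \sum_(m <- B) fhat f (n - m) *: (cliff (n - m) *m a m).
  transitivity (\sum_i - 'i *: (gam i *m \sum_(m <- B) fhat (g i) (n - m) *: a m)).
    rewrite /omega fourier_sum//; apply: eq_bigr => i _.
    rewrite fourierZ; last exact: csquare_spinor_mulmx.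
    by rewrite fourier_mulmx// fourier_mult_trigsp.
  under eq_bigr do rewrite mulmx_sumr scaler_sumr.
  rewrite exchange_big; apply: eq_bigr => m _.
  rewrite -cliffE scaler_sumr; apply: eq_bigr => i _.
  rewrite (fhat_deriv _ tf (tg i) (fg i)) -scalemxAr !scalerA.
  congr (_ *: _); rewrite mulrA [RHS]mulrC; congr (_ * _).
  by apply: complexP; rewrite reimE -[(_ *~ _ : C)]/(_%:~R) -(rmorph_int (real_complex R)) /=; ring.
have hfe : csquare_spinor (mult f eta) by apply: mult_csquare => //; exact: trigsp_csquare.
have := h xi eta (fun t => omega t + mult f eta t) (dirac_trigsp a B1) _ a1.
rewrite (_ : (fun t => omega t + mult f eta t - mult f eta t) = omega); last first.
  by apply/funext => t; rewrite addrK.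
move=> h'; rewrite nrm2_trigsp//; apply: le_trans (h' _).
  rewrite (_ : nn2 B _ = nn2 B (fourier omega)); first exact: bessel.
  by apply: eq_bigr => n _; rewrite fom.
apply/dirac_graphP; split; [exact: mult_csquare|exact: csquare_spinorD|].
move=> n; rewrite fourierD// fom !fourier_mult_trigsp// mulmx_sumr -big_split /=.
by apply: eq_bigr => m _; rewrite -scalemxAr -scalerDr -mulmxDl cliffB subrK.
Qed.

End Full.
End DiracCommutators.

(** * Lipschitz estimates for compressions *)

Section FejerLinear.
Context {R : realType} {d : nat}.
Local Notation C := R[i].
Local Notation X := 'rV[R]_d.
Variable m : nat.

Lemma fejerZ (c : C) (f : X -> C) x : tcont f -> fejer m (fun x => c * f x) x = c * fejer m f x.
Proof.
move=> tf; rewrite /fejer mulrCA; congr (_ * _); rewrite mulr_sumr.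
apply: eq_bigr => p _; rewrite mulr_sumr; apply: eq_bigr => q _.
by rewrite fhatZ// mulrA.
Qed.

Lemma fejerD (f g : X -> C) x : tcont f -> tcont g ->
  fejer m (fun x => f x + g x) x = fejer m f x + fejer m g x.
Proof.
move=> tf tg; rewrite /fejer -mulrDr; congr (_ * _); rewrite -big_split.
apply: eq_bigr => p _; rewrite -big_split; apply: eq_bigr => q _.
by rewrite fhatD// mulrDl.
Qed.

Lemma fejer_sum I (s : seq I) (F : I -> X -> C) x : (forall i, tcont (F i)) ->
  fejer m (fun x => \sum_(i <- s) F i x) x = \sum_(i <- s) fejer m (F i) x.
Proof.
move=> tF; rewrite -fejerE; last exact: tcont_sum.
under [RHS]eq_bigr do rewrite -fejerE//.
rewrite -cintegral_sum => [|i]; first by apply: eq_cintegral => t; rewrite mulr_sumr.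
exact: tcont_integrable (tcontM (fejer_kernel_tcont m x) (tF i)).
Qed.

End FejerLinear.

(** Lipschitz continuity for the sum of the coordinate distances.  It is stated
    for real and imaginary parts, to which the mean value theorem applies. *)
Definition lipschitz (R : realType) (d : nat) (l : R) (f : 'rV[R]_d -> R[i]) : Prop :=
  forall x z, `|complex.Re (f (x + z)) - complex.Re (f x)| <= l * \sum_i `|z 0 i| /\
              `|complex.Im (f (x + z)) - complex.Im (f x)| <= l * \sum_i `|z 0 i|.

Lemma mvt_le (R : realType) (u u' : R -> R) (c : R) :
  (forall s, is_derive (s : R^o) (1 : R^o) (u : R^o -> R^o) (u' s)) ->
  (forall s, `|u' s| <= c) -> `|u 1 - u 0| <= c.
Proof.
move=> du u'c; have cu : {within `[0, 1], continuous u}.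
  apply: continuous_subspaceT => s; apply: differentiable_continuous.
  by apply/derivable1_diffP; case: (du s).
have [s _ ->] := @MVT R u u' 0 1 ltr01 (fun s _ => du s) cu.
by rewrite subr0 mulr1.
Qed.

Section LipschitzForms.
Context {R : realType} {d : nat}.
Local Notation C := R[i].
Local Notation X := 'rV[R]_d.
Local Notation Zd := 'rV[int]_d.
Local Notation V := 'cV[C]_(2 ^ d./2).
Variable gam : 'I_d -> 'M[C]_(2 ^ d./2).
Hypothesis gam_clifford : clifford gam.
Variable L : R.
Local Notation cliff := (cliff gam).
Local Notation B := (@ball_seq R d L).

(** The quadratic form of the compression of [f], evaluated at the translate by
    [x] of the vector with Fourier coefficients [a]. *)
Definition qform (f : X -> C) (a : Zd -> V) (x : X) : C :=
  \sum_(n <- B) \sum_(m <- B) (fhat f (n - m) * vdot (a n) (a m)) * tchar (n - m) x.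

Lemma qform_tcont f a : tcont (qform f a).
Proof.
apply: tcont_sum => n; apply: tcont_sum => m; apply: tcontZ; exact: tcont_tchar.
Qed.

Lemma qform0E f a : tcont f -> qform f a 0 = inner (trigsp B a) (mult f (trigsp B a)).
Proof.
move=> tf; rewrite inner_trigsp; last by apply: mult_csquare => //; exact: trigsp_csquare.
apply: eq_bigr => n _; rewrite fourier_mult_trigsp// vdot_sumr; apply: eq_bigr => m _.
by rewrite tchar_0r mulr1 vdotZr.
Qed.

Lemma qform0_trunc f a : tcont f -> qform f a 0 = inner (trigsp B a) (trunc L f (trigsp B a)).
Proof.
move=> tf; rewrite trunc_trigsp// inner_trigsp; last exact: trigsp_csquare.
rewrite /qform !big_seq; apply: eq_bigr => n nB.
rewrite fourier_trigsp ?ball_seq_uniq// nB vdot_sumr; apply: eq_bigr => m _.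
by rewrite tchar_0r mulr1 vdotZr.
Qed.

Lemma qform_real (u : X -> R) a : tcont (fun x => (u x)%:C) ->
  qform (fun x => (u x)%:C) a 0 =
  ((\int[@torus_measure R d]_t (u (row_of t) * vn2 (trigsp B a t)))%R)%:C.
Proof.
move=> tu; rewrite qform0E// -cintegral_real; apply: eq_cintegral => t.
rewrite real_complexM -vdotE /vdot mulr_sumr; apply: eq_bigr => k _.
by rewrite /mult mxE mulrCA.
Qed.

Lemma nn2_twist (a : Zd -> V) x : nn2 B (fun n => conjc (tchar n x) *: a n) = nn2 B a.
Proof.
by apply: eq_bigr => n _; rewrite vn2Z normc_conj normc_tchar expr1n mul1r.
Qed.

Lemma qform_fejer f a m x : tcont f -> fejer m (qform f a) x = qform (fejer m f) a x.
Proof.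
move=> tf; rewrite fejer_sum => [|n]; last first.
  by apply: tcont_sum => k; apply: tcontZ; exact: tcont_tchar.
apply: eq_bigr => n _; rewrite fejer_sum => [|k]; last by apply: tcontZ; exact: tcont_tchar.
apply: eq_bigr => k _; rewrite fejerZ; last exact: tcont_tchar.
by rewrite fejer_tchar fhat_fejer; ring.
Qed.

Section Bound.
Variables (f : X -> C) (l : R).
Hypotheses (l0 : 0 <= l).
Hypothesis fl : forall a, nn2 B (comm_coef gam L f a) <= l ^+ 2 * nn2 B a.

Lemma ndot_comm_le (a b : Zd -> V) : nn2 B b = nn2 B a ->
  normc (ndot B b (comm_coef gam L f a)) <= l * nn2 B a.
Proof.
move=> ba; have A0 := nn2_ge0 B a.
rewrite -(@ler_pXn2r _ 2)// ?nnegrE ?normc_ge0 ?mulr_ge0//.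
apply: le_trans (cauchy_schwarz _ _ _) _; rewrite -/(nn2 B b) ba.
have -> : (l * nn2 B a) ^+ 2 = nn2 B a * (l ^+ 2 * nn2 B a) by ring.
by apply: ler_wpM2l => //; exact: fl.
Qed.

Lemma ndot_commE (a b : Zd -> V) : ndot B b (comm_coef gam L f a) =
  \sum_(n <- B) \sum_(m <- B) fhat f (n - m) * vdot (b n) (cliff (n - m) *m a m).
Proof.
by apply: eq_bigr => n _; rewrite vdot_sumr; apply: eq_bigr => m _; rewrite vdotZr.
Qed.

(** By [vdot_coord], twice this sum is the sum of two matrix coefficients of the
    truncated commutator, and Clifford generators act isometrically. *)
Lemma qform_coord_le i a : normc (\sum_(n <- B) \sum_(m <- B)
   (fhat f (n - m) * vdot (a n) (a m)) * (((n - m) 0 i)%:~R : C)) <= l * nn2 B a.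
Proof.
set S := \sum_(n <- B) _.
have ga : nn2 B (fun n => gam i *m a n) = nn2 B a.
  by apply: eq_bigr => n _; rewrite vn2_gam.
have E : 2 * S = ndot B (fun n => gam i *m a n) (comm_coef gam L f a) +
    ndot B a (comm_coef gam L f (fun n => gam i *m a n)).
  rewrite !ndot_commE -big_split mulr_sumr; apply: eq_bigr => n _.
  rewrite -big_split mulr_sumr; apply: eq_bigr => m _ /=.
  by rewrite -mulrDr -vdot_coord//; ring.
have h1 := ndot_comm_le ga.
have h2 : normc (ndot B a (comm_coef gam L f (fun n => gam i *m a n))) <= l * nn2 B a.
  by rewrite -[X in _ <= _ * X]ga; apply: ndot_comm_le; rewrite ga.
have : normc (2 * S) <= l * nn2 B a + l * nn2 B a.
  by rewrite E (le_trans (le_normcD _ _))// lerD.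
rewrite normcM -[2]/((1 + 1)%:R) -(rmorph_nat (real_complex R)) normc_real normr_nat.
lra.
Qed.

(** Differentiating at [x] amounts to differentiating at the origin for the
    translated coefficients [a'], which have the same norm. *)
Lemma qform_derive_le a x v : exists2 w, cderive x v (qform f a) w &
  normc w <= l * nn2 B a * \sum_i `|v 0 i|.
Proof.
pose a' n := conjc (tchar n x) *: a n.
pose S i := \sum_(n <- B) \sum_(m <- B)
   (fhat f (n - m) * vdot (a' n) (a' m)) * (((n - m) 0 i)%:~R : C).
exists (\sum_(n <- B) \sum_(m <- B) (fhat f (n - m) * vdot (a n) (a m)) *
    ((phase (n - m) v)*i * tchar (n - m) x)).
  by apply: cderive_sum => n; apply: cderive_sum => m; apply: cderiveZ; exact: cderive_tchar.
have -> : \sum_(n <- B) \sum_(m <- B) (fhat f (n - m) * vdot (a n) (a m)) *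
    ((phase (n - m) v)*i * tchar (n - m) x) = \sum_i ((v 0 i)*i : C) * S i.
  under [RHS]eq_bigr do rewrite mulr_sumr.
  rewrite [RHS]exchange_big; apply: eq_bigr => n _.
  under [RHS]eq_bigr do rewrite mulr_sumr.
  rewrite [RHS]exchange_big; apply: eq_bigr => m _.
  have -> : (phase (n - m) v)*i = \sum_i ((v 0 i)*i : C) * ((n - m) 0 i)%:~R.
    apply: complexP; rewrite ?(Re_sum, Im_sum).
      rewrite big1// => i _; rewrite -(rmorph_int (real_complex R)) /=; ring.
    rewrite /phase; apply: eq_bigr => i _; rewrite -(rmorph_int (real_complex R)) /=; ring.
  rewrite mulr_suml mulr_sumr; apply: eq_bigr => i _.
  by rewrite /a' vdotZr vdotZl conjcK tchar_subl; ring.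
rewrite (le_trans (le_normc_sum _ _ _))// mulr_sumr; apply: ler_sum => i _.
rewrite normcM mulrC; apply: ler_pM; rewrite ?normc_ge0//.
  by rewrite -(nn2_twist a x); exact: qform_coord_le.
by rewrite /= expr0n add0r sqrtr_sqr.
Qed.

Lemma qform_lip a : lipschitz (l * nn2 B a) (qform f a).
Proof.
move=> x z; have /choice[w wP] s : exists w, cderive (x + s *: z) z (qform f a) w /\
    normc w <= l * nn2 B a * \sum_i `|z 0 i|.
  by have [w h1 h2] := qform_derive_le a (x + s *: z) z; exists w.
split.
  have := @mvt_le R (fun s => complex.Re (qform f a (x + s *: z))) (fun s => complex.Re (w s))
    (l * nn2 B a * \sum_i `|z 0 i|).
  rewrite scale1r scale0r addr0; apply => s; have [[h1 _] h] := wP s.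
    exact: (is_derive_line_at (u := fun y => complex.Re (qform f a y))).
  by rewrite (le_trans (normc_Re _)).
have := @mvt_le R (fun s => complex.Im (qform f a (x + s *: z))) (fun s => complex.Im (w s))
  (l * nn2 B a * \sum_i `|z 0 i|).
rewrite scale1r scale0r addr0; apply => s; have [[_ h1] h] := wP s.
  exact: (is_derive_line_at (u := fun y => complex.Im (qform f a y))).
by rewrite (le_trans (normc_Im _)).
Qed.

End Bound.
End LipschitzForms.

Section FejerRate.
Context {R : realType} {d : nat}.
Local Notation C := R[i].
Local Notation X := 'rV[R]_d.

(** The bound of [fejer_close] for functions of Lipschitz constant one; [e] is the
    threshold angle of [angle_modulus]. *)
Definition fejer_rate (e : R) (m : nat) : R :=
  2 * (d%:R * e + pi / (1 - cos e) * (d%:R / m.+1%:R)).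

Lemma fejer_lip (f : X -> C) (l e : R) m x : 0 <= l -> 0 < e <= pi -> tcont f -> lipschitz l f ->
  normc (f x - fejer m f x) <= l * fejer_rate e m.
Proof.
move=> l0 epi tf lf; have c0 : 0 < 1 - cos e by rewrite subr_gt0 cos_lt1.
have K0 : 0 <= pi / (1 - cos e) by rewrite divr_ge0 ?pi_ge0// ltW.
have K1 := mulr_ge0 l0 K0.
apply: le_trans (@fejer_close R d m f x (l * (d%:R * e)) _ tf K1 _ _) _.
- move=> y; rewrite -mulrA -mulrDr.
  exact: (lipschitz_modulus (u := fun x => complex.Re (f x)) l0 (tcont_Re tf) epi (fun x z => (lf x z).1)).
- move=> y; rewrite -mulrA -mulrDr.
  exact: (lipschitz_modulus (u := fun x => complex.Im (f x)) l0 (tcont_Im tf) epi (fun x z => (lf x z).2)).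
by rewrite -mulrA -mulrDr mulrCA.
Qed.

Lemma fejer_rate_ge0 (e : R) m : 0 < e <= pi -> 0 <= fejer_rate e m.
Proof.
move=> epi; have c0 : 0 < 1 - cos e by rewrite subr_gt0 cos_lt1.
case/andP: epi => e0 _; rewrite /fejer_rate mulr_ge0// addr_ge0 ?mulr_ge0 ?(ltW e0)//.
  by rewrite pi_ge0.
Qed.

(** First [e] is chosen for the first summand, then [m], depending on [e], for the
    second. *)
Lemma fejer_rate_small (e0 : R) : 0 < e0 -> exists2 e, 0 < e <= pi & exists m, fejer_rate e m <= e0.
Proof.
move=> e00; pose e := Num.min pi (e0 / (4 * (d%:R + 1))).
have d1 : (0 : R) < d%:R + 1 by rewrite ltr_wpDl.
have ep : 0 < e <= pi.
  by rewrite lt_min pi_gt0 divr_gt0 ?mulr_gt0//= ge_min lexx.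
exists e => //; have c0 : 0 < 1 - cos e by rewrite subr_gt0 cos_lt1.
pose K := pi / (1 - cos e) * d%:R; have K0 : 0 <= K.
  by rewrite mulr_ge0// divr_ge0 ?pi_ge0// ltW.
exists (Num.bound (K / (e0 / 4))); set m := Num.bound _; rewrite /fejer_rate.
have h1 : d%:R * e <= e0 / 4.
  apply: (@le_trans _ _ ((d%:R + 1) * (e0 / (4 * (d%:R + 1))))).
    apply: ler_pM => //; first by case/andP : ep => /ltW.
      by rewrite lerDl.
    by rewrite ge_min lexx orbT.
  by rewrite mulrCA invfM [X in _ * X]mulrCA mulfV ?mulr1// gt_eqF.
have h2 : pi / (1 - cos e) * (d%:R / m.+1%:R) <= e0 / 4.
  rewrite mulrA -/K ler_pdivrMr ?ltr0n// mulrC -ler_pdivrMr ?divr_gt0//.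
  apply: ltW; apply: lt_le_trans (archi_boundP _) _; first by rewrite divr_ge0// divr_ge0// ltW.
  by rewrite ler_nat.
apply: (@le_trans _ _ (2 * (e0 / 4 + e0 / 4))); last by lra.
by rewrite ler_wpM2l// lerD.
Qed.

End FejerRate.

Section BoxVector.
Context {R : realType} {d : nat}.
Local Notation C := R[i].
Local Notation X := 'rV[R]_d.
Local Notation Zd := 'rV[int]_d.
Local Notation V := 'cV[C]_(2 ^ d./2).
Variable gam : 'I_d -> 'M[C]_(2 ^ d./2).
Variables (L : R) (m : nat).
Hypothesis mL : (d * m)%:R <= L.
Local Notation B := (@ball_seq R d L).
Local Notation cliff := (cliff gam).

(** The translate by [x] of the normalized indicator of the box, with constant
    spinor [u]; its matrix coefficients turn a compression into a Fejer mean. *)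
Definition boxvec (x : X) (u : V) (n : Zd) : V :=
  if n \in codom (@box d m) then ((Num.sqrt (@boxN R d m))^-1%:C * conjc (tchar n x)) *: u else 0.

Lemma box_mem (p : {ffun 'I_d -> 'I_m.+1}) : box p \in B.
Proof. exact: box_ball_seq. Qed.

Lemma sqrt_boxN2 : (Num.sqrt (@boxN R d m))^-1 * (Num.sqrt (@boxN R d m))^-1 = (@boxN R d m)^-1.
Proof. by rewrite -invfM -expr2 sqr_sqrtr// ltW// boxN_gt0. Qed.

Lemma nn2_boxvec x u : nn2 B (boxvec x u) = vn2 u.
Proof.
rewrite /nn2 (eq_bigr (fun n => if n \in codom (@box d m) then (@boxN R d m)^-1 * vn2 u else 0)).
  rewrite (sum_box (fun=> _) (ball_seq_uniq L) box_mem) sumr_const -/(@boxN R d m).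
  by rewrite -mulr_natl mulrA mulfV ?mul1r// boxN_neq0.
move=> n _; rewrite /boxvec; case: ifP => _; last by rewrite /vn2 big1// => k _; rewrite mxE normc0 expr0n.
by rewrite vn2Z normcM normc_conj normc_tchar mulr1 normc_real real_normK ?num_real// expr2 sqrt_boxN2.
Qed.

(** The common form of the matrix coefficients at box vectors of a compression
    ([M] constant) and of its commutator with the Dirac operator ([M] Clifford
    multiplication). *)
Lemma sum_boxvec (phi : Zd -> C) (M : Zd -> 'M[C]_(2 ^ d./2)) x (u v : V) :
  \sum_(n <- B) \sum_(k <- B) phi (n - k) * vdot (boxvec x u n) (M (n - k) *m boxvec x v k) =
  (@boxN R d m)^-1%:C * \sum_p \sum_q phi (@box d m p - @box d m q) *
    tchar (@box d m p - @box d m q) x * vdot u (M (@box d m p - @box d m q) *m v).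
Proof.
pose r : C := (Num.sqrt (@boxN R d m))^-1%:C.
rewrite (eq_bigr (fun n => if n \in codom (@box d m) then
   \sum_q r * tchar n x * (phi (n - @box d m q) *
       (r * conjc (tchar (@box d m q) x) * vdot u (M (n - @box d m q) *m v))) else 0)).
  rewrite (sum_box (fun n => \sum_q r * tchar n x * (phi (n - @box d m q) *
       (r * conjc (tchar (@box d m q) x) * vdot u (M (n - @box d m q) *m v)))) (ball_seq_uniq L) box_mem).
  rewrite mulr_sumr; apply: eq_bigr => p _; rewrite mulr_sumr; apply: eq_bigr => q _.
  by rewrite -sqrt_boxN2 real_complexM -/r [tchar (box p - box q) x]tchar_subl; ring.
move=> n _; case: ifP => nb; last first.
  rewrite big1// => k _; rewrite /boxvec nb.
  have -> : vdot (0 : V) (M (n - k) *m (if k \in codom (@box d m) then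
     ((Num.sqrt (@boxN R d m))^-1%:C * conjc (tchar k x)) *: v else 0)) = 0.
    by rewrite /vdot big1// => j _; rewrite mxE conjc0 mul0r.
  by rewrite mulr0.
rewrite -(sum_box (fun k => r * tchar n x * (phi (n - k) *
    (r * conjc (tchar k x) * vdot u (M (n - k) *m v)))) (ball_seq_uniq L) box_mem).
apply: eq_bigr => k _; rewrite {1}/boxvec nb -/r /boxvec; case: ifP => kb; last first.
  by rewrite mulmx0 /vdot big1 ?mulr0// => j _; rewrite !mxE mulr0.
rewrite -scalemxAr vdotZr vdotZl conjcM conjcK -/r.
by rewrite (_ : conjc r = r); [ring|rewrite /r; apply: complexP; rewrite reimE//= oppr0].
Qed.

Lemma qform_boxvec f x y (v : V) : vn2 v = 1 -> qform L f (boxvec x v) y = fejer m f (x + y).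
Proof.
move=> v1; pose phi k := fhat f k * tchar k y.
transitivity (\sum_(n <- B) \sum_(k <- B) phi (n - k) *
    vdot (boxvec x v n) ((1%:M : 'M[C]_(2 ^ d./2)) *m boxvec x v k)).
  by apply: eq_bigr => n _; apply: eq_bigr => k _; rewrite mul1mx /phi; ring.
rewrite (sum_boxvec phi (fun=> 1%:M)); congr (_ * _).
apply: eq_bigr => p _; apply: eq_bigr => q _.
by rewrite mul1mx vdotE v1 mulr1 tchar_addr /phi; ring.
Qed.

Lemma unit_spinor : exists v : V, vn2 v = 1.
Proof.
have p0 : (0 < 2 ^ d./2)%N by rewrite expn_gt0.
exists (\col_k (k == Ordinal p0)%:R); rewrite /vn2 (bigD1 (Ordinal p0))//= big1.
  by rewrite mxE eqxx normc1 expr1n addr0.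
by move=> k /negbTE kp; rewrite mxE kp normc0 expr0n.
Qed.

Section FejerBound.
Hypothesis gam_clifford : clifford gam.
Variables (f : X -> C) (l : R).
Hypotheses (l0 : 0 <= l) (tf : tcont f).
Hypothesis fl : (tlip gam L (trunc L f) <= l%:E)%E.

Let fl' := (tlip_leP gam L tf l0).1 fl.

Lemma lipschitz_fejer : lipschitz l (fejer m f).
Proof.
move=> x z; have [v v1] := unit_spinor.
have := qform_lip gam_clifford l0 fl' (boxvec 0 v) x z.
by rewrite !qform_boxvec// nn2_boxvec v1 mulr1 !add0r.
Qed.

(** For fixed [x] and [v] let [w] be Clifford multiplication by the differential
    of the Fejer mean, applied to [v] at [x].  Then [vn2 w] is the matrix
    coefficient of the truncated commutator between the box vectors of [w] and
    [v], and Cauchy-Schwarz gives the pointwise bound on [w]. *)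
Lemma dlip_fejer : (dlip gam (fejer m f) <= l%:E)%E.
Proof.
pose I := ({ffun 'I_d -> 'I_m.+1} * {ffun 'I_d -> 'I_m.+1})%type.
pose b (i : I) : C := (@boxN R d m)^-1%:C * fhat f (@box d m i.1 - @box d m i.2).
pose k (i : I) : Zd := @box d m i.1 - @box d m i.2.
have fE : fejer m f = (fun x => \sum_(i <- index_enum I) b i * tchar (k i) x).
  apply/funext => x; rewrite /fejer mulr_sumr.
  rewrite -(pair_bigA _ (fun p q => b (p, q) * tchar (k (p, q)) x)) /=.
  apply: eq_bigr => p _; rewrite mulr_sumr; apply: eq_bigr => q _.
  by rewrite /b /k /= mulrA.
rewrite fE; apply: dlip_trig => // x v; set w := \sum_(i <- _) _.
have ww : (vn2 w)%:C = ndot B (boxvec x w) (comm_coef gam L f (boxvec x v)).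
  rewrite ndot_commE (sum_boxvec (fhat f) cliff) -vdotE /w vdot_sumr -/w mulr_sumr.
  rewrite -(pair_bigA _ (fun p q => vdot w ((b (p, q) * tchar (k (p, q)) x) *: (cliff (k (p, q)) *m v)))) /=.
  apply: eq_bigr => p _; rewrite mulr_sumr; apply: eq_bigr => q _.
  by rewrite vdotZr /b /k /=; ring.
have := cauchy_schwarz B (comm_coef gam L f (boxvec x v)) (boxvec x w).
rewrite -/(ndot B (boxvec x w) (comm_coef gam L f (boxvec x v))) -ww normc_real real_normK ?num_real//.
rewrite -/(nn2 B (boxvec x w)) nn2_boxvec => h.
have h2 : \sum_(i <- B) vn2 (comm_coef gam L f (boxvec x v) i) <= l ^+ 2 * vn2 v.
  by have := fl' (boxvec x v); rewrite nn2_boxvec.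
have [w0|w0] := eqVneq (vn2 w) 0; first by rewrite w0 mulr_ge0 ?sqr_ge0 ?vn2_ge0.
have wp : 0 < vn2 w by rewrite lt_def w0 vn2_ge0.
rewrite -(ler_pM2l wp) -expr2 (le_trans h)//.
by apply: ler_wpM2l => //; exact: vn2_ge0.
Qed.

(** The Fejer mean of the quadratic form is the quadratic form of the Fejer mean,
    and the quadratic form is Lipschitz. *)
Lemma qform_fejer_le (e : R) a : 0 < e <= pi ->
  normc (qform L f a 0 - qform L (fejer m f) a 0) <= l * fejer_rate (d:=d) e m * nn2 B a.
Proof.
move=> epi; rewrite -qform_fejer//.
rewrite mulrAC; apply: fejer_lip => //; first by rewrite mulr_ge0// nn2_ge0.
- exact: qform_tcont.
- exact: (qform_lip gam_clifford l0 fl' a).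
Qed.

End FejerBound.
End BoxVector.

(** * Smooth functions and scaling *)

Section Smooth.
Context {R : realType} {d : nat}.
Local Notation C := R[i].
Local Notation X := 'rV[R]_d.
Local Notation Zd := 'rV[int]_d.
Local Notation smooth f := (torus_smooth (f : X -> R[i]^o)).

Lemma smooth_tcont f : smooth f -> tcont f.
Proof. by move=> [pf /(_ 0%N)[[c1 _] [c2 _]]]. Qed.

Lemma derive_periodic (u : X -> R^o) (v : X) : rperiodic u ->
  rperiodic (fun x => 'D_v u x).
Proof.
move=> pu n x; rewrite /derive.
set f1 := (fun h => _); set f2 := (fun h : R => h^-1 *: ((u \o shift x) (h *: v) - u x)).
rewrite (_ : f1 = f2)//; apply/funext => h.
by rewrite /f1 /f2 /= addrA !pu.
Qed.

Lemma smooth_deriv f : smooth f -> exists g : 'I_d -> X -> C,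
  (forall i, tcont (g i)) /\ (forall i x, cderive x 'e_i f (g i x)).
Proof.
move=> sf; have tf := smooth_tcont sf; have [_ /(_ 1%N)[[_ d1] [_ d2]]] := sf.
exists (fun i x => ('D_('e_i) (fun y => complex.Re (f y) : R^o) x : R) +i*
                   ('D_('e_i) (fun y => complex.Im (f y) : R^o) x : R)); split=> i.
  split.
  - move=> n x; apply: complexP => /=.
      exact: (derive_periodic 'e_i (tcont_Re tf)).
    exact: (derive_periodic 'e_i (tcont_Im tf)).
  - by case: (d1 i) => _ [].
  - by case: (d2 i) => _ [].
by move=> x; split; apply: DeriveDef => //; [case: (d1 i)|case: (d2 i)].
Qed.

Lemma cderive_trig I (s : seq I) (b : I -> C) (k : I -> Zd) x v :
  cderive x v (fun x => \sum_(i <- s) b i * tchar (k i) x)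
    (\sum_(i <- s) (b i * (phase (k i) v)*i) * tchar (k i) x).
Proof.
apply: cderive_sum => i; rewrite -mulrA; apply: cderiveZ; exact: cderive_tchar.
Qed.

Lemma trig_tcont I (s : seq I) (b : I -> C) (k : I -> Zd) :
  tcont (fun x => \sum_(i <- s) b i * tchar (k i) x).
Proof. by apply: tcont_sum => i; apply: tcontZ; exact: tcont_tchar. Qed.

Lemma Ck_trig j I (s : seq I) (b : I -> C) (k : I -> Zd) :
  Ck j (fun x => complex.Re (\sum_(i <- s) b i * tchar (k i) x)).
Proof.
elim: j b => [|j ih] b; (split; first by case: (trig_tcont s b k)) => //.
move=> i; have D x := (cderive_trig s b k x 'e_i).1; split; first by move=> x; case: (D x).
have -> : (fun x => 'D_('e_i) (fun x => complex.Re (\sum_(i <- s) b i * tchar (k i) x) : R^o) x) =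
  (fun x => complex.Re (\sum_(i0 <- s) (b i0 * (phase (k i0) 'e_i)*i) * tchar (k i0) x)).
  by apply/funext => x; case: (D x).
exact: ih.
Qed.

Lemma smooth_trig I (s : seq I) (b : I -> C) (k : I -> Zd) :
  smooth (fun x => \sum_(i <- s) b i * tchar (k i) x).
Proof.
split; first by case: (trig_tcont s b k).
move=> j; split; first exact: Ck_trig.
rewrite (_ : (fun x => _) = (fun x => complex.Re (\sum_(i <- s) (- 'i * b i) * tchar (k i) x))).
  exact: Ck_trig.
apply/funext => x; under [in RHS]eq_bigr do rewrite -mulrA.
by rewrite -mulr_sumr !reimE /=; ring.
Qed.

Lemma smooth_fejer m f : smooth (fejer m f).
Proof.
pose I := ({ffun 'I_d -> 'I_m.+1} * {ffun 'I_d -> 'I_m.+1})%type.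
rewrite (_ : fejer m f = (fun x => \sum_(i <- index_enum I)
   ((@boxN R d m)^-1%:C * fhat f (@box d m i.1 - @box d m i.2)) * tchar (@box d m i.1 - @box d m i.2) x)).
  exact: smooth_trig.
apply/funext => x; rewrite /fejer mulr_sumr.
rewrite -(pair_bigA _ (fun p q => (@boxN R d m)^-1%:C * fhat f (@box d m p - @box d m q) *
   tchar (@box d m p - @box d m q) x)) /=.
by apply: eq_bigr => p _; rewrite mulr_sumr; apply: eq_bigr => q _; rewrite mulrA.
Qed.

Lemma Ck_scale j (r : R) (u : X -> R^o) : Ck j u -> Ck j (fun x => r * u x).
Proof.
elim: j u => [|j ih] u [cu du]; (split; first by move=> x; exact: (@cvgM R X (nbhs x) _ (cst r) u _ _ (cvg_cst _) (cu x))) => //.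
move=> i; have [d1 c1] := du i.
have E x : is_derive x 'e_i (fun x => r * u x : R^o) (r * 'D_('e_i) u x).
  have du' : is_derive x 'e_i u ('D_('e_i) u x) by apply: DeriveDef => //.
  exact: (is_deriveZ r du').
split; first by move=> x; case: (E x).
rewrite (_ : (fun x => 'D_('e_i) _ x) = (fun x => r * 'D_('e_i) u x)); first exact: ih.
by apply/funext => x; case: (E x).
Qed.

Lemma smooth_scale (r : R) f : smooth f -> smooth (fun x => r%:C * f x).
Proof.
move=> [pf cf]; split; first by move=> n x; rewrite pf.
move=> j; have [c1 c2] := cf j; split.
  rewrite (_ : (fun x => _) = (fun x => r * complex.Re (f x))); first exact: Ck_scale.
  by apply/funext => x; rewrite reimE /= mul0r subr0.
rewrite (_ : (fun x => _) = (fun x => r * complex.Im (f x))); first exact: Ck_scale.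
by apply/funext => x; rewrite reimE /= mul0r addr0.
Qed.

End Smooth.

(** Connes' distance only sees elements of seminorm exactly one.  Scaling extends
    the bound to positive seminorms; where the seminorm vanishes scaling does not
    help, so that case is a separate hypothesis.  The seminorm is accessed
    through upper bounds only, because that is how commutators are estimated. *)
Lemma homogeneous_bound (R : realType) (E : Type) (P : E -> Prop) (N : E -> \bar R)
    (sc : R -> E -> E) (D : E -> R) (D0 : R) :
  (forall r f, 0 < r -> P f -> P (sc r f)) ->
  (forall r f l, 0 < r -> 0 <= l -> P f -> (N f <= l%:E)%E -> (N (sc r f) <= (r * l)%:E)%E) ->
  (forall r f, 0 < r -> P f -> sc r^-1 (sc r f) = f) ->
  (forall r f, 0 < r -> P f -> D (sc r f) = r * D f) ->
  (forall f, P f -> N f = 1%E -> D f <= D0) ->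
  (forall f, P f -> (N f <= 0)%E -> D f <= 0) -> 0 <= D0 ->
  forall f l, P f -> 0 <= l -> (N f <= l%:E)%E -> D f <= l * D0.
Proof.
move=> Psc Nsc scK Dsc D1 Dz D00 f l Pf l0 Nl.
have [N0|N0] := leP (N f) 0%E; first by rewrite (le_trans (Dz _ Pf N0))// mulr_ge0.
have [r Nr] : exists r, N f = r%:E.
  by case: (N f) Nl N0 => [r _ _|//|//]; exists r.
have r0 : 0 < r by move: N0; rewrite Nr lte_fin.
have ri : 0 < r^-1 by rewrite invr_gt0.
have rl : r <= l by move: Nl; rewrite Nr lee_fin.
have N1 : N (sc r^-1 f) = 1%E.
  apply/eqP; rewrite eq_le; apply/andP; split.
    have := Nsc r^-1 f r ri (ltW r0) Pf; rewrite Nr lexx => /(_ isT).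
    by rewrite mulVf ?gt_eqF.
  (* scaling back a seminorm below one would contradict [N f = r] *)
  rewrite leNgt; apply/negP => lt1.
  have [s [s0 s1 Ns]] : exists s, [/\ 0 <= s, s < 1 & (N (sc r^-1%R f) <= s%:E)%E].
    case: (N (sc r^-1 f)) lt1 => [s|//|_]; last by exists 0; rewrite lexx ltr01 leNye.
    rewrite lte_fin => s1; exists (Num.max 0 s).
    by rewrite le_max lexx gt_max ltr01 s1 lee_fin le_max lexx orbT.
  have := Nsc r (sc r^-1 f) s r0 s0 (Psc _ _ ri Pf) Ns.
  rewrite -{1}(invrK r) scK// Nr lee_fin => h.
  by have : r * s < r; [rewrite gtr_pMr|rewrite ltNge h].
have := D1 _ (Psc _ _ ri Pf) N1; rewrite Dsc// mulrC ler_pdivrMr// => h.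
by rewrite (le_trans h)// mulrC ler_wpM2r.
Qed.

Section Scaling.
Context {R : realType} {d : nat}.
Local Notation C := R[i].
Local Notation X := 'rV[R]_d.
Variable gam : 'I_d -> 'M[C]_(2 ^ d./2).

Lemma dlip_scale (r l : R) (f : X -> C) : 0 < r -> 0 <= l -> tcont f ->
  (dlip gam f <= l%:E)%E -> (dlip gam (fun x => (r%:C * f x)%R) <= (r * l)%:E)%E.
Proof.
move=> r0 l0 tf /(dlip_leP gam tf l0) h.
have trf := tcontZ r%:C tf; have rl0 : 0 <= r * l by rewrite mulr_ge0// ltW.
have rC : r%:C != 0 :> C by rewrite (inj_eq (@complexI R)) gt_eqF.
apply/(dlip_leP gam trf rl0) => xi eta zeta g1 g2 x1.
have [hz1 hz fz] := (dirac_graphP gam _ _).1 g2; have [hx he fe] := (dirac_graphP gam _ _).1 g1.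
have := h xi eta (fun t => r%:C^-1 *: zeta t) g1 _ x1.
have mE : mult (fun x => r%:C * f x) xi = (fun t => r%:C *: mult f xi t).
  by apply/funext => t; rewrite /mult scalerA.
have g3 : dirac_graph gam (mult f xi, fun t => r%:C^-1 *: zeta t).
  apply/dirac_graphP; split; [exact: mult_csquare|exact: csquare_spinorZ|].
  move=> n; rewrite fourierZ// fz mE fourierZ; last exact: mult_csquare.
  by rewrite -scalemxAr scalerA mulVf// scale1r.
move=> /(_ g3) h'.
have hd : csquare_spinor (fun t => r%:C^-1 *: zeta t + -1 *: mult f eta t).
  apply: csquare_spinorD; first exact: csquare_spinorZ.
  by apply: csquare_spinorZ; exact: mult_csquare.
rewrite (_ : nrm2 _ = r ^+ 2 * nrm2 (fun t => r%:C^-1 *: zeta t + -1 *: mult f eta t)).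
  rewrite exprMn; apply: ler_wpM2l; first exact: sqr_ge0.
  by under [X in nrm2 X]eq_fun do rewrite scaleN1r.
rewrite -(RintegralZl _ measurableT (vn2_integrable hd)); apply: eq_Rintegral => t _.
rewrite -(real_normK (num_real r)) -normc_real -vn2Z; congr vn2.
by rewrite scalerDr scalerA mulfV// scale1r scaleN1r scalerN /mult scalerA.
Qed.

Lemma tlip_scale L (r l : R) (f : X -> C) : 0 < r -> 0 <= l -> tcont f ->
  (tlip gam L (trunc L f) <= l%:E)%E ->
  (tlip gam L (trunc L (fun x => (r%:C * f x)%R)) <= (r * l)%:E)%E.
Proof.
move=> r0 l0 tf /(tlip_leP gam L tf l0) h.
have rl0 : 0 <= r * l by rewrite mulr_ge0// ltW.
apply/tlip_leP => // [|a]; first exact: tcontZ.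
rewrite (_ : nn2 _ _ = nn2 (ball_seq L) (fun n => r%:C *: comm_coef gam L f a n)).
  rewrite nn2Z normc_real real_normK ?num_real// exprMn -[_ * _ * nn2 _ a]mulrA.
  by apply: ler_wpM2l; [exact: sqr_ge0|exact: h].
apply: eq_bigr => n _; congr vn2; rewrite /comm_coef scaler_sumr; apply: eq_bigr => k _.
by rewrite fhatZ// scalerA.
Qed.

End Scaling.

(** * States and their pullbacks *)

Section TorusStates.
Context {R : realType} {d : nat}.
Local Notation C := R[i].
Local Notation X := 'rV[R]_d.
Variable psi : @torus_state R d.

Lemma torus_state_lin (c : C) (f g : X -> C) : tcont f -> tcont g ->
  state_val psi (fun x => c * f x + g x : C^o) = c * state_val psi f + state_val psi g.
Proof.
move=> tf tg; apply: (state_val_linear psi (u := f) (v := g) (a := c)) => //.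
by apply: tcontD => //; exact: tcontZ.
Qed.

Lemma torus_state_cst1 : state_val psi (fun=> 1 : C^o) = 1.
Proof. by case: (state_val_one psi). Qed.

Lemma torus_state0 : state_val psi (fun=> 0 : C^o) = 0.
Proof.
have E := torus_state_lin (-1) (tcont_cst 1) (tcont_cst 1).
rewrite torus_state_cst1 mulr1 addNr in E; rewrite -[RHS]E; congr state_val.
Qed.

Lemma torus_stateZ (c : C) (f : X -> C) : tcont f -> state_val psi (fun x => c * f x : C^o) = c * state_val psi f.
Proof.
move=> tf; have := torus_state_lin c tf (tcont_cst 0); rewrite torus_state0 addr0 => <-; congr state_val.
by apply/funext => x; rewrite addr0.
Qed.

Lemma torus_stateB (f g : X -> C) : tcont f -> tcont g ->
  state_val psi (fun x => f x - g x : C^o) = state_val psi f - state_val psi g.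
Proof.
move=> tf tg; have := torus_state_lin (-1) tg tf; rewrite mulN1r addrC => <-; congr state_val.
by apply/funext => x; rewrite mulN1r addrC.
Qed.

Lemma torus_state_cst (c : C) : state_val psi (fun=> c : C^o) = c.
Proof.
have := torus_stateZ c (tcont_cst 1); by rewrite torus_state_cst1 mulr1 => h; rewrite -[RHS]h; congr state_val.
Qed.

(** Positivity also forces the imaginary part to vanish. *)
Lemma ge0_normc_le (c : R) (z : C) : 0 <= c%:C - z -> 0 <= c%:C + z -> normc z <= c.
Proof.
rewrite !ge0_complexE; case: z => a b; rewrite /= add0r add0r oppr_eq0.
move=> /andP[/eqP -> h1] /andP[_ h2]; rewrite expr0n addr0 sqrtr_sqr ler_norml.
by apply/andP; split; lra.
Qed.

Lemma tcont_real_Re f : tcont f -> tcont (fun x : X => (complex.Re (f x))%:C : C).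
Proof.
move=> tf; have [_ c1 _] := tf; split.
- by move=> n x; rewrite (tcont_Re tf).
- exact: c1.
- exact: cst_continuous.
Qed.
Lemma tcont_real_Im f : tcont f -> tcont (fun x : X => (complex.Im (f x))%:C : C).
Proof.
move=> tf; have [_ _ c1] := tf; split.
- by move=> n x; rewrite (tcont_Im tf).
- exact: c1.
- exact: cst_continuous.
Qed.

(** The factor 2 is not optimal, but it is harmless for the convergence. *)
Lemma torus_state_split f (c : R) : tcont f ->
  normc (state_val psi (fun x => (complex.Re (f x))%:C : C^o)) <= c ->
  normc (state_val psi (fun x => (complex.Im (f x))%:C : C^o)) <= c ->
  normc (state_val psi f) <= 2 * c.
Proof.
move=> tf h1 h2.
have -> : state_val psi f = 'i * state_val psi (fun x => (complex.Im (f x))%:C : C^o) +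
    state_val psi (fun x => (complex.Re (f x))%:C : C^o).
  rewrite -torus_state_lin; [|exact: tcont_real_Im|exact: tcont_real_Re].
  congr state_val; apply/funext => x; apply: complexP; rewrite !reimE /=; ring.
rewrite (le_trans (le_normcD _ _))// normcM mulr_natl mulr2n lerD//.
by rewrite [normc 'i](_ : _ = 1) ?mul1r//= expr0n expr1n add0r sqrtr1.
Qed.

Lemma torus_state_real_bound (u : X -> R) (c : R) : tcont (fun x => (u x)%:C) ->
  (forall x, `|u x| <= c) -> normc (state_val psi (fun x => (u x)%:C : C^o)) <= c.
Proof.
move=> tu uc; apply: ge0_normc_le.
  rewrite -[X in X - _](torus_state_cst c%:C) -torus_stateB//; last exact: tcont_cst.
  apply: state_val_ge0; first by apply: tcontB => //; exact: tcont_cst.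
  move=> x /=; rewrite ge0_complexE /= subrr eqxx /= subr_ge0.
  by rewrite (le_trans (ler_norm _)).
rewrite -[X in X + _](torus_state_cst c%:C) -[state_val psi (fun=> c%:C)]mul1r -torus_state_lin//; last exact: tcont_cst.
apply: state_val_ge0; first by apply: tcontD => //; apply: tcontZ; exact: tcont_cst.
move=> x /=; rewrite mul1r ge0_complexE /= add0r eqxx /= -lerBlDr sub0r.
by have := uc x; rewrite ler_norml lerNl => /andP[].
Qed.

Lemma torus_state_bound (f : X -> C) (c : R) : tcont f ->
  (forall x, normc (f x) <= c) -> normc (state_val psi f) <= 2 * c.
Proof.
move=> tf fc; apply: torus_state_split => //; apply: torus_state_real_bound.
- exact: tcont_real_Re.
- by move=> x; rewrite (le_trans (normc_Re _)).
- exact: tcont_real_Im.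
- by move=> x; rewrite (le_trans (normc_Im _)).
Qed.

End TorusStates.

Section TruncatedStates.
Context {R : realType} {d : nat}.
Local Notation C := R[i].
Local Notation X := 'rV[R]_d.
Local Notation Zd := 'rV[int]_d.
Local Notation V := 'cV[C]_(2 ^ d./2).
Local Notation spinor := (@spinor R d).
Variable L : R.
Local Notation B := (@ball_seq R d L).
Local Notation truncation := (@truncation R d L).

Lemma trunc_lin (c : C) (f g : X -> C) : tcont f -> tcont g ->
  trunc L (fun x => c * f x + g x) = c *: trunc L f + trunc L g.
Proof.
move=> tf tg; apply/funext => xi.
rewrite truncE; last by apply: tcontD => //; exact: tcontZ.
rewrite !fctE !truncE//; apply/funext => t.
rewrite /trigsp scaler_sumr -big_split; apply: eq_bigr => n _ /=.
rewrite scalerA mulrC -scalerA -scalerDr; congr (_ *: _).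
rewrite scaler_sumr -big_split; apply: eq_bigr => k _ /=.
by rewrite fhatD ?fhatZ//; [rewrite scalerDl scalerA|exact: tcontZ].
Qed.

Lemma trunc_cst1 : trunc L (fun _ : X => 1 : C) = proj L.
Proof.
apply/funext => xi; rewrite /trunc /= (_ : mult _ _ = proj L xi).
  by rewrite [proj L xi]projE proj_trigsp.
by apply/funext => t; rewrite /mult scale1r.
Qed.

(** A compression sees only finitely many Fourier coefficients, so a continuous
    function has the same compression as some trigonometric polynomial. *)
Lemma truncation_trunc (f : X -> C) : tcont f -> truncation (trunc L f).
Proof.
move=> tf; pose D := undup [seq n - m | n <- B, m <- B].
exists (fun x => \sum_(k <- D) fhat f k * tchar k x); first exact: smooth_trig.
apply/funext => xi; rewrite -/(trunc L _) !truncE//; last exact: trig_tcont.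
apply: eq_trigsp => n nB; rewrite !big_seq; apply: eq_bigr => m mB; congr (_ *: _).
rewrite fhat_sum => [|k]; last by apply: tcontZ; exact: tcont_tchar.
have nmD : n - m \in D by rewrite mem_undup; apply/allpairsP; exists (n, m).
rewrite (bigD1_seq (n - m)) ?undup_uniq//= fhatZ; last exact: tcont_tchar.
rewrite fhat_tchar eqxx mulr1 big1 ?addr0// => k /negbTE kn.
by rewrite fhatZ ?fhat_tchar ?kn ?mulr0//; exact: tcont_tchar.
Qed.

Lemma truncationP T : truncation T -> exists2 f : X -> C,
  torus_smooth (f : X -> C^o) & T = trunc L f.
Proof. by move=> [f sf <-]; exists f. Qed.

Lemma qform_integral f (a : Zd -> V) : tcont f -> qform L f a 0 =
  cintegral (fun t => f (row_of t) * (vn2 (trigsp B a t))%:C).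
Proof.
move=> tf; rewrite qform0E//; apply: eq_cintegral => t.
rewrite -vdotE /vdot mulr_sumr; apply: eq_bigr => k _.
by rewrite /mult mxE mulrCA.
Qed.

Lemma qform_ge0 f (a : Zd -> V) : tcont f -> (forall x, 0 <= f x) -> 0 <= qform L f a 0.
Proof.
move=> tf f0; rewrite qform_integral// ge0_complexE Re_cintegral Im_cintegral.
rewrite (_ : (\int[_]_t complex.Im _)%R = 0); last first.
  rewrite -[RHS](mul0r (fine (@torus_measure R d setT))) -Rintegral_cst//; apply: eq_Rintegral.
  move=> t _; rewrite reimE /= mulr0 add0r.
  by have := f0 (row_of t); rewrite ge0_complexE => /andP[/eqP -> _]; rewrite mul0r.
rewrite eqxx /=; apply: Rintegral_ge0 => t _.
rewrite reimE /= mulr0 subr0 mulr_ge0 ?vn2_ge0//.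
by have := f0 (row_of t); rewrite ge0_complexE => /andP[].
Qed.

Lemma nonneg_trunc f : tcont f -> (forall a : Zd -> V, 0 <= qform L f a 0) ->
  nonneg_on L (trunc L f).
Proof. by move=> tf h xi /proj_rangeP[a ->]; rewrite -qform0_trunc. Qed.

Lemma compression_pullback_subproof (phi : @truncated_state R d L) :
  {psi : @torus_state R d | forall f : X -> C, tcont f -> state_val psi f = state_val phi (trunc L f)}.
Proof.
have [] := @mk_state R _ (@torus_continuous R d) (@torus_nonneg R d) (cst 1)
  (fun f => state_val phi (trunc L f)).
- move=> a u v Eu Ev Ew; rewrite (trunc_lin a Eu Ev); apply: state_val_linear.
  + exact: truncation_trunc.
  + exact: truncation_trunc.
  + by rewrite -trunc_lin//; exact: truncation_trunc.
- move=> f Ef f0; apply: state_val_ge0; first exact: truncation_trunc.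
  by apply: nonneg_trunc => // a; exact: qform_ge0.
- exact: tcont_cst.
- by rewrite trunc_cst1; case: (state_val_one phi).
by move=> psi h; exists psi.
Qed.

(** The torus state [f |-> phi (P f P)]. *)
Definition compression_pullback phi := sval (compression_pullback_subproof phi).

Lemma compression_pullbackE phi (f : X -> C) : tcont f -> state_val (compression_pullback phi) f = state_val phi (trunc L f).
Proof. exact: (svalP (compression_pullback_subproof phi)). Qed.

Lemma qform_lin (c : C) (f g : X -> C) (a : Zd -> V) x : tcont f -> tcont g ->
  qform L (fun x => c * f x + g x) a x = c * qform L f a x + qform L g a x.
Proof.
move=> tf tg; rewrite /qform mulr_sumr -big_split; apply: eq_bigr => n _ /=.
rewrite mulr_sumr -big_split; apply: eq_bigr => k _ /=.
by rewrite fhatD ?fhatZ//; [ring|exact: tcontZ].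
Qed.

Lemma qformZ (c : C) (f : X -> C) (a : Zd -> V) x : tcont f ->
  qform L (fun x => c * f x) a x = c * qform L f a x.
Proof.
move=> tf; rewrite /qform mulr_sumr; apply: eq_bigr => n _ /=.
by rewrite mulr_sumr; apply: eq_bigr => k _ /=; rewrite fhatZ// !mulrA.
Qed.

Lemma qform_cst1 (a : Zd -> V) : qform L (fun=> 1 : C) a 0 = (nn2 B a)%:C.
Proof.
rewrite (@qform_real R d L (fun=> 1)); last exact: tcont_cst.
rewrite -(nrm2_trigsp a (ball_seq_uniq L)); congr (_%:C).
by apply: eq_Rintegral => t _; rewrite mul1r.
Qed.

(** The compressions of [c + u] and [c - u] are positive operators.  Only the
    quadratic form of [u] on the range of the projection enters, which is weaker
    than a pointwise bound on [u]. *)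
Lemma truncated_state_real_bound (phi : @truncated_state R d L) (u : X -> R) (c : R) :
  tcont (fun x => (u x)%:C) ->
  (forall a : Zd -> V, normc (qform L (fun x => (u x)%:C) a 0) <= c * nn2 B a) ->
  normc (state_val (compression_pullback phi) (fun x => (u x)%:C : C^o)) <= c.
Proof.
move=> tu uc.
have pos (e : R) : `|e| <= 1 ->
    0 <= c%:C + e%:C * state_val (compression_pullback phi) (fun x => (u x)%:C : C^o).
  (* both signs at once: only [e = 1] and [e = -1] are used *)
  move=> e1; pose f x : C := c%:C * 1 + e%:C * (u x)%:C.
  have tf : tcont f by apply: tcontD; apply: tcontZ => //; exact: tcont_cst.
  have -> : c%:C + e%:C * state_val (compression_pullback phi) (fun x => (u x)%:C : C^o) = state_val (compression_pullback phi) f.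
    rewrite /f torus_state_lin; [|exact: tcont_cst|exact: tcontZ].
    by rewrite torus_state_cst1 mulr1 torus_stateZ.
  rewrite compression_pullbackE//; apply: state_val_ge0; first exact: truncation_trunc.
  apply: nonneg_trunc => // a; rewrite /f qform_lin; [|exact: tcont_cst|exact: tcontZ].
  rewrite qformZ// qform_cst1; have := uc a; rewrite qform_real// normc_real.
  set I := (\int[_]_t _)%R => Ic; rewrite -!real_complexM -rmorphD ler0c.
  have : `|e * I| <= c * nn2 B a.
    rewrite normrM (le_trans _ Ic)// ler_piMl//.
  by rewrite ler_norml => /andP[]; lra.
apply: ge0_normc_le.
  by have := pos (-1); rewrite normrN1 lexx => /(_ isT); rewrite rmorphN1 mulN1r.
by have := pos 1; rewrite normr1 lexx => /(_ isT); rewrite mul1r.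
Qed.

Lemma truncated_state_bound (phi : @truncated_state R d L) (f : X -> C) (c : R) : tcont f ->
  (forall a : Zd -> V, normc (qform L f a 0) <= c * nn2 B a) ->
  normc (state_val phi (trunc L f)) <= 2 * c.
Proof.
move=> tf fc; rewrite -compression_pullbackE//; apply: torus_state_split => //; apply: truncated_state_real_bound.
- exact: tcont_real_Re.
- move=> a; rewrite (@qform_real R d L (fun x => complex.Re (f x))); last exact: tcont_real_Re.
  rewrite normc_real (le_trans _ (fc a))// qform_integral// (le_trans _ (normc_Re _))//.
  rewrite Re_cintegral le_eqVlt; apply/orP; left; apply/eqP; congr `|_|; apply: eq_Rintegral => t _.
  by rewrite reimE /= mulr0 subr0.
- exact: tcont_real_Im.
- move=> a; rewrite (@qform_real R d L (fun x => complex.Im (f x))); last exact: tcont_real_Im.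
  rewrite normc_real (le_trans _ (fc a))// qform_integral// (le_trans _ (normc_Im _))//.
  rewrite Im_cintegral le_eqVlt; apply/orP; left; apply/eqP; congr `|_|; apply: eq_Rintegral => t _.
  by rewrite reimE /= mulr0 add0r.
Qed.

Lemma truncated_stateB (phi : @truncated_state R d L) (f g : X -> C) : tcont f -> tcont g ->
  state_val phi (trunc L (fun x => f x - g x)) = state_val phi (trunc L f) - state_val phi (trunc L g).
Proof.
move=> tf tg.
have tfg := tcontB tf tg.
rewrite -[LHS](compression_pullbackE phi tfg) -[X in _ = X - _](compression_pullbackE phi tf).
rewrite -[X in _ = _ - X](compression_pullbackE phi tg); exact: torus_stateB.
Qed.

Lemma truncated_stateZ (phi : @truncated_state R d L) (f : X -> C) (c : C) : tcont f ->
  state_val phi (trunc L (fun x => c * f x)) = c * state_val phi (trunc L f).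
Proof.
move=> tf; rewrite -[LHS](compression_pullbackE phi (tcontZ c tf)) -[X in _ = _ * X](compression_pullbackE phi tf).
exact: torus_stateZ.
Qed.

Section Symbol.
Variable m : nat.
Hypothesis mL : (d * m)%:R <= L.

(** Any unit spinor serves, since the symbols of compressions do not depend on it. *)
Definition symbol_vector (x : X) : spinor :=
  trigsp B (boxvec m x (sval (cid (@unit_spinor R d)))).

Definition symbol (T : spinor -> spinor) (x : X) : C :=
  inner (symbol_vector x) (T (symbol_vector x)).

Lemma symbol_trunc f : tcont f -> symbol (trunc L f) = fejer m f.
Proof.
move=> tf; apply/funext => x; rewrite /symbol /symbol_vector.
case: cid => v v1 /=; rewrite -qform0_trunc//.
by rewrite (qform_boxvec mL)// addr0.
Qed.

Lemma symbol_pullback_subproof (psi : @torus_state R d) :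
  {phi : @truncated_state R d L | forall f : X -> C, tcont f ->
     state_val phi (trunc L f) = state_val psi (fejer m f)}.
Proof.
have [] := @mk_state R _ truncation (@nonneg_on R d L) (@proj R d L)
  (fun T => state_val psi (symbol T)).
- move=> a u v /truncationP[f sf ->] /truncationP[g sg ->] _.
  have tf := smooth_tcont sf; have tg := smooth_tcont sg.
  have tfg : tcont (fun x => a * f x + g x) by apply: tcontD => //; exact: tcontZ.
  have e : symbol (a *: trunc L f + trunc L g) = (fun x => a * fejer m f x + fejer m g x).
    apply: eq_trans (f_equal symbol (esym (trunc_lin a tf tg))) _.
    apply: eq_trans (symbol_trunc tfg) _.
    by apply/funext => x; rewrite fejerD// ?fejerZ//; exact: tcontZ.
  apply: eq_trans (f_equal (state_val psi) e) _.
  apply: eq_trans (torus_state_lin psi a (tcont_fejer m f) (tcont_fejer m g)) _.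
  exact: (f_equal2 (fun F G => a * state_val psi F + state_val psi G)
    (esym (symbol_trunc tf)) (esym (symbol_trunc tg))).
- move=> T ET pT; apply: state_val_ge0.
    have [f sf ->] := truncationP ET; rewrite symbol_trunc; last exact: smooth_tcont.
    exact: tcont_fejer.
  move=> x; apply: pT; apply/proj_rangeP; by exists (boxvec m x (sval (cid (@unit_spinor R d)))).
- rewrite -trunc_cst1; apply: truncation_trunc; exact: tcont_cst.
- rewrite -trunc_cst1 symbol_trunc; last exact: tcont_cst.
  rewrite (_ : fejer m _ = fun=> 1); first exact: torus_state_cst1.
  apply/funext => x; rewrite -[RHS](_ : fejer m (tchar 0) x = 1).
    by congr (fejer m _ x); apply/funext => y; rewrite tchar_0l.
  by rewrite fejer_tchar fejer_weight0 tchar_0l mul1r.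
move=> phi h; exists phi => f tf; rewrite h ?symbol_trunc//; exact: truncation_trunc.
Qed.

(** The truncated state [T |-> psi (sigma T)], with [sigma T] the symbol of [T]. *)
Definition symbol_pullback psi := sval (symbol_pullback_subproof psi).

Lemma symbol_pullbackE psi (f : X -> C) : tcont f ->
  state_val (symbol_pullback psi) (trunc L f) = state_val psi (fejer m f).
Proof. exact: (svalP (symbol_pullback_subproof psi)). Qed.

End Symbol.

End TruncatedStates.

(** * Convergence of the state spaces *)

Lemma normc_chain (R : realType) (p p1 q q1 : R[i]) (a b : R) :
  normc (p - p1) <= a -> normc (q - q1) <= a -> normc (p1 - q1) <= b ->
  normc (p - q) <= b + 2 * a.
Proof.
move=> h1 h2 h3; have -> : p - q = (p1 - q1) + ((p - p1) - (q - q1)) by ring.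
rewrite (le_trans (le_normcD _ _))// lerD// (le_trans (le_normcD _ _))// normcN; lra.
Qed.

Section Distances.
Context {R : realType} {d : nat}.
Local Notation C := R[i].
Local Notation X := 'rV[R]_d.
Variable gam : 'I_d -> 'M[C]_(2 ^ d./2).
Hypothesis gam_clifford : clifford gam.
Local Notation smooth f := (torus_smooth (f : X -> R[i]^o)).

(** Compress in a large ball, where Fejer means are Lipschitz, and let the ball
    grow. *)
Lemma dlip_lipschitz f l : 0 <= l -> smooth f -> (dlip gam f <= l%:E)%E -> lipschitz l f.
Proof.
move=> l0 sf fl x z; have tf := smooth_tcont sf.
suff h e : 0 < e -> `|complex.Re (f (x + z)) - complex.Re (f x)| <= l * \sum_i `|z 0 i| + e /\
    `|complex.Im (f (x + z)) - complex.Im (f x)| <= l * \sum_i `|z 0 i| + e.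
  by split; apply/ler_addgt0Pr => e /h[].
move=> e0; have e2 : 0 < e / 2 by rewrite divr_gt0.
have [m /(_ m (leqnn m)) hm] := fejer_uniform tf e2.
have [g [tg dg]] := smooth_deriv sf.
have fl' := tlip_le_dlip (d * m)%:R l0 tf tg dg fl.
have [h1 h2] := lipschitz_fejer (lexx _) gam_clifford l0 tf fl' x z.
split.
  have := le_trans (normc_Re _) (hm x); have := le_trans (normc_Re _) (hm (x + z)).
  move: h1; rewrite !reimE !ler_norml => /andP[? ?] /andP[? ?] /andP[? ?].
  by apply/andP; split; lra.
have := le_trans (normc_Im _) (hm x); have := le_trans (normc_Im _) (hm (x + z)).
move: h2; rewrite !reimE !ler_norml => /andP[? ?] /andP[? ?] /andP[? ?].
by apply/andP; split; lra.
Qed.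

Lemma torus_oscillation f l x : 0 <= l -> smooth f -> (dlip gam f <= l%:E)%E ->
  normc (f x - f 0) <= 2 * (l * (d%:R * pi)).
Proof.
move=> l0 sf fl; have [z [n [zpi ->]]] := torus_rep 0 x.
have [pf _] := sf; rewrite pf.
have Z : l * \sum_i `|z 0 i| <= l * (d%:R * pi).
  rewrite ler_wpM2l// (le_trans (ler_sum _ (fun i _ => zpi i)))//.
  by rewrite sumr_const card_ord mulr_natl.
have [h1 h2] := dlip_lipschitz l0 sf fl 0 z.
rewrite (le_trans (normc_le_ReIm _))// !reimE mulr_natl mulr2n.
by apply: lerD; [exact: le_trans h1 Z|exact: le_trans h2 Z].
Qed.

(** A torus state differs from evaluation at the origin by at most the
    oscillation, and the torus has finite diameter. *)
Lemma torus_states_bounded (psi psi' : @torus_state R d) f l :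
  0 <= l -> smooth f -> (dlip gam f <= l%:E)%E ->
  normc (state_val psi f - state_val psi' f) <= l * (8 * (d%:R * pi)).
Proof.
move=> l0 sf fl; have tf := smooth_tcont sf.
have b (chi : @torus_state R d) : normc (state_val chi f - f 0) <= 2 * (2 * (l * (d%:R * pi))).
  rewrite -[X in _ - X](torus_state_cst chi) -[X in normc X]torus_stateB//; last exact: tcont_cst.
  apply: torus_state_bound => [|x]; last exact: torus_oscillation.
  by apply: tcontB => //; exact: tcont_cst.
have -> : state_val psi f - state_val psi' f = (state_val psi f - f 0) - (state_val psi' f - f 0) by ring.
rewrite (le_trans (le_normcD _ _))// normcN; have := b psi; have := b psi'; lra.
Qed.

Definition tdist (psi psi' : @torus_state R d) : R := fine (torus_dist gam psi psi').

Lemma torus_dist_fin (psi psi' : @torus_state R d) : (torus_dist gam psi psi' < +oo)%E.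
Proof.
apply: (@le_lt_trans _ _ (8 * (d%:R * pi))%:E); last exact: ltry.
apply: connes_dist_le => [|f _ [sf fl]]; first by rewrite !mulr_ge0// pi_ge0.
rewrite -[leRHS]mul1r; apply: torus_states_bounded => //.
by rewrite /dlip fl.
Qed.

Lemma tdistE psi psi' : torus_dist gam psi psi' = (tdist psi psi')%:E.
Proof. by rewrite fineK// ge0_fin_numE ?torus_dist_fin ?connes_dist_ge0. Qed.

Lemma tdist_ge0 psi psi' : 0 <= tdist psi psi'.
Proof. by rewrite -lee_fin -tdistE connes_dist_ge0. Qed.

Lemma tdist_bound psi psi' f l : 0 <= l -> smooth f -> (dlip gam f <= l%:E)%E ->
  normc (state_val psi f - state_val psi' f) <= l * tdist psi psi'.
Proof.
move=> l0 sf fl.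
apply: (@homogeneous_bound R (X -> C) (fun f => smooth f) (dlip gam)
   (fun r f x => r%:C * f x) (fun f => normc (state_val psi f - state_val psi' f))) => //.
- by move=> r g _; exact: smooth_scale.
- by move=> r g c r0 c0 /smooth_tcont tg; exact: dlip_scale.
- move=> r g r0 _; apply/funext => x; rewrite mulrA -real_complexM mulVf ?gt_eqF//.
  by rewrite mul1r.
- move=> r g r0 /smooth_tcont tg.
  by rewrite !torus_stateZ// -mulrBr normcM normc_real gtr0_norm.
- move=> g sg g1; rewrite -lee_fin -tdistE; apply: le_connes_dist => //.
  exact: smooth_tcont.
- move=> g sg g0; rewrite -[leRHS](mul0r (8 * (d%:R * pi))).
  exact: torus_states_bounded.
- exact: tdist_ge0.
Qed.

(** States at distance zero agree on all Fejer means, whose Lipschitz seminorms are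
    finite, and hence on their uniform limits. *)
Lemma tdist_eq0 psi psi' : torus_dist gam psi psi' = 0%E -> psi = psi'.
Proof.
rewrite tdistE => -[h0]; apply: state_ext => f tf.
have hm m : state_val psi (fejer m f) = state_val psi' (fejer m f).
  have := tlip_fin gam (d * m)%:R tf => lf.
  have [l l0 fl] : exists2 l, 0 <= l & (tlip gam (d * m)%:R (trunc (d * m)%:R f) <= l%:E)%E.
    case: (tlip _ _ _) lf => [l _|//|_]; last by exists 0; rewrite ?leNye.
    by exists (Num.max 0 l); rewrite ?lee_fin le_max lexx ?orbT.
  have := tdist_bound psi psi' l0 (smooth_fejer m f) (dlip_fejer (lexx _) l0 tf fl).
  rewrite h0 mulr0 => h; apply/eqP; rewrite -subr_eq0; apply/eqP; apply: eq0_normc.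
  by apply/eqP; rewrite eq_le h normc_ge0.
apply/eqP; rewrite -subr_eq0; apply/eqP; apply: eq0_normc.
apply/eqP; rewrite eq_le normc_ge0 andbT; apply/ler_addgt0Pr => e e0.
have e4 : 0 < e / 4 by rewrite divr_gt0.
have [m /(_ m (leqnn m)) fm] := fejer_uniform tf e4.
have b (chi : @torus_state R d) : normc (state_val chi f - state_val chi (fejer m f)) <= 2 * (e / 4).
  rewrite -[X in normc X]torus_stateB//; last exact: tcont_fejer.
  by apply: torus_state_bound => //; apply: tcontB => //; exact: tcont_fejer.
have -> : state_val psi f - state_val psi' f = (state_val psi f - state_val psi (fejer m f)) -
    (state_val psi' f - state_val psi' (fejer m f)) by rewrite hm; ring.
rewrite (le_trans (le_normcD _ _))// normcN; have := b psi; have := b psi'; lra.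
Qed.

Lemma tdist_metric : is_metric tdist.
Proof. by apply: connes_dist_metric; [exact: torus_dist_fin|exact: tdist_eq0]. Qed.

Section Truncated.
Variables (L : R) (m : nat) (e : R).
Hypotheses (mL : (d * m)%:R <= L) (epi : 0 < e <= pi).
Local Notation F := (@compression_pullback R d L).
Local Notation rho := (fejer_rate (d:=d) e m).

(** A state changes by at most a multiple of the Fejer rate when [f] is replaced
    by its Fejer mean in the compression, and the Lipschitz seminorm of the Fejer
    mean on the torus is at most that of the compression. *)
Lemma truncated_states_bound (phi phi' : @truncated_state R d L) f l : 0 <= l -> tcont f ->
  (tlip gam L (trunc L f) <= l%:E)%E ->
  normc (state_val phi (trunc L f) - state_val phi' (trunc L f)) <= l * (tdist (F phi) (F phi') + 4 * rho).
Proof.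
move=> l0 tf fl; have tfm := tcont_fejer m f.
have b (chi : @truncated_state R d L) :
    normc (state_val chi (trunc L f) - state_val chi (trunc L (fejer m f))) <= 2 * (l * rho).
  have tfg := tcontB tf tfm.
  rewrite -[X in normc X](truncated_stateB chi tf tfm); apply: truncated_state_bound => // a.
  rewrite (_ : qform _ _ _ _ = qform L f a 0 - qform L (fejer m f) a 0).
    exact: (@qform_fejer_le R d gam L m gam_clifford f l l0 tf fl e a epi).
  rewrite addrC -[X in X + _]mulN1r -qform_lin//; congr (qform _ _ _ _).
  by apply/funext => x; rewrite mulN1r addrC.
have fejl := dlip_fejer mL l0 tf fl.
have h := tdist_bound (F phi) (F phi') l0 (smooth_fejer m f) fejl.
have E (chi : @truncated_state R d L) := compression_pullbackE chi tfm.
have : normc (state_val phi (trunc L (fejer m f)) - state_val phi' (trunc L (fejer m f))) <=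
    l * tdist (F phi) (F phi') by rewrite -(E phi) -(E phi').
move=> h1; apply: le_trans (normc_chain (b phi) (b phi') h1) _.
by rewrite mulrDr; lra.
Qed.

Definition tdistL (phi phi' : @truncated_state R d L) : R := fine (truncated_dist gam phi phi').

Lemma truncated_dist_le (phi phi' : @truncated_state R d L) :
  (truncated_dist gam phi phi' <= (tdist (F phi) (F phi') + 4 * rho)%:E)%E.
Proof.
apply: connes_dist_le => [|T /truncationP[f sf ->] Tl].
  by rewrite addr_ge0 ?tdist_ge0// mulr_ge0// fejer_rate_ge0.
rewrite -[leRHS]mul1r; apply: truncated_states_bound => //; first exact: smooth_tcont.
by rewrite /tlip Tl.
Qed.

Lemma truncated_dist_fin (phi phi' : @truncated_state R d L) :
  (truncated_dist gam phi phi' < +oo)%E.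
Proof. exact: le_lt_trans (truncated_dist_le phi phi') (ltry _). Qed.

Lemma tdistLE phi phi' : truncated_dist gam phi phi' = (tdistL phi phi')%:E.
Proof. by rewrite fineK// ge0_fin_numE ?truncated_dist_fin ?connes_dist_ge0. Qed.

Lemma tdistL_ge0 phi phi' : 0 <= tdistL phi phi'.
Proof. by rewrite -lee_fin -tdistLE connes_dist_ge0. Qed.

Lemma tdistL_le phi phi' : tdistL phi phi' <= tdist (F phi) (F phi') + 4 * rho.
Proof. by rewrite -lee_fin -tdistLE truncated_dist_le. Qed.

Lemma tdistL_bound (phi phi' : @truncated_state R d L) f l : 0 <= l -> tcont f ->
  (tlip gam L (trunc L f) <= l%:E)%E ->
  normc (state_val phi (trunc L f) - state_val phi' (trunc L f)) <= l * tdistL phi phi'.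
Proof.
move=> l0 tf fl.
apply: (@homogeneous_bound R (X -> C) tcont (fun f => tlip gam L (trunc L f))
   (fun r f x => r%:C * f x)
   (fun f => normc (state_val phi (trunc L f) - state_val phi' (trunc L f)))) => //.
- by move=> r g _; exact: tcontZ.
- by move=> r g c r0 c0 tg; exact: tlip_scale.
- move=> r g r0 _; apply/funext => x; rewrite mulrA -real_complexM mulVf ?gt_eqF//.
  by rewrite mul1r.
- move=> r g r0 tg.
  apply: eq_trans (f_equal2 (fun u v => normc (u - v))
    (truncated_stateZ phi r%:C tg) (truncated_stateZ phi' r%:C tg)) _.
  by rewrite -mulrBr normcM normc_real gtr0_norm.
- move=> g tg g1; rewrite -lee_fin -tdistLE; apply: le_connes_dist => //.
  exact: truncation_trunc.
- move=> g tg g0; rewrite -[leRHS](mul0r (tdist (F phi) (F phi') + 4 * rho)).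
  exact: truncated_states_bound.
- exact: tdistL_ge0.
Qed.

Lemma tdistL_eq0 (phi phi' : @truncated_state R d L) : truncated_dist gam phi phi' = 0%E -> phi = phi'.
Proof.
rewrite tdistLE => -[h0]; apply: state_ext => T /truncationP[f sf ->].
have tf := smooth_tcont sf; have lf := tlip_fin gam L tf.
have [l l0 fl] : exists2 l, 0 <= l & (tlip gam L (trunc L f) <= l%:E)%E.
  case: (tlip _ _ _) lf => [l _|//|_]; last by exists 0; rewrite ?leNye.
  by exists (Num.max 0 l); rewrite ?lee_fin le_max lexx ?orbT.
have := tdistL_bound phi phi' l0 tf fl; rewrite h0 mulr0 => h.
apply/eqP; rewrite -subr_eq0; apply/eqP; apply: eq0_normc.
by apply/eqP; rewrite eq_le h normc_ge0.
Qed.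

Lemma tdistL_metric : is_metric tdistL.
Proof. by apply: connes_dist_metric; [exact: truncated_dist_fin|exact: tdistL_eq0]. Qed.

(** Compression does not increase the Lipschitz seminorm. *)
Lemma compression_pullback_contract phi phi' : tdist (F phi) (F phi') <= tdistL phi phi'.
Proof.
rewrite -lee_fin -tdistE; apply: connes_dist_le => [|f tf [sf fl]]; first exact: tdistL_ge0.
have [g [tg dg]] := smooth_deriv sf.
rewrite (compression_pullbackE phi tf) (compression_pullbackE phi' tf) -[leRHS]mul1r.
apply: tdistL_bound => //; apply: (tlip_le_dlip L ler01 tf tg dg).
by rewrite /dlip fl.
Qed.

(** The truncated state [T |-> psi (sigma T)] pulls back to [f |-> psi (fejer m f)],
    and Fejer means are uniformly close to Lipschitz functions. *)
Lemma compression_pullback_dense psi : exists phi, tdist (F phi) psi <= 2 * rho.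
Proof.
exists (symbol_pullback mL psi); rewrite -lee_fin -tdistE.
apply: connes_dist_le => [|f tf [sf fl]]; first by rewrite mulr_ge0// fejer_rate_ge0.
have fl' : (dlip gam f <= 1%:E)%E by rewrite /dlip fl.
rewrite (compression_pullbackE _ tf) (symbol_pullbackE mL psi tf) -normcN opprB.
rewrite -[X in normc X]torus_stateB//; last exact: tcont_fejer.
apply: torus_state_bound => [|x].
  by apply: tcontB => //; exact: tcont_fejer.
by rewrite -[leRHS]mul1r; apply: fejer_lip => //; exact: dlip_lipschitz.
Qed.

Lemma gh_dist_rate (r : R) : 0 < r -> rho <= r ->
  (gh_dist (truncated_dist gam (L:=L)) (torus_dist gam) <= (4 * r)%:E)%E.
Proof.
move=> r0 rr; have -> : 4 * r = 2 * (2 * r) by ring.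
apply: (@gh_dist_le R _ _ tdistL tdist F) => //.
- by rewrite mulr_gt0.
- exact: tdistL_metric.
- exact: tdist_metric.
- exact: compression_pullback_contract.
- move=> phi phi'; rewrite (le_trans (tdistL_le _ _))// lerD2l; lra.
- exact: tdistLE.
- exact: tdistE.
- move=> psi; have [phi h] := compression_pullback_dense psi; exists phi.
  by rewrite (le_trans h)// ler_wpM2l.
Qed.

End Truncated.
End Distances.

Theorem theorem3p10 (R : realType) (d : nat) (d_ge1 : (1 <= d)%N)
    (gam : 'I_d -> 'M[R[i]]_(2 ^ d./2)) (gam_clifford : clifford gam) :
  gh_dist (truncated_dist gam (L:=L)) (torus_dist gam) @[L --> +oo] --> (0 : \bar R).
Proof.
have bound (r : R) : 0 < r -> \forall L \near +oo,
    (gh_dist (truncated_dist gam (L:=L)) (torus_dist gam) <= r%:E)%E.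
  move=> r0; have r4 : 0 < r / 4 by rewrite divr_gt0.
  have [e epi [m em]] := fejer_rate_small (d:=d) r4.
  near=> L; have mL : (d * m)%:R <= L by near: L; exact: nbhs_pinfty_ge.
  have := gh_dist_rate gam_clifford mL epi r4 em.
  by have -> : 4 * (r / 4) = r by lra.
apply/fine_cvgP; split.
  near=> L; rewrite ge0_fin_numE ?gh_dist_ge0//; apply: (@le_lt_trans _ _ 1%:E); last exact: ltry.
  by near: L; exact: bound.
apply/cvgrPdist_le => r r0; near=> L.
have h : (gh_dist (truncated_dist gam (L:=L)) (torus_dist gam) <= r%:E)%E.
  by near: L; exact: bound.
have := gh_dist_ge0 (truncated_dist gam (L:=L)) (torus_dist gam).
rewrite sub0r normrN /=; case: gh_dist h => [g||]//=; rewrite !lee_fin => gr g0.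
by rewrite ger0_norm.
Unshelve. all: by end_near.
Qed.
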